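(* Let $\Gamma=\Gamma_5$ be the Fermat curve $x^6+y^6+z^6=0$ in characteristic $5$, with automorphism group $\mathrm{PGU}_3(\mathbb{F}_{25})$, and let $\mathcal{D}$ be the set of connected components of the graph $G$ on the set $\mathcal{Q}$ of non-singular conics totally tangent to $\Gamma$. Let $D$ and $D'$ be distinct elements of $\mathcal{D}$. Identify $\mathrm{stab}(D)$ with $\mathfrak{A}_7$ through its action on the graph $D\cong T(7)$. Then $T(D,D')$ is $$\begin{cases}\beta^{21} & \text{if and only if } \mathrm{stab}(D)\cap\mathrm{stab}(D') \text{ is conjugate in } \mathfrak{A}_7 \text{ to } \Sigma_b \text{ or } \Sigma_b',\\ \gamma^{21} & \text{if and only if } \mathrm{stab}(D)\cap\mathrm{stab}(D') \text{ is conjugate in } \mathfrak{A}_7 \text{ to } \Sigma_d,\\ \alpha^{15}\gamma^{6} & \text{if and only if } \mathrm{stab}(D)\cap\mathrm{stab}(D') \text{ is conjugate in } \mathfrak{A}_7 \text{ to } \Sigma_a,\\ \alpha^{3}\gamma^{18} & \text{if and only if } \mathrm{stab}(D)\cap\mathrm{stab}(D') \text{ is conjugate in } \mathfrak{A}_7 \text{ to } \Sigma_c.\end{cases}$$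
   Context: Work over an algebraically closed field $k$ of characteristic $5$. $\Gamma=\Gamma_5\subset\mathbb{P}^2$ is the curve $x^6+y^6+z^6=0$; its automorphism group $\{g\in\mathrm{PGL}_3(k)\mid g(\Gamma)=\Gamma\}$ is $\mathrm{PGU}_3(\mathbb{F}_{25})$, of order $378000$. $\mathcal{P}$ denotes the set of Weierstrass points of $\Gamma$; equivalently, the set of $\mathbb{F}_{25}$-rational points of $\Gamma_5$; $|\mathcal{P}|=126$. A line of $\mathbb{P}^2$ is a special secant line of $\Gamma$ if it passes through two distinct points of $\mathcal{P}$. A non-singular conic $Q\subset\mathbb{P}^2$ is totally tangent to $\Gamma$ if $Q$ meets $\Gamma$ at six distinct points, each with intersection multiplicity $2$. $\mathcal{Q}$ denotes the set of all such conics; one has $|\mathcal{Q}|=3150$ and $Q\cap\Gamma\subset\mathcal{P}$ for $Q\in\mathcal{Q}$. For $Q\in\mathcal{Q}$, $\mathcal{S}(Q)$ is the set of the $15$ special secant lines of $\Gamma$ passing through two distinct points of $Q\cap\Gamma$. $G$ is the graph with vertex set $\mathcal{Q}$ in which distinct $Q,Q'$ are adjacent if and only if $|Q\cap Q'|=4$ and $|\mathcal{S}(Q)\cap\mathcal{S}(Q')|=3$. $\mathcal{D}$ is the set of connected components of $G$ (there are $150$ of them); each $D\in\mathcal{D}$ is regarded as a subset of $\mathcal{Q}$ ($21$ conics), and as a graph it is isomorphic to the triangular graph $T(7)$ (vertices: unordered pairs of distinct elements of $\{1,\dots,7\}$; distinct pairs adjacent iff they meet), with $\mathrm{Aut}(T(7))\cong\mathfrak{S}_7$.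 For $Q\in\mathcal{Q}$ and $D'\in\mathcal{D}$ with $Q\notin D'$, the type $t(Q,D')\in\{\alpha,\beta,\gamma\}$ is defined by the values of $|Q\cap Q'\cap\Gamma|$ as $Q'$ runs over the $21$ conics of $D'$: $t(Q,D')=\alpha$ if the value is $2$ for $3$ conics and $0$ for $18$; $t(Q,D')=\beta$ if it is $2$ for $1$ conic, $1$ for $4$ conics and $0$ for $16$; $t(Q,D')=\gamma$ if it is $1$ for $6$ conics and $0$ for $15$. (One of these three cases always occurs.) For distinct $D,D'\in\mathcal{D}$, the type $T(D,D')$ is: $\beta^{21}$ if $t(Q,D')=\beta$ for all $Q\in D$; $\gamma^{21}$ if $t(Q,D')=\gamma$ for all $Q\in D$; $\alpha^{15}\gamma^{6}$ if $t(Q,D')=\alpha$ for $15$ conics $Q\in D$ and $\gamma$ for the other $6$; $\alpha^{3}\gamma^{18}$ if $t(Q,D')=\alpha$ for $3$ conics $Q\in D$ and $\gamma$ for the other $18$. (One of these four cases always occurs, and $T(D,D')=T(D',D)$.) $\mathrm{stab}(D)$ is the stabilizer of $D$ in $\mathrm{PGU}_3(\mathbb{F}_{25})$. Its action on $D\cong T(7)$ is faithful with image $\mathfrak{A}_7\subset\mathfrak{S}_7\cong\mathrm{Aut}(T(7))$; this identifies $\mathrm{stab}(D)$ with $\mathfrak{A}_7$, uniquely up to conjugation by elements of $\mathfrak{S}_7$ (the statement does not depend on the choice). Subgroups of $\mathfrak{A}_7$ (acting on $\{1,\dots,7\}$): (a) $\Sigma_a:=\{g\in\mathfrak{A}_7\mid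 g(7)=7\}\cong\mathfrak{A}_6$. (b) Let $\rho:\mathbb{P}^2(\mathbb{F}_2)\to\{1,\dots,7\}$ be the bijection $(a:b:c)\mapsto 4a+2b+c$ ($a,b,c\in\{0,1\}$), and let $\rho'$ be the composite of $\rho$ and the transposition $(67)$. The action of $\mathrm{PSL}_3(\mathbb{F}_2)$ on $\mathbb{P}^2(\mathbb{F}_2)$ gives, via $\rho$ and $\rho'$, two faithful permutation representations $\mathrm{PSL}_3(\mathbb{F}_2)\hookrightarrow\mathfrak{S}_7$; their images, which are contained in $\mathfrak{A}_7$ and have order $168$, are $\Sigma_b$ and $\Sigma_b'$ respectively. (c) $\Sigma_c:=\{g\in\mathfrak{A}_7\mid\{g(5),g(6),g(7)\}=\{5,6,7\}\}$, of order $72$. (d) $\Sigma_d:=\{g\in\mathfrak{A}_7\mid g(7)=7,\ g(t_0)=t_0\}\cong\mathfrak{A}_5$, where $t_0$ is the set of five partitions of $\{1,\dots,6\}$ into pairs $$\begin{aligned}t_0:=\{&\{\{1,2\},\{3,4\},\{5,6\}\},\ \{\{1,3\},\{2,5\},\{4,6\}\},\ \{\{1,4\},\{2,6\},\{3,5\}\},\\ &\{\{1,5\},\{2,4\},\{3,6\}\},\ \{\{1,6\},\{2,3\},\{4,5\}\}\}.\end{aligned}$$ *)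

(* Defs.v *)
From HB Require Import structures.
From Stdlib Require Import Relation_Operators.
From mathcomp Require Import all_boot all_order all_fingroup all_algebra.
From mathcomp Require Import all_solvable.
From mathcomp Require Import boolp classical_sets functions cardinality.
From mathcomp Require Import fraction mpoly.

Set Implicit Arguments.
Unset Strict Implicit.
Unset Printing Implicit Defensive.

Import GRing.Theory.

Local Notation "x %:F" := (@FracField.tofrac _ x) : ring_scope.

Local Open Scope classical_set_scope.
Local Open Scope card_scope.
Local Open Scope ring_scope.

(* P^2(k) is the set of 1-dimensional subspaces of k^3, a line of P^2 is a
   2-dimensional subspace of k^3, and a point P lies on a line L when
   (P <= L)%VS. *)
Notation subsp k := {vspace 'rV[k]_3}.

Definition evalv (k : fieldType) (F : {mpoly k[3]}) (v : 'rV[k]_3) : k :=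
  F.@[fun i => v 0 i].

(* Only meant for homogeneous F. *)
Definition zeros (k : fieldType) (F : {mpoly k[3]}) : set (subsp k) :=
  [set P | \dim P = 1%N /\ forall v, v \in P -> evalv F v = 0].

Definition fermat (k : fieldType) : {mpoly k[3]} := \sum_(i < 3) 'X_i ^+ 6.

Definition Gamma (k : fieldType) : set (subsp k) := zeros (fermat k).

(* The F_25-rational points of Gamma; F_25 is the set of roots of t^25 - t. *)
Definition rational_pts (k : fieldType) : set (subsp k) :=
  [set P | Gamma P /\
     exists2 v, P = <[v]>%VS & forall i, v 0 i ^+ 25 = v 0 i].

Definition passes_two (k : fieldType) (A : set (subsp k)) (L : subsp k) : Prop :=
  exists P1 P2, [/\ A P1, A P2, P1 <> P2, (P1 <= L)%VS & (P2 <= L)%VS].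

Definition special_secant (k : fieldType) : set (subsp k) :=
  [set L | \dim L = 2%N /\ passes_two (@rational_pts k) L].

(* The local ring O_P of P^2 at P inside Frac k[x,y,z]: fractions a/b of forms
   of the same degree with b(P) <> 0. *)
Definition local_ring (k : fieldType) (P : subsp k) :
    set {fraction {mpoly k[3]}} :=
  [set x | exists d (a b : {mpoly k[3]}),
     [/\ a \is d.-homog, b \is d.-homog,
         exists2 v, v \in P & evalv b v != 0 & x = a%:F / b%:F]].

(* The ideal of O_P generated by the local equations of the forms F and G. *)
Definition local_ideal (k : fieldType) (F G : {mpoly k[3]}) (P : subsp k) :
    set {fraction {mpoly k[3]}} :=
  [set x | exists d (a b : {mpoly k[3]}),
     [/\ a \is d.-homog, b \is d.-homog,
         exists2 v, v \in P & evalv b v != 0,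
         exists h l, a = F * h + G * l & x = a%:F / b%:F]].

(* dim_k O_P / (F, G) = n: some e_1, ..., e_n in O_P induce a k-basis of the
   quotient. *)
Definition intersection_mult (k : fieldType) (F G : {mpoly k[3]})
    (P : subsp k) (n : nat) : Prop :=
  exists e : 'I_n -> {fraction {mpoly k[3]}},
    (forall i, local_ring P (e i)) /\
    forall x, local_ring P x ->
      exists! c : {ffun 'I_n -> k},
        local_ideal F G P (x - \sum_(i < n) (c i)%:MP_[3]%:F * e i).

Definition nonsingular_conic_form (k : fieldType) (q : {mpoly k[3]}) : Prop :=
  q \is 2.-homog /\
  forall v : 'rV[k]_3, v != 0 -> evalv q v = 0 ->
    exists i, evalv (q^`M(i)) v != 0.

(* Over an algebraically closed field a non-singular conic has, up to scalars,
   only one quadratic equation, so conics are represented by their point sets. *)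
Definition tt_conics (k : fieldType) : set (set (subsp k)) :=
  [set Q | exists q, [/\ nonsingular_conic_form q, Q = zeros q,
     Q `&` @Gamma k #= `I_6 &
     forall P, (Q `&` @Gamma k) P -> intersection_mult q (fermat k) P 2]].

Definition secants (k : fieldType) (Q : set (subsp k)) : set (subsp k) :=
  [set L | special_secant L /\ passes_two (Q `&` @Gamma k) L].

Definition adj (k : fieldType) (Q Q' : set (subsp k)) : Prop :=
  [/\ tt_conics Q, tt_conics Q', Q <> Q', Q `&` Q' #= `I_4 &
      secants Q `&` secants Q' #= `I_3].

Definition components (k : fieldType) : set (set (set (subsp k))) :=
  [set D | exists2 Q, tt_conics Q & D = clos_refl_trans _ (@adj k) Q].

Inductive ttype := alpha | beta | gamma.

Inductive Ttype := beta21 | gamma21 | alpha15_gamma6 | alpha3_gamma18.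

(* Conics Q' in D' with |Q \cap Q' \cap Gamma| = n *)
Definition meeting (k : fieldType) (Q : set (subsp k)) (D' : set (set (subsp k)))
    (n : nat) : set (set (subsp k)) :=
  [set Q' | D' Q' /\ Q `&` Q' `&` @Gamma k #= `I_n].

Definition t_is (k : fieldType) (Q : set (subsp k)) (D' : set (set (subsp k)))
    (t : ttype) : Prop :=
  match t with
  | alpha => meeting Q D' 2 #= `I_3 /\ meeting Q D' 0 #= `I_18
  | beta => [/\ meeting Q D' 2 #= `I_1, meeting Q D' 1 #= `I_4 &
                meeting Q D' 0 #= `I_16]
  | gamma => meeting Q D' 1 #= `I_6 /\ meeting Q D' 0 #= `I_15
  end.

Definition of_t (k : fieldType) (D D' : set (set (subsp k))) (t : ttype) :
    set (set (subsp k)) :=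
  [set Q | D Q /\ t_is Q D' t].

Definition T_is (k : fieldType) (D D' : set (set (subsp k))) (T : Ttype) : Prop :=
  match T with
  | beta21 => forall Q, D Q -> t_is Q D' beta
  | gamma21 => forall Q, D Q -> t_is Q D' gamma
  | alpha15_gamma6 => of_t D D' alpha #= `I_15 /\ of_t D D' gamma #= `I_6
  | alpha3_gamma18 => of_t D D' alpha #= `I_3 /\ of_t D D' gamma #= `I_18
  end.

(* Elements of PGL_3(k) are handled through their lifts to GL_3(k), seen as
   linear automorphisms of k^3. *)
Definition act (k : fieldType) (g : 'End('rV[k]_3)) (C : set (subsp k)) :
    set (subsp k) :=
  [set (g @: P)%VS | P in C].

Definition Aut_Gamma (k : fieldType) : set 'End('rV[k]_3) :=
  [set g | lker g = 0%VS /\ act g (@Gamma k) = @Gamma k].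

Definition stab (k : fieldType) (D : set (set (subsp k))) : set 'End('rV[k]_3) :=
  [set g | Aut_Gamma g /\ [set act g Q | Q in D] = D].

(* The set {1, ..., 7} is 'I_7, the label i being the ordinal i - 1. *)
Definition lab (i : nat) : 'I_7 := inord i.-1.

Definition T7_iso (k : fieldType) (D : set (set (subsp k)))
    (phi : set (subsp k) -> {set 'I_7}) : Prop :=
  set_bij D [set A : {set 'I_7} | #|A| = 2%N] phi /\
  forall Q Q', D Q -> D Q' ->
    (adj Q Q' <-> phi Q != phi Q' /\ phi Q :&: phi Q' != finset.set0).

(* The permutations of {1, ..., 7} through which the elements of H act on
   D = T(7). *)
Definition perm_image (k : fieldType) (D : set (set (subsp k)))
    (phi : set (subsp k) -> {set 'I_7}) (H : set 'End('rV[k]_3)) : {set 'S_7} :=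
  finset (fun s : 'S_7 => `[< exists2 g, H g &
    forall Q, D Q -> phi (act g Q) = imset s (mem (phi Q)) >]).

Definition A7_conj (H S : {set 'S_7}) : Prop :=
  exists2 s, s \in ('Alt_('I_7))%g & H = (S :^ s)%g.

Definition Sigma_a : {set 'S_7} :=
  ([set s in ('Alt_('I_7))%g | s (lab 7) == lab 7])%SET.

(* A point of P^2(F_2) is a nonzero vector of F_2^3. *)
Definition rho (v : 'rV['F_2]_3) : 'I_7 :=
  lab (4 * v 0 ord0 + 2 * v 0 (inord 1) + v 0 (inord 2)).

Definition rho' (v : 'rV['F_2]_3) : 'I_7 := tperm (lab 6) (lab 7) (rho v).

Definition PSL32_image (r : 'rV['F_2]_3 -> 'I_7) : {set 'S_7} :=
  ([set s : 'S_7 | [exists A : 'M['F_2]_3, (\det A == 1) &&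
     [forall v : 'rV['F_2]_3, (v != 0) ==> (s (r v) == r (v *m A))]]])%SET.

Definition Sigma_b : {set 'S_7} := PSL32_image rho.

Definition Sigma_b' : {set 'S_7} := PSL32_image rho'.

Definition Sigma_c : {set 'S_7} :=
  let B := [set lab 5; lab 6; lab 7]%SET in
  ([set s in ('Alt_('I_7))%g | imset (s : 'S_7) (mem B) == B])%SET.

Definition pairs3 (a b c d e f : nat) : {set {set 'I_7}} :=
  ([set [set lab a; lab b]; [set lab c; lab d]; [set lab e; lab f]])%SET.

Definition t0 : {set {set {set 'I_7}}} :=
  ([set:: [:: pairs3 1 2 3 4 5 6; pairs3 1 3 2 5 4 6; pairs3 1 4 2 6 3 5;
              pairs3 1 5 2 4 3 6; pairs3 1 6 2 3 4 5]])%SET.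

Definition Sigma_d : {set 'S_7} :=
  ([set s in ('Alt_('I_7))%g | (s (lab 7) == lab 7) &&
     ([set [set [set s i | i in B] | B : {set 'I_7} in p]
         | p : {set {set 'I_7}} in t0] == t0)])%SET.

(* Main.v *)
(* Let H(v, w) = sum_i v_i^5 w_i, so that Gamma is H(v, v) = 0 and its tangent at v
   is H(v, .) = 0. Take two contact points of a totally tangent conic Q as e0 and e2
   and the pole of the line joining them as e1, so that Q is parametrized by
   s^2 e0 + s e1 + e2. Tangency at the six points makes the restriction of H(v, v)
   to Q a square, and comparing coefficients shows that, after rescaling, the Gram
   matrix of (e0, e1, e2) for H is antidiagonal with entries 1, -2, 1. Hence the
   unitary group acts transitively on these conics, their contact points are
   F_25-rational, and at most six of them pass through two given points, one for
   every sixth root of unity.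

   All conics can therefore be encoded by sets of six indices into the list of the 126
   rational points. Starting from a base conic Q0, a computation with two unitary
   matrices that permute seven labels as (1 2 3) and (1 2 3 4 5 6 7), hence generate
   A_7, produces 21 conics labelled by the pairs of labels. The hypothesis that the
   component D0 of Q0 is isomorphic to T(7) bounds the number of neighbours by 10,
   which shows that these 21 conics are all of D0. An automorphism that fixes Q0 and
   three of its contact points is scalar, so the two matrices generate stab(D0).

   Six further words give representatives of the orbits of A_7 on the other
   components: the 150 components so obtained provide six conics through every pair
   (point 0, point m), so none is missing. The stabilizers of the representatives
   are found by Schreier's lemma and the types by counting. Distinct types have
   non-conjugate stabilizers, as is seen from the existence of a common fixed point
   and of an element with exactly four fixed points. This turns the computed
   implications into equivalences. *)

From HB Require Import structures.
From Stdlib Require Import Relation_Operators.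
Require Import Defs.
From mathcomp Require Import all_boot all_order all_fingroup all_algebra.
From mathcomp Require Import all_solvable.
From mathcomp Require Import boolp.

Set Implicit Arguments.
Unset Strict Implicit.
Unset Printing Implicit Defensive.

Import GroupScope GRing.Theory.
Local Open Scope nat_scope.

(** * The triangular graph T(7) *)

Section TriangularGraph.

(** Adjacency counts all common points of two conics over k, on Gamma or not, so it cannot be read
    off from index sets. It is verified for a single pair of conics, by splitting a quartic and
    comparing secants; the stabilizer of the base conic then carries this edge to ten neighbours,
    which exhaust the possible ones.

    Computations take place on pairs of natural numbers reduced modulo 5. They reach the abstract
    field k through [ev], once a square root of 2 has been chosen in k.

    The given labelling of D agrees with the computed one only up to a permutation of either parity,
    whereas the conclusion speaks of conjugacy in A_7. Each of [Sigma_a], [Sigma_c], [Sigma_d] is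
    normalized by some odd permutation, while (6 7) exchanges [Sigma_b] and [Sigma_b']; this
    accounts for the disjunction in the first case.

    An element of stab(D) is given only as a linear map preserving Gamma. It is compared with a word
    in the generators through its effect on conics and contact points, so it is recovered up to a
    scalar, which acts trivially on point sets. *)

Lemma fresh (s : seq 'I_7) : (size s < 7)%N -> exists d, d \notin s.
Proof.
move=> hs; apply: contrapT => h.
have : {subset enum 'I_7 <= s} by move=> d _; apply: contrapT => /negP hd; apply: h; exists d.
by move=> /(uniq_leq_size (enum_uniq _)); rewrite size_enum_ord leqNgt hs.
Qed.

Lemma pair_eq (X : {set 'I_7}) x y : #|X| = 2 -> x != y -> x \in X -> y \in X -> X = [set x; y].
Proof.
move=> c2 xy xX yX; apply/esym/eqP; rewrite eqEcard c2 cards2 xy andbT.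
by apply/fintype.subsetP => z; rewrite !inE => /orP[]/eqP->.
Qed.

Lemma meeting_pairs (X Y : {set 'I_7}) : #|X| = 2 -> #|Y| = 2 -> X != Y -> X :&: Y != finset.set0 ->
  exists j x y, [/\ X = [set j; x], Y = [set j; y], j != x, j != y & x != y].
Proof.
move=> cX cY ne /set0Pn [j]; rewrite inE => /andP[jX jY].
have [x xX jx] : exists2 x, x \in X & j != x.
  have /card_gt0P [x] : (0 < #|X :\ j|)%N by move: (cardsD1 j X); rewrite cX jX; case: #|_|.
  by rewrite !inE eq_sym => /andP[? ?]; exists x.
have [y yY jy] : exists2 y, y \in Y & j != y.
  have /card_gt0P [y] : (0 < #|Y :\ j|)%N by move: (cardsD1 j Y); rewrite cY jY; case: #|_|.
  by rewrite !inE eq_sym => /andP[? ?]; exists y.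
have XE := pair_eq cX jx jX xX; have YE := pair_eq cY jy jY yY.
exists j, x, y; split=> //; apply: contraNneq ne => xy.
by rewrite XE YE xy.
Qed.

Variable f : {set 'I_7} -> {set 'I_7}.
Hypothesis f2 : forall A : {set 'I_7}, #|A| = 2 -> #|f A| = 2.
Hypothesis f_inj : forall A B : {set 'I_7}, #|A| = 2 -> #|B| = 2 -> f A = f B -> A = B.
Hypothesis f_meet : forall A B : {set 'I_7}, #|A| = 2 -> #|B| = 2 ->
  (A != B /\ A :&: B != finset.set0) <-> (f A != f B /\ f A :&: f B != finset.set0).

Let p i j := f [set i; j].

Let p2 i j : i != j -> #|p i j| = 2.
Proof. by move=> ij; apply: f2; rewrite cards2 ij. Qed.

Let p_meet i a b : i != a -> i != b -> a != b -> p i a != p i b /\ p i a :&: p i b != finset.set0.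
Proof.
move=> ia ib ab; have c2 c : i != c -> #|[set i; c]| = 2 by move=> ic; rewrite cards2 ic.
apply: (proj1 (@f_meet _ _ (c2 _ ia) (c2 _ ib))); split.
  apply: contra ab => /eqP /setP /(_ a); rewrite !inE eqxx orbT eq_sym (negbTE ia).
  by move=> /esym.
by apply/set0Pn; exists i; rewrite !inE eqxx.
Qed.

(** The six pairs through i form a clique of T(7), and a clique with more than three members is a
    star. If two of the images are {j, x} and {j, y} and a third one misses j, it must be the
    triangle side {x, y}; the image of a further pair {i, d} would then repeat one of these
    three. *)
Lemma star_image i : exists j, forall a, i != a -> j \in p i a.
Proof.
have [a ha] := @fresh [:: i] isT; have [b hb] := @fresh [:: i; a] isT.
have ia : i != a by move: ha; rewrite inE eq_sym.
have [ib ab] : i != b /\ a != b by move: hb; rewrite !inE negb_or ![b == _]eq_sym => /andP.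
have [neX meX] := p_meet ia ib ab.
have [j [x [y [XE YE jx jy xy]]]] := meeting_pairs (p2 ia) (p2 ib) neX meX.
exists j => c ic; have [->|ca] := eqVneq c a; first by rewrite XE !inE eqxx.
have [->|cb] := eqVneq c b; first by rewrite YE !inE eqxx.
have third e : i != e -> e != a -> e != b -> j \notin p i e -> p i e = [set x; y].
  move=> ie ea eb je; apply: (pair_eq (p2 ie) xy).
    have [_ /set0Pn [z]] := p_meet ie ia ea; rewrite inE XE !inE => /andP[ze /orP[]/eqP e'].
      by rewrite -e' ze in je.
    by rewrite -e'.
  have [_ /set0Pn [z]] := p_meet ie ib eb; rewrite inE YE !inE => /andP[ze /orP[]/eqP e'].
    by rewrite -e' ze in je.
  by rewrite -e'.
apply: contrapT => /negP jc; have ZE := third c ic ca cb jc.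
have [d] := @fresh [:: i; a; b; c] isT; rewrite !inE !negb_or => /and4P[di da db dc].
have id : i != d by rewrite eq_sym.
have [jd|jd] := boolP (j \in p i d); last first.
  have [] := p_meet id ic dc; rewrite ZE (third d id da db jd) eqxx //.
have [_ /set0Pn [z]] := p_meet id ic dc; rewrite inE ZE !inE => /andP[zd /orP[]/eqP e].
  have [] := p_meet id ia da; rewrite XE (pair_eq (p2 id) jx jd) ?eqxx //.
  by rewrite -e.
have [] := p_meet id ib db; rewrite YE (pair_eq (p2 id) jy jd) ?eqxx //.
by rewrite -e.
Qed.

(** The centre of the image of the star at i defines the permutation. If i and i' had the same
    centre, the disjoint pairs {i, a} and {i', b} would have meeting images. *)
Lemma triangular_aut : exists s : 'S_7, forall A : {set 'I_7}, #|A| = 2 -> f A = [set s i | i in A].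
Proof.
have [s0 hs] := choice star_image.
have s_inj : injective s0.
  move=> i i' e; apply: contrapT => /eqP ii'.
  have [a] := @fresh [:: i; i'] isT; rewrite !inE negb_or => /andP[ai ai'].
  have [b] := @fresh [:: i; i'; a] isT; rewrite !inE !negb_or => /and3P[bi bi' ba].
  have ia : i != a by rewrite eq_sym.
  have ib : i' != b by rewrite eq_sym.
  have : [set i; a] != [set i'; b] /\ [set i; a] :&: [set i'; b] != finset.set0.
    have c2 (c d : 'I_7) : c != d -> #|[set c; d]| = 2 by move=> cd; rewrite cards2 cd.
    apply: (proj2 (@f_meet _ _ (c2 _ _ ia) (c2 _ _ ib))); split.
      apply: contraNneq ii' => /f_inj; rewrite ?cards2 ?ia ?ib // => /(_ erefl erefl) /setP /(_ i).
      by rewrite !inE eqxx /= => /esym /orP[//|/eqP ibb]; rewrite ibb eqxx in bi.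
    by apply/set0Pn; exists (s0 i); rewrite inE hs //= e hs.
  move=> [_ /set0Pn [z]]; rewrite !inE => /andP[/orP[]/eqP-> /orP[]]; rewrite ?(negbTE ii') //.
  - by rewrite eq_sym (negbTE bi).
  - by rewrite (negbTE ai').
  - by rewrite eq_sym (negbTE ba).
exists (perm s_inj) => A cA; have /cards2P [x [y [xy AE]]] : #|A| == 2 by rewrite cA.
have sxy : s0 x != s0 y by rewrite (inj_eq s_inj).
have yx : y != x by rewrite eq_sym.
rewrite AE imsetU !imset_set1 !permE; apply: (pair_eq _ sxy); last 2 first.
- exact: hs.
- by rewrite finset.setUC; apply: hs.
by apply: f2; rewrite cards2 xy.
Qed.
End TriangularGraph.

Lemma perm_pairs_inj (s s' : 'S_7) :
  (forall A : {set 'I_7}, #|A| = 2 -> [set s i | i in A] = [set s' i | i in A]) -> s = s'.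
Proof.
move=> h; apply/permP => i.
have [a] := @fresh [:: i] isT; rewrite inE => ai.
have [b] := @fresh [:: i; a] isT; rewrite !inE negb_or => /andP[bi ba].
have e x : x != i -> s i \in [set s' i; s' x].
  move=> xi; have := h [set i; x]; rewrite cards2 eq_sym xi !imsetU !imset_set1 => <- //.
  by rewrite !inE eqxx.
have := e a ai; have := e b bi; rewrite !inE => /orP[/eqP //|/eqP ->] /orP[]/eqP; first by [].
by move=> /perm_inj e'; rewrite e' eqxx in ba.
Qed.

(** * A finite model over F_25 *)

(* (a, b) stands for a + b r, where r^2 = 2 generates F_25 over F_5. *)
Definition F25 := (nat * nat)%type.
Definition vec := (F25 * F25 * F25)%type.
Definition mat := (vec * vec * vec)%type.

Definition fadd (x y : F25) : F25 := ((x.1 + y.1) %% 5, (x.2 + y.2) %% 5).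
Definition fmul (x y : F25) : F25 :=
  ((x.1 * y.1 + 2 * (x.2 * y.2)) %% 5, (x.1 * y.2 + x.2 * y.1) %% 5).
(** The Frobenius x -> x^5, because r^5 = (r^2)^2 r = 4 r. *)
Definition fconj (x : F25) : F25 := (x.1, (4 * x.2) %% 5).
(** Conjugate divided by the norm n = a^2 - 2 b^2; in F_5 the inverse of n is n^3. *)
Definition finv (x : F25) : F25 :=
  let n := (x.1 * x.1 + 3 * (x.2 * x.2)) %% 5 in fmul ((n * n * n) %% 5, 0) (fconj x).

Definition vscale (c : F25) (v : vec) : vec :=
  let: (x, y, z) := v in (fmul c x, fmul c y, fmul c z).
Definition vadd (v w : vec) : vec :=
  let: (x, y, z) := v in let: (x', y', z') := w in (fadd x x', fadd y y', fadd z z').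
Definition vdot (v w : vec) : F25 :=
  let: (x, y, z) := v in let: (x', y', z') := w in
  fadd (fadd (fmul x x') (fmul y y')) (fmul z z').
Definition vconj (v : vec) : vec := let: (x, y, z) := v in (fconj x, fconj y, fconj z).
Definition vmul (v : vec) (A : mat) : vec :=
  let: (x, y, z) := v in let: (a, b, c) := A in
  vadd (vadd (vscale x a) (vscale y b)) (vscale z c).
Definition vherm (v w : vec) : F25 := vdot (vconj v) w.

Definition lead (v : vec) : F25 :=
  let: (x, y, z) := v in if x != (0, 0) then x else if y != (0, 0) then y else z.
Definition vnorm (v : vec) : vec := vscale (finv (lead v)) v.

Definition F25s : seq F25 := [seq (a, b) | a <- iota 0 5, b <- iota 0 5].
Definition lines25 : seq vec :=
  ((0, 0), (0, 0), (1, 0)) :: [seq ((0, 0), (1, 0), c) | c <- F25s] ++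
  [seq ((1, 0), b, c) | b <- F25s, c <- F25s].
Definition points : seq vec := Eval vm_compute in [seq v <- lines25 | vherm v v == (0, 0)].

Definition vzero : vec := ((0, 0), (0, 0), (0, 0)).
Definition pidx (v : vec) : nat := index (vnorm v) points.

(* n = a + 5 b stands for a + b r. *)
Definition fe (n : nat) : F25 := (n %% 5, n %/ 5).
Definition ve (a b c : nat) : vec := (fe a, fe b, fe c).
(* The base conic is {x M0 | x1^2 = x0 x2}. *)
Definition M0 : mat := (ve 0 1 2, ve 5 0 0, ve 0 3 4).
(* Unitary matrices. The first two generate the stabilizer of the base component
   and permute its seven labels as (1 2 3) and (1 2 3 4 5 6 7), see pis. *)
Definition gens : seq mat :=
  [:: (ve 13 0 0, ve 0 21 8, ve 0 8 21); (ve 13 18 2, ve 8 13 19, ve 19 2 2);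
      (ve 0 0 1, ve 0 12 0, ve 4 0 0)].
Definition gen (g : nat) : mat := nth (vzero, vzero, vzero) gens g.

(* The permutations of the 126 points induced by gens. *)
Definition sigmas : seq (seq nat) :=
  Eval vm_compute in [seq [seq pidx (vmul p A) | p <- points] | A <- gens].
Definition cact (g : nat) (l : seq nat) : seq nat :=
  sort leq [seq nth 0 (nth [::] sigmas g) n | n <- l].
Definition cactw (w : seq nat) (l : seq nat) : seq nat := foldl (fun l g => cact g l) l w.

(* A totally tangent conic is encoded by the sorted indices of its six contact points. *)
Definition conic0 : seq nat :=
  Eval vm_compute in sort leq [seq pidx (vmul v M0) |
    v <- [:: ve 1 0 0; ve 0 0 1; ve 1 1 1; ve 4 2 1; ve 4 3 1; ve 1 4 1]].

Definition cact2 (L : seq (seq nat)) (g : nat) : seq (seq nat) := map (cact g) L.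

(* Breadth-first enumeration of an orbit, every element coming with a word of
   generators, applied from left to right, that reaches it. *)
Fixpoint bfs (T : Type) (same : T -> T -> bool) (step : nat -> T -> T) (letters : seq nat)
    (fuel : nat) (todo seen : seq (seq nat * T)) : seq (seq nat * T) :=
  if fuel is n.+1 then
    if todo is (w, x) :: todo' then
      let new := foldl (fun acc g => let y := step g x in
        if has (fun z => same y z.2) (seen ++ acc) then acc else rcons acc (rcons w g, y))
        [::] letters in
      bfs same step letters n (todo' ++ new) (seen ++ new)
    else seen
  else seen.
(** The fuel bounds the number of elements processed; the longest orbit searched below has 120
    elements, the ordered triples of contact points of [conic0]. *)
Definition orbit_words (T : Type) (same : T -> T -> bool) step letters (x : T) :=
  bfs same step letters 200 [:: ([::], x)] [:: ([::], x)].

(* A permutation of {1, ..., 7} as the list of the images of 1, ..., 7. *)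
Definition table := seq nat.
Definition tapp (t : table) (x : nat) : nat := nth 0 t x.-1.
Definition tid : table := iota 1 7.
Definition tcomp (t t' : table) : table := [seq tapp t' x | x <- t].
Definition tinv (t : table) : table := [seq (index x t).+1 | x <- tid].
Definition pis : seq table := [:: [:: 2; 3; 1; 4; 5; 6; 7]; [:: 2; 3; 4; 5; 6; 7; 1]].
Definition pi_ (g : nat) : table := nth tid pis g.
Definition tw (w : seq nat) : table := foldl (fun t g => tcomp t (pi_ g)) tid w.
Definition lact (t : table) (ab : nat * nat) : nat * nat :=
  let a := tapp t ab.1 in let b := tapp t ab.2 in (minn a b, maxn a b).

(* Entries (word, (conic, {i, j})), the pair being the vertex of T(7) that the conic represents. *)
Definition D0st : seq (seq nat * (seq nat * (nat * nat))) := Eval vm_compute in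
  orbit_words eq_op (fun g x => (cact g x.1, lact (pi_ g) x.2)) [:: 0; 1] (conic0, (1, 2)).
Definition D0L : seq (seq nat) := [seq x.2.1 | x <- D0st].

Definition in_a (t : table) : bool := tapp t 7 == 7.
Definition in_c (t : table) : bool := all (fun x => tapp t x \in [:: 5; 6; 7]) [:: 5; 6; 7].

(* Addition in F_2^3 of vectors written as binary numbers. *)
Definition xor3 (x y : nat) : nat :=
  4 * odd (x %/ 4 + y %/ 4) + 2 * odd (x %/ 2 + y %/ 2) + odd (x + y).
(** Over F_2 a permutation of the nonzero vectors that is additive on distinct vectors is linear, so
    these are the collineations of the Fano plane. *)
Definition in_b (t : table) : bool :=
  all (fun x => all (fun y => (x == y) || (tapp t (xor3 x y) == xor3 (tapp t x) (tapp t y))) tid) tid.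
Definition t67 : table := [:: 1; 2; 3; 4; 5; 7; 6].
Definition in_b' (t : table) : bool := in_b (tcomp (tcomp t67 t) t67).
Definition synthemes : seq (seq (nat * nat)) :=
  [:: [:: (1, 2); (3, 4); (5, 6)]; [:: (1, 3); (2, 5); (4, 6)]; [:: (1, 4); (2, 6); (3, 5)];
      [:: (1, 5); (2, 4); (3, 6)]; [:: (1, 6); (2, 3); (4, 5)]].
Definition syn_maps (t : table) (p p' : seq (nat * nat)) : bool :=
  all (fun x => lact t x \in p') p && all (fun y => y \in map (lact t) p) p'.
Definition in_d (t : table) : bool := [&& tapp t 7 == 7,
  all (fun p => has (syn_maps t p) synthemes) synthemes &
  all (fun p' => has (fun p => syn_maps t p p') synthemes) synthemes].

(* Words carrying the base component to representatives of the six orbits of its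
   stabilizer on the other components, with the stabilizers of these. *)
Definition reps : seq (seq nat * (table -> bool)) :=
  [:: ([:: 2; 2; 1; 1; 1; 2], in_a); ([:: 2; 2; 0; 2; 2], in_b); ([:: 2; 1; 2], in_b');
      ([:: 2; 2; 1; 1], in_c); ([:: 2; 1; 1], in_c); ([:: 2; 1; 2; 2; 0], in_d)].

(* A component has exactly one conic through the point 0. *)
Definition rep0 (L : seq (seq nat)) : seq nat := nth [::] L (find (fun l => head 1 l == 0) L).
Definition same_comp (L L' : seq (seq nat)) : bool := rep0 L == rep0 L'.
Definition family (w : seq nat) : seq (seq nat * seq (seq nat)) :=
  orbit_words same_comp (fun g L => map (cact g) L) [:: 0; 1] (foldl cact2 D0L w).
Definition families := Eval vm_compute in [seq family r.1 | r <- reps].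

(* The first condition says that the Schreier generators of the stabilizer of the
   head of the orbit f satisfy p. *)
Definition check_family (f : seq (seq nat * seq (seq nat))) (p : table -> bool) : bool :=
  all (fun x => all (fun g => let l := rep0 (map (cact g) x.2) in
     has (fun y => if l == rep0 y.2 then
       p (tcomp (tcomp (tw x.1) (pi_ g)) (tinv (tw y.1))) else false) f) [:: 0; 1]) f
  && all (fun x => ~~ p (tw x.1)) (behead f) && all (fun x => rep0 x.2 != [::]) f.

Definition all_conics : seq (seq nat) := flatten (D0L :: [seq flatten [seq x.2 | x <- f] | f <- families]).

Definition common (l l' : seq nat) : nat := count (mem l) l'.
Definition meet_count (l : seq nat) (L : seq (seq nat)) (n : nat) : nat :=
  count (fun l' => common l l' == n) L.
Definition talpha l L := (meet_count l L 2 == 3) && (meet_count l L 0 == 18).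
Definition tbeta l L := [&& meet_count l L 2 == 1, meet_count l L 1 == 4 & meet_count l L 0 == 16].
Definition tgamma l L := (meet_count l L 1 == 6) && (meet_count l L 0 == 15).
Definition rep_comp n : seq (seq nat) := head [::] [seq x.2 | x <- nth [::] families n].

(* Words generating the stabilizer of conic0 in the stabilizer of its component. *)
Definition loop0 := [:: 1; 0; 0].
Definition loop1 := [:: 1; 1; 1; 1; 1; 1; 0; 1; 0].
Definition loop g := if g == 0 then loop0 else loop1.
Definition pact g n := nth 0 (nth [::] sigmas g) n.
Definition pactw w n := foldl (fun n g => pact g n) n w.
Definition six_points := Eval vm_compute in [seq pidx (vmul v M0) |
    v <- [:: ve 1 0 0; ve 0 0 1; ve 1 1 1; ve 4 2 1; ve 4 3 1; ve 1 4 1]].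
Definition triples := Eval vm_compute in
  orbit_words eq_op (fun g x => map (pactw (loop g)) x) [:: 0; 1] (take 3 six_points).

(** * Certificates obtained by computation in the finite model *)

Lemma check_families : all (fun fr => check_family fr.1 fr.2.2) (zip families reps).
Proof. by vm_compute. Qed.
(* By tt_pencil six is the largest possible number, so no conic is missing. *)
Lemma check_cover : all (fun m => size (undup [seq l <- [seq l <- all_conics | 0 \in l] | m \in l]) == 6) (iota 1 125).
Proof. by vm_compute. Qed.
(* The stabilizer of conic0 acts on its six contact points as PGL_2(F_5), 3-transitively. *)
Lemma check_triples : all (fun a => all (fun b => all (fun c => uniq [:: a; b; c] ==>
  has (fun x => x.2 == [:: a; b; c]) triples) six_points) six_points) six_points.
Proof. by vm_compute. Qed.

(** Ties the tables of [sigmas] to the matrices: each generator is unitary and sends point n to a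
    multiple of point [pact g n]. The multiplier is required to be reduced and nonzero so that its
    image in k is nonzero. *)
Definition check_gens : bool := all (fun g => all (fun n =>
  let u := vmul (nth vzero points n) (gen g) in
  [&& pact g n < 126, lead u \in F25s, lead u != (0, 0) &
     vscale (lead u) (nth vzero points (pact g n)) == u]) (iota 0 126)
  && all (fun i => all (fun j =>
       vherm (vmul i (gen g)) (vmul j (gen g)) == if i == j then (1, 0) else (0, 0))
     [:: ve 1 0 0; ve 0 1 0; ve 0 0 1]) [:: ve 1 0 0; ve 0 1 0; ve 0 0 1]) (iota 0 3).

Lemma check_gens_true : check_gens.
Proof. by vm_compute. Qed.

Definition params : seq vec := [:: ve 1 0 0; ve 0 0 1; ve 1 1 1; ve 4 2 1; ve 4 3 1; ve 1 4 1].
Definition scaled_point (u : vec) (n : nat) : bool :=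
  [&& n < 126, lead u \in F25s, lead u != (0, 0) & vscale (lead u) (nth vzero points n) == u].
Lemma six_points_ok : all2 (fun v n => scaled_point (vmul v M0) n) params six_points.
Proof. by vm_compute. Qed.
Lemma six_points_conic0 : sort leq six_points = conic0.
Proof. by []. Qed.
(** The entries of the Gram matrix with antidiagonal 1, -2, 1; the 3 stands for -2. *)
Definition Jlist : seq (vec * vec * F25) :=
  [:: (ve 1 0 0, ve 1 0 0, (0, 0)); (ve 1 0 0, ve 0 1 0, (0, 0)); (ve 1 0 0, ve 0 0 1, (1, 0));
      (ve 0 1 0, ve 1 0 0, (0, 0)); (ve 0 1 0, ve 0 1 0, (3, 0)); (ve 0 1 0, ve 0 0 1, (0, 0));
      (ve 0 0 1, ve 1 0 0, (1, 0)); (ve 0 0 1, ve 0 1 0, (0, 0)); (ve 0 0 1, ve 0 0 1, (0, 0))].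
Lemma M0_gram : all (fun x => vherm (vmul x.1.1 M0) (vmul x.1.2 M0) == x.2) Jlist.
Proof. by vm_compute. Qed.
Definition good (l : seq nat) : bool := [&& sorted ltn l, all (ltn^~ 126) l & size l == 6].

Definition mmul (A B : mat) : mat := let: (a, b, c) := A in (vmul a B, vmul b B, vmul c B).
Definition mid : mat := (ve 1 0 0, ve 0 1 0, ve 0 0 1).
Definition wmat (w : seq nat) : mat := foldl (fun A g => mmul A (gen g)) mid w.
Definition mtrconj (A : mat) : mat :=
  let: ((a, b, c), (d, e, f), (g, h, i)) := A in
  (vconj (a, d, g), vconj (b, e, h), vconj (c, f, i)).
(* The inverse of M0, because the Gram matrix of M0 is Jm. *)
Definition M0i : mat := Eval vm_compute in mmul (mtrconj M0) (ve 0 0 1, ve 0 2 0, ve 1 0 0).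
Definition w1 : seq nat := Eval vm_compute in
  nth [::] (unzip1 D0st) (find (fun x => x.2.2 == (1, 3)) D0st).
Definition conic1 : seq nat := Eval vm_compute in cactw w1 conic0.
(* In the coordinates of the base conic, N1 carries it to its neighbour conic1. *)
Definition N1 : mat := Eval vm_compute in mmul (mmul M0 (wmat w1)) M0i.
(* Coefficients of the quartic in s obtained by substituting (s^2, s, 1) A into
   x1^2 - x0 x2. *)
Definition quartic_coefs (A : mat) : seq F25 :=
  let: ((a0, a1, a2), (b0, b1, b2), (c0, c1, c2)) := A in
  let m x y := fmul (4, 0) (fmul x y) in
  [:: fadd (fmul a1 a1) (m a0 a2);
      fadd (fmul (2, 0) (fmul a1 b1)) (fadd (m a0 b2) (m b0 a2));
      fadd (fadd (fmul b1 b1) (fmul (2, 0) (fmul a1 c1))) (fadd (fadd (m a0 c2) (m b0 b2)) (m c0 a2));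
      fadd (fmul (2, 0) (fmul b1 c1)) (fadd (m b0 c2) (m c0 b2));
      fadd (fmul c1 c1) (m c0 c2)].
(** The coefficients of c (s - a)(s - b)(s - d)(s - e) by Vieta's formulas, with 4 in the role of
    -1. *)
Definition elem_sym (l : seq F25) (c : F25) : seq F25 :=
  if l is [:: a; b; d; e] then
    [:: c; fmul (4, 0) (fmul c (fadd (fadd a b) (fadd d e)));
      fmul c (fadd (fadd (fmul a b) (fmul d e)) (fmul (fadd a b) (fadd d e)));
      fmul (4, 0) (fmul c (fadd (fmul (fmul a b) (fadd d e)) (fmul (fmul d e) (fadd a b))));
      fmul c (fmul (fmul a b) (fmul d e))]
  else [::].
Definition roots1 : seq F25 := Eval vm_compute in
  [seq s <- F25s | foldl (fun x c => fadd (fmul x s) c) (0, 0) (quartic_coefs N1) == (0, 0)].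
Definition vcross (u v : vec) : vec :=
  let: (x, y, z) := u in let: (x', y', z') := v in
  let d a b c e := fadd (fmul a b) (fmul (4, 0) (fmul c e)) in
  (d y z' z y', d z x' x z', d x y' y x').
Definition pairs (l : seq nat) : seq (nat * nat) :=
  [seq ij <- [seq (i, j) | i <- l, j <- l] | ij.1 < ij.2].
Definition normal_vec (ij : nat * nat) : vec :=
  vcross (nth vzero points ij.1) (nth vzero points ij.2).
Definition on_line (n : vec) (a : nat) : bool := vdot n (nth vzero points a) == (0, 0).
Definition secants01 : seq (nat * nat) := Eval vm_compute in
  [seq ij <- pairs conic0 | has (fun ab => on_line (normal_vec ij) ab.1 && on_line (normal_vec ij) ab.2)
    (pairs conic1)].
Definition in_span (ij : nat * nat) (a : nat) : bool :=
  has (fun x => has (fun y => vadd (vscale x (nth vzero points ij.1)) (vscale y (nth vzero points ij.2))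
    == nth vzero points a) F25s) F25s.
Lemma M0iE : mmul M0 M0i = mid. Proof. by vm_compute. Qed.
Lemma N1E : mmul (mmul M0 (wmat w1)) M0i = N1. Proof. by vm_compute. Qed.
(** The quartic splits over F_25, which locates all common points of the two conics, whether on
    Gamma or not. *)
Lemma quartic1 : quartic_coefs N1 = elem_sym roots1 (head (0, 0) (quartic_coefs N1)).
Proof. by vm_compute. Qed.
(** This and the next two checks show that exactly three secants are common. Normal vectors rule out
    all other lines, explicit linear combinations show that the listed lines also join two points of
    [conic1], and the listed lines are pairwise distinct. *)
Lemma secants01_lines : all (fun ij =>
  [&& on_line (normal_vec ij) ij.1, on_line (normal_vec ij) ij.2 &
   all (fun ab => (if on_line (normal_vec ij) ab.1 then on_line (normal_vec ij) ab.2 else false) ==>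
     (ij \in secants01)) (pairs conic1)]) (pairs conic0).
Proof. by vm_compute. Qed.
Lemma secants01_common : all (fun ij => has (fun ab => in_span ij ab.1 && in_span ij ab.2) (pairs conic1)) secants01.
Proof. by vm_compute. Qed.
Lemma secants01_distinct : all (fun ij => (ij \in pairs conic0) && all (fun ab => (ij == ab) ||
  ~~ (on_line (normal_vec ij) ab.1 && on_line (normal_vec ij) ab.2)) secants01) secants01.
Proof. by vm_compute. Qed.

Definition lmeet (x y : nat * nat) : bool :=
  (x != y) && [|| x.1 == y.1, x.1 == y.2, x.2 == y.1 | x.2 == y.2].
Definition stab_words : seq (seq nat) := Eval vm_compute in
  [seq flatten (map loop x.1) | x <- triples].
Definition letters01 (w : seq nat) : bool := all (fun g => g < 2) w.
Definition D0nb : seq (seq nat * (seq nat * (nat * nat))) := Eval vm_compute in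
  [seq x <- D0st | lmeet x.2.2 (1, 2)].
Lemma D0nbE : D0nb = [seq x <- D0st | lmeet x.2.2 (1, 2)]. Proof. by []. Qed.
Lemma D0st_words : all (fun x => [&& letters01 x.1, cactw x.1 conic0 == x.2.1,
  lact (tw x.1) (1, 2) == x.2.2 & [&& 0 < x.2.2.1, x.2.2.1 < x.2.2.2 & x.2.2.2 < 8]]) D0st.
Proof. by vm_compute. Qed.
Lemma D0st_closed : all (fun x => all (fun g =>
  (cact g x.2.1, lact (pi_ g) x.2.2) \in unzip2 D0st) [:: 0; 1]) D0st.
Proof. by vm_compute. Qed.
Lemma D0L_uniq : uniq D0L. Proof. by vm_compute. Qed.
Lemma D0lab_uniq : uniq [seq x.2.2 | x <- D0st]. Proof. by vm_compute. Qed.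
Lemma D0lab_full : all (fun a => all (fun b => (a < b) ==> ((a, b) \in [seq x.2.2 | x <- D0st])) tid) tid.
Proof. by vm_compute. Qed.
(** Every expected neighbour is the image of [conic1] under a word fixing [conic0], so one verified
    adjacency yields all ten. *)
Lemma D0nb_stab : all (fun x => has (fun u => [&& letters01 u, cactw u conic0 == conic0 &
  cactw u conic1 == x.2.1]) stab_words) D0nb.
Proof. by vm_compute. Qed.
Lemma D0nb_size : size D0nb = 10. Proof. by []. Qed.
(** The word of x carries the base conic to the conic of x, and hence the ten base neighbours to the
    neighbours of x. These are conics whose labels meet the label of x; [D0_adj2] is the converse
    inclusion. *)
Lemma D0_adj1 : all (fun x => all (fun y => has (fun z =>
  (z.2.1 == cactw x.1 y.2.1) && lmeet z.2.2 x.2.2) D0st) D0nb) D0st.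
Proof. by vm_compute. Qed.
Lemma D0_adj2 : all (fun x => all (fun z => lmeet z.2.2 x.2.2 ==>
  has (fun y => z.2.1 == cactw x.1 y.2.1) D0nb) D0st) D0st.
Proof. by vm_compute. Qed.
Lemma D0nb_uniq : uniq [seq x.2.1 | x <- D0nb]. Proof. by []. Qed.

Lemma uniq_map_inj (T1 T2 : eqType) (f : T1 -> T2) (s : seq T1) :
  uniq (map f s) -> {in s &, injective f}.
Proof.
elim: s => // a s IH /= /andP[fa us] x y; rewrite !inE => /orP[/eqP->|xs] /orP[/eqP->|ys] e //.
- by rewrite e map_f in fa.
- by rewrite -e map_f in fa.
exact: IH.
Qed.

Definition fixcount (t : table) : nat := count (fun x => tapp t x == x) tid.
(** A permutation of seven labels with exactly four fixed points is a 3-cycle; no 3-cycle is a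
    collineation of the Fano plane or fixes 7 and preserves the synthematic total. *)
Lemma b_d_no_fix4 : all (fun t => if fixcount t == 4 then ~~ (in_b t || in_d t) else true) (permutations tid).
Proof. by vm_compute. Qed.

(* The word of the 3-cycle (j, j + 1, j + 2). *)
Definition cyc (j : nat) : seq nat := nseq (8 - j) 1 ++ 0 :: nseq j.-1 1.
(** For a <= n, a word sending a to n and fixing every label above n. The 3-cycle (a, a+1, a+2)
    raises a by one; the last step from n - 1 uses (n-2, n-1, n) instead, so that nothing above n
    moves. *)
Fixpoint up (fuel n a : nat) : seq nat :=
  if fuel is f.+1 then
    if a == n then [::] else if a.+1 == n then cyc (n - 2) else cyc a ++ up f n a.+1
  else [::].
Lemma up_ok : all (fun n => all (fun a => (a <= n) ==> [&& letters01 (up 7 n a),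
  tapp (tw (up 7 n a)) a == n & all (fun x => (n < x) ==> (tapp (tw (up 7 n a)) x == x)) tid]) tid)
  [:: 3; 4; 5; 6; 7].
Proof. by vm_compute. Qed.

(** * The subgroups of A_7 *)

Lemma lab_val i : 0 < i < 8 -> (lab i).+1 = i.
Proof. by move=> /andP[h0 h8]; rewrite /lab inordK ?prednK. Qed.

Lemma lab_succ (i : 'I_7) : lab i.+1 = i.
Proof. exact: inord_val. Qed.

Lemma mem_tid x : (x \in tid) = (0 < x < 8).
Proof. by rewrite mem_iota. Qed.

Lemma succ_tid (i : 'I_7) : i.+1 \in tid.
Proof. by rewrite mem_tid /= ltnS (ltn_ord i). Qed.

Definition tb (s : 'S_7) : table := [seq (s (lab x)).+1 | x <- tid].

Lemma tapp_tid x : x \in tid -> nth 0 tid x.-1 = x.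
Proof. by rewrite mem_tid; case: x => // x; rewrite ltnS => h; rewrite nth_iota. Qed.

Lemma tapp_map f x : x \in tid -> tapp [seq f y | y <- tid] x = f x.
Proof.
move=> hx; rewrite /tapp (nth_map 0) ?tapp_tid //.
by move: hx; rewrite mem_tid size_iota; case: x.
Qed.

Lemma tapp_tb s x : x \in tid -> tapp (tb s) x = (s (lab x)).+1.
Proof. exact: tapp_map. Qed.

Lemma tb_M s s' : tb (s * s')%g = tcomp (tb s) (tb s').
Proof.
rewrite /tcomp /tb -map_comp; apply/eq_in_map => x hx /=.
by rewrite permM tapp_tb ?succ_tid // lab_succ.
Qed.

Lemma tb_inj : injective tb.
Proof.
move=> s s' e; apply/permP => i; apply: val_inj; apply: succn_inj.
by rewrite -[i]lab_succ -!tapp_tb ?succ_tid // e.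
Qed.

Lemma tb_1 : tb 1%g = tid.
Proof.
rewrite -[RHS]map_id; apply/eq_in_map => x; rewrite mem_tid => hx.
by rewrite perm1 lab_val.
Qed.

Lemma tb_uniq s : uniq (tb s).
Proof.
rewrite map_inj_in_uniq ?iota_uniq // => x y; rewrite !mem_tid => hx hy [] /val_inj /perm_inj e.
by rewrite -(lab_val hx) e lab_val.
Qed.

Lemma tb_V s : tb s^-1%g = tinv (tb s).
Proof.
apply/eq_in_map => x hx; congr S; pose i := s^-1%g (lab x).
have hx' : 0 < x < 8 by rewrite -mem_tid.
have xE : x = nth 0 (tb s) i.
  have := tapp_tb s (succ_tid i); rewrite /tapp /= lab_succ /i permKV lab_val // => <- //.
by rewrite [in index _ _]xE index_uniq ?tb_uniq // size_map size_iota.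
Qed.

Definition valid_table (t : table) : bool := [&& size t == 7, uniq t & all (mem tid) t].

Lemma table_inj t : valid_table t -> injective (fun i : 'I_7 => lab (nth 0 t i)).
Proof.
move=> /and3P[/eqP st ut /allP ht] i j e; apply/val_inj/eqP.
have h (l : 'I_7) : nth 0 t l \in tid by apply/ht/mem_nth; rewrite st.
have hb (l : 'I_7) : 0 < nth 0 t l < 8 by rewrite -mem_tid h.
have hs (l : 'I_7) : l < size t by rewrite st.
by rewrite -(nth_uniq 0 (hs i) (hs j) ut) -(lab_val (hb i)) e lab_val.
Qed.

Lemma table_perm t : valid_table t -> exists s, tb s = t.
Proof.
move=> ht; exists (perm (table_inj ht)); have /and3P[/eqP st ut /allP mt] := ht.
apply: (@eq_from_nth _ 0) => [|i]; first by rewrite size_map size_iota st.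
rewrite size_map size_iota => hi; rewrite (nth_map 0) ?size_iota // nth_iota // permE add1n.
have -> : lab i.+1 = Ordinal hi by apply: val_inj; rewrite /= inordK.
by rewrite lab_val // -mem_tid; apply/mt/mem_nth; rewrite st.
Qed.

Lemma tb_valid s : valid_table (tb s).
Proof.
apply/and3P; split; [by rewrite size_map|exact: tb_uniq|].
by apply/allP => _ /mapP [x _ ->]; exact: succ_tid.
Qed.

Lemma pg_exists g : exists s, tb s = pi_ g.
Proof. by case: g => [|[|g]]; apply: table_perm => //; rewrite /pi_ nth_default. Qed.

Definition pg g : 'S_7 := projT1 (cid (pg_exists g)).

Lemma tb_pg g : tb (pg g) = pi_ g.
Proof. exact: projT2 (cid (pg_exists g)). Qed.

Definition pw (w : seq nat) : 'S_7 := foldl (fun (s : 'S_7) g => s * pg g)%g 1%g w.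

Lemma pw_rcons w g : pw (rcons w g) = (pw w * pg g)%g.
Proof. by rewrite /pw foldl_rcons. Qed.

Lemma pw_cat w w' : pw (w ++ w') = (pw w * pw w')%g.
Proof.
elim/last_ind: w' => [|w' g IH]; first by rewrite cats0 mulg1.
by rewrite -rcons_cat !pw_rcons IH mulgA.
Qed.

Lemma tb_pw w : tb (pw w) = tw w.
Proof.
elim/last_ind: w => [|w g IH]; first exact: tb_1.
by rewrite pw_rcons tb_M IH tb_pg /tw foldl_rcons.
Qed.

(** The generators have odd order, 3 and 7, so their signs are trivial; any other index denotes the
    identity. *)
Lemma pg_even g : pg g \in 'Alt_('I_7).
Proof.
have [g0|g1] := posnP g.
  have e : (pg g ^+ 3 = 1)%g by apply: tb_inj; rewrite !expgS expg0 mulg1 !tb_M tb_pg g0 tb_1.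
  by rewrite Alt_even; have := congr1 (@odd_perm _) e; rewrite !expgS expg0 mulg1 !odd_permM odd_perm1; case: odd_perm.
case: g g1 => [//|[_|g _]]; last first.
  suff -> : pg g.+2 = 1%g by apply: group1.
  by apply: tb_inj; rewrite tb_pg tb_1 /pi_ nth_default.
have e : (pg 1 ^+ 7 = 1)%g by apply: tb_inj; rewrite !expgS expg0 mulg1 !tb_M tb_pg tb_1.
by rewrite Alt_even; have := congr1 (@odd_perm _) e; rewrite !expgS expg0 mulg1 !odd_permM odd_perm1; case: odd_perm.
Qed.

Lemma pw_even w : pw w \in 'Alt_('I_7).
Proof.
by elim/last_ind: w => [|w g IH]; rewrite ?group1 // pw_rcons groupM // pg_even.
Qed.

Lemma pw_expg w n : (pw w ^+ n)%g = pw (flatten (nseq n w)).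
Proof. by elim: n => [|n IH]; rewrite ?expg0 // expgS IH /= pw_cat. Qed.

Lemma letters01_cat w w' : letters01 w -> letters01 w' -> letters01 (w ++ w').
Proof. by rewrite /letters01 all_cat => -> ->. Qed.

Lemma letters01_flatten n w : letters01 w -> letters01 (flatten (nseq n w)).
Proof. by move=> hw; elim: n => //= n IH; apply: letters01_cat. Qed.

Lemma pw_lab w x : x \in tid -> pw w (lab x) = lab (tapp (tw w) x).
Proof. by move=> hx; rewrite -tb_pw tapp_tb // lab_succ. Qed.

Lemma lab_eq x y : x \in tid -> y \in tid -> (lab x == lab y) = (x == y).
Proof.
move=> hx hy; apply/eqP/eqP => [e|-> //].
by rewrite -[x]lab_val -?mem_tid // e lab_val -?mem_tid.
Qed.

(** The words [up] put the labels 7, 6, 5, 4, 3 in their places one after the other. What remains is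
    the identity or the transposition (1 2), and parity excludes the latter. *)
Lemma alt_words (s : 'S_7) : s \in 'Alt_('I_7) -> exists2 w, letters01 w & pw w = s.
Proof.
move=> sA.
pose P n := exists2 w, letters01 w & forall x, x \in tid -> n <= x -> (s * pw w)%g (lab x) = lab x.
have step n : n \in [:: 3; 4; 5; 6; 7] -> P n.+1 -> P n.
  move=> hn [w hw fw]; set s' := (s * pw w)%g in fw.
  have nt : n \in tid by move: hn; rewrite !inE => /or4P[/eqP->|/eqP->|/eqP->|/orP[]/eqP->].
  pose a := (s' (lab n)).+1; have at_ : a \in tid by exact: succ_tid.
  have an : a <= n.
    rewrite leqNgt; apply/negP => na.
    have /perm_inj e : s' (lab a) = s' (lab n) by rewrite (fw a at_ na) /a lab_succ.
    have : a = n by rewrite -[a]lab_val -?mem_tid // e lab_val -?mem_tid.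
    by move=> e'; rewrite e' ltnn in na.
  have /implyP /(_ an) /and3P[h1 /eqP h2 h3] := allP (allP up_ok n hn) a at_.
  exists (w ++ up 7 n a); first exact: letters01_cat.
  move=> x hx nx; rewrite pw_cat mulgA -/s' permM.
  move: nx; rewrite leq_eqVlt => /orP[/eqP <-|nx].
    have -> : s' (lab n) = lab a by rewrite /a lab_succ.
    by rewrite pw_lab // h2.
  rewrite fw // pw_lab //; have /implyP /(_ nx) /eqP -> // := allP h3 x hx.
have P8 : P 8 by exists [::] => // x; rewrite mem_tid => /andP[_ h] /(leq_trans h); rewrite ltnn.
have [w hw fw] : P 3 by do 5 (apply: (step) => //).
set s' := (s * pw w)%g in fw.
have s'A : s' \in 'Alt_('I_7) by rewrite groupM // pw_even.
have s1 : s' = 1%g.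
  have cases x : x \in tid -> x <= 2 -> (s' (lab x) = lab 1) \/ (s' (lab x) = lab 2).
    move=> hx x2; pose a := (s' (lab x)).+1; have at_ : a \in tid by exact: succ_tid.
    have aE : s' (lab x) = lab a by rewrite /a lab_succ.
    have [a3|] := leqP 3 a.
      have := fw a at_ a3; rewrite -aE => /perm_inj e; move: a3.
      have : a = x by rewrite /a e lab_val -?mem_tid.
      by move=> -> ; rewrite ltnNge x2.
    move: at_; rewrite mem_tid aE => /andP[a0 _]; rewrite ltnS.
    by case: (a) a0 => [//|[|[|//]]] _ _; [left|right].
  have l12 : lab 1 != lab 2 :> 'I_7 by rewrite lab_eq.
  have odd_t : tperm (lab 1) (lab 2) \in 'Alt_('I_7) -> False by rewrite Alt_even odd_tperm l12.
  have [h1|h1] := cases 1 isT isT; have [h2|h2] := cases 2 isT isT.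
  - by case/eqP: l12; apply: (@perm_inj _ s'); rewrite h1 h2.
  - apply: tb_inj; rewrite tb_1 -[RHS]map_id; apply/eq_in_map => x hx.
    have [x3|] := leqP 3 x; first by rewrite fw // lab_val -?mem_tid.
    by move: (hx); rewrite mem_tid => /andP[x0 _]; rewrite ltnS;
      case: x x0 {hx} => [//|[|[|//]]] _ _; rewrite ?h1 ?h2 lab_val.
  - case: odd_t; suff <- : s' = tperm (lab 1) (lab 2) by [].
    apply: tb_inj; apply/eq_in_map => x hx; congr (_.+1); congr val.
    have [x3|] := leqP 3 x.
      by rewrite fw // tpermD // lab_eq //; apply: contraTneq x3 => <-.
    by move: (hx); rewrite mem_tid => /andP[x0 _]; rewrite ltnS;
      case: x x0 {hx} => [//|[|[|//]]] _ _; rewrite ?h1 ?h2 ?tpermL ?tpermR.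
  by case/eqP: l12; apply: (@perm_inj _ s'); rewrite h1 h2.
(* Now s is the inverse of [pw w]; as a positive power of [pw w] it is again given by a word without
   inverses. *)
exists (flatten (nseq #[pw w].-1 w)); first exact: letters01_flatten.
by rewrite -pw_expg -invg_expg; apply: (mulIg (pw w)); rewrite mulVg -s1.
Qed.

Lemma sapp_eq (s : 'S_7) x y : x \in tid -> y \in tid ->
  (s (lab x) == lab y) = (tapp (tb s) x == y).
Proof.
move=> hx hy; rewrite tapp_tb // -[in RHS](@lab_val y) -?mem_tid //.
Qed.

Lemma in_cE (s : 'S_7) : in_c (tb s) = ([set s i | i in [set lab 5; lab 6; lab 7]] == [set lab 5; lab 6; lab 7]).
Proof.
set B := [set lab 5; lab 6; lab 7].
have inB (i : 'I_7) : (i \in B) = (i.+1 \in [:: 5; 6; 7]).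
  have h y : y \in tid -> (i == lab y) = (i.+1 == y).
    by move=> hy; rewrite -{1}(lab_succ i) lab_eq ?succ_tid.
  by rewrite !inE !h // orbA.
apply/allP/eqP => [h|e x hx]; last first.
  have xt : x \in tid by move: hx; rewrite !inE => /or3P[]/eqP->.
  rewrite tapp_tb // -inB -e; apply: imset_f.
  by rewrite inB lab_val // -mem_tid.
apply/eqP; rewrite eqEcard card_imset ?leqnn ?andbT; last exact: perm_inj.
apply/subsetP => _ /imsetP [i iB ->]; rewrite inB.
have hi : i.+1 \in tid by exact: succ_tid.
by move: iB; rewrite inB => /h; rewrite tapp_tb // lab_succ.
Qed.

Definition lset (ab : nat * nat) : {set 'I_7} := [set lab ab.1; lab ab.2].
Definition proper_pair (ab : nat * nat) : bool := [&& ab.1 \in tid, ab.2 \in tid & ab.1 < ab.2].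

Lemma lsetC a b : lset (minn a b, maxn a b) = lset (a, b).
Proof.
rewrite /lset /=; case: (leqP a b) => h; first by rewrite /minn /maxn; case: ltngtP h => // ->.
by rewrite setUC.
Qed.

Lemma lset_imset (s : 'S_7) ab : ab.1 \in tid -> ab.2 \in tid ->
  [set s i | i in lset ab] = lset (lact (tb s) ab).
Proof.
move=> h1 h2; rewrite /lact lsetC /lset imsetU !imset_set1 /= !tapp_tb //.
by rewrite !lab_succ.
Qed.

Lemma lact_proper s ab : proper_pair ab -> proper_pair (lact (tb s) ab).
Proof.
move=> /and3P[h1 h2 lt]; have ne : tapp (tb s) ab.1 != tapp (tb s) ab.2.
  rewrite !tapp_tb // eqSS val_eqE (inj_eq perm_inj) lab_eq //.
  by move: lt; rewrite ltn_neqAle => /andP[].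
have [t1 t2] : tapp (tb s) ab.1 \in tid /\ tapp (tb s) ab.2 \in tid by rewrite !tapp_tb // !succ_tid.
by rewrite /proper_pair /lact /=; case: (ltngtP (tapp (tb s) ab.1)) ne => h //= _; rewrite ?t1 ?t2.
Qed.

Lemma lset_pair_inj x y : proper_pair x -> proper_pair y -> lset x = lset y -> x = y.
Proof.
case: x => a b; case: y => c d /and3P[/= a1 b1 ab] /and3P[/= c1 d1 cd] /setP e.
have := e (lab a); have := e (lab b); have := e (lab c).
rewrite !inE !eqxx ?orbT !lab_eq // => /orP h3 /esym /orP h2 /esym /orP h1.
case: h1 => /eqP h1; case: h2 => /eqP h2; subst a b; rewrite ?ltnn // in ab *.
by have := ltn_trans ab cd; rewrite ltnn.
Qed.

Definition enc (p : seq (nat * nat)) : {set {set 'I_7}} := [set x in map lset p].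

Lemma enc_imset (s : 'S_7) p : all proper_pair p ->
  [set [set s i | i in B] | B : {set 'I_7} in enc p] = enc (map (lact (tb s)) p).
Proof.
move=> /allP hp; apply/setP => B; rewrite inE; apply/imsetP/mapP.
  move=> [A]; rewrite inE => /mapP [x xp ->] ->; exists (lact (tb s) x); first exact: map_f.
  by have /and3P[h1 h2 _] := hp x xp; rewrite lset_imset.
move=> [_ /mapP [x xp ->] ->]; exists (lset x); first by rewrite inE map_f.
by have /and3P[h1 h2 _] := hp x xp; rewrite lset_imset.
Qed.

Lemma enc_eq p p' : all proper_pair p -> all proper_pair p' ->
  (enc p == enc p') = all (mem p') p && all (mem p) p'.
Proof.
move=> /allP hp /allP hp'.
have sub q q' : {in q, forall x, proper_pair x} -> {in q', forall x, proper_pair x} ->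
   enc q = enc q' -> all (mem q') q.
  move=> hq hq' /setP e; apply/allP => x xq.
  have := e (lset x); rewrite !inE map_f // => /esym /mapP [y yq' /lset_pair_inj exy].
  by rewrite (exy (hq _ xq) (hq' _ yq')).
apply/eqP/andP => [e|[/allP h1 /allP h2]]; first by split; apply: sub.
apply/setP => B; rewrite !inE; apply/mapP/mapP => -[x xp ->]; exists x => //.
  exact: h1.
exact: h2.
Qed.

Lemma synthemes_proper : {in synthemes, forall p, all proper_pair p}.
Proof. by apply/allP. Qed.

Lemma t0E : t0 = [set x in map enc synthemes].
Proof.
have e a b c d e f : pairs3 a b c d e f = enc [:: (a, b); (c, d); (e, f)].
  by apply/setP => B; rewrite !inE orbA.
by rewrite /t0 !e; apply/setP => B; rewrite !inE.
Qed.

Lemma syn_mapsE (s : 'S_7) p p' : p \in synthemes -> p' \in synthemes ->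
  syn_maps (tb s) p p' = ([set [set s i | i in B] | B : {set 'I_7} in enc p] == enc p').
Proof.
move=> /synthemes_proper hp /synthemes_proper hp'.
rewrite enc_imset // enc_eq //; last first.
  by rewrite all_map; apply/allP => x /(allP hp) /= /lact_proper.
by rewrite all_map.
Qed.

Lemma in_dE (s : 'S_7) : in_d (tb s) = (s (lab 7) == lab 7) &&
  ([set [set [set s i | i in B] | B : {set 'I_7} in p] | p : {set {set 'I_7}} in t0] == t0).
Proof.
rewrite sapp_eq // /in_d; congr (_ && _).
rewrite t0E; apply/andP/eqP => [[/allP h1 /allP h2]|/setP e]; last first.
  split; apply/allP => p hp.
    have := e [set [set s i | i in B] | B : {set 'I_7} in enc p]; rewrite imset_f ?in_set ?map_f // => /esym.
    move=> /mapP [p' hp' e']; apply/hasP; exists p' => //.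
    by rewrite syn_mapsE // e'.
  have := e (enc p); rewrite [in RHS]in_set map_f // => /imsetP [x].
  rewrite in_set => /mapP [p' hp' ->] e'; apply/hasP; exists p' => //.
  by rewrite syn_mapsE // -e'.
apply/setP => x; apply/imsetP/idP.
  move=> [y]; rewrite in_set => /mapP [p hp ->] ->.
  have /hasP [p' hp'] := h1 p hp; rewrite syn_mapsE // => /eqP ->.
  by rewrite in_set map_f.
rewrite in_set => /mapP [p' hp' ->]; have /hasP [p hp] := h2 p' hp'.
by rewrite syn_mapsE // => /eqP <-; exists (enc p) => //; rewrite in_set map_f.
Qed.

Notation V3 := 'rV['F_2]_3.

Definition code (v : V3) : nat := 4 * v 0%R ord0 + 2 * v 0%R (inord 1) + v 0%R (inord 2).

Lemma F2_cases (a : 'F_2) : a = 0%R \/ a = 1%R.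
Proof. by case: a => [[|[|//]]] h; [left|right]; apply: val_inj. Qed.

Lemma ord3_cases (i : 'I_3) : [\/ i = ord0, i = inord 1 | i = inord 2].
Proof.
by case: i => [[|[|[|//]]] h]; [apply: Or31|apply: Or32|apply: Or33]; apply: val_inj; rewrite /= ?inordK.
Qed.

Lemma rho_code v : rho v = lab (code v).
Proof. by []. Qed.

Lemma code_inj : injective code.
Proof.
move=> v w; rewrite /code => e; apply/rowP => i; case: (ord3_cases i) => ->; move: e;
case: (F2_cases (v 0%R ord0)) => ->; case: (F2_cases (v 0%R (inord 1))) => ->;
case: (F2_cases (v 0%R (inord 2))) => ->; case: (F2_cases (w 0%R ord0)) => ->;
case: (F2_cases (w 0%R (inord 1))) => ->; by case: (F2_cases (w 0%R (inord 2))) => ->.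
Qed.

Lemma code0 : code 0%R = 0.
Proof. by rewrite /code !mxE. Qed.

Lemma code_eq0 v : (code v == 0) = (v == 0%R).
Proof. by rewrite -(inj_eq code_inj) code0. Qed.

Lemma code_lt v : code v < 8.
Proof.
rewrite /code; case: (F2_cases (v 0%R ord0)) => ->; case: (F2_cases (v 0%R (inord 1))) => ->;
by case: (F2_cases (v 0%R (inord 2))) => ->.
Qed.

Lemma code_tid v : v != 0%R -> code v \in tid.
Proof. by move=> v0; rewrite mem_tid code_lt lt0n code_eq0 v0. Qed.

Lemma code_add v w : code (v + w)%R = xor3 (code v) (code w).
Proof.
rewrite /code !mxE.
case: (F2_cases (v 0%R ord0)) => ->; case: (F2_cases (v 0%R (inord 1))) => ->;
case: (F2_cases (v 0%R (inord 2))) => ->; case: (F2_cases (w 0%R ord0)) => ->;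
case: (F2_cases (w 0%R (inord 1))) => ->; by case: (F2_cases (w 0%R (inord 2))) => ->.
Qed.

Definition decode (n : nat) : V3 :=
  (\row_j (if j == ord0 then (n %/ 4)%N else if j == inord 1 then (n %/ 2)%N else n)%:R)%R.

Lemma code_decode n : n < 8 -> code (decode n) = n.
Proof.
rewrite /code !mxE.
have -> : (inord 1 == ord0 :> 'I_3) = false by rewrite -val_eqE /= inordK.
have -> : (inord 2 == ord0 :> 'I_3) = false by rewrite -val_eqE /= inordK.
have -> : (inord 2 == inord 1 :> 'I_3) = false by rewrite -val_eqE /= !inordK.
rewrite !eqxx !val_Fp_nat //.
by case: n => [|[|[|[|[|[|[|[|]]]]]]]].
Qed.

Lemma xor3_tid x y : x \in tid -> y \in tid -> x != y -> xor3 x y \in tid.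
Proof.
have h : all (fun x => all (fun y => (x != y) ==> (xor3 x y \in tid)) tid) tid by [].
by move=> hx hy ne; have /implyP -> := allP (allP h x hx) y hy.
Qed.

Lemma in_bP t : reflect {in tid &, forall x y, x != y -> tapp t (xor3 x y) = xor3 (tapp t x) (tapp t y)} (in_b t).
Proof.
apply: (iffP allP) => [h x y hx hy ne|h x hx].
  by have := allP (h x hx) y hy; rewrite (negbTE ne) => /eqP.
apply/allP => y hy; have [//|ne] := eqVneq x y.
by rewrite h // eqxx.
Qed.

(** A matrix acts additively, and conversely an additive permutation is the action of the matrix
    whose rows are the images of the basis vectors. *)
Lemma Sigma_bE s : (s \in Sigma_b) = in_b (tb s).
Proof.
rewrite inE; apply/existsP/in_bP.
  move=> [A /andP[/eqP dA /forallP hA]].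
  have H (v : V3) : v != 0%R -> tapp (tb s) (code v) = code (v *m A)%R.
    move=> v0; have := implyP (hA v) v0; rewrite !rho_code tapp_tb ?code_tid //.
    have vA0 : (v *m A)%R != 0%R.
      apply: contra_neq v0 => e; rewrite -[v](@mulmxK _ _ _ A) ?e ?mul0mx //.
      by rewrite unitmxE dA unitr1.
    by move=> /eqP ->; rewrite lab_val -?mem_tid ?code_tid.
  move=> x y hx hy ne.
  have dx n : n \in tid -> n < 8 by rewrite mem_tid => /andP[].
  have d0 n : n \in tid -> decode n != 0%R.
    by move=> hn; rewrite -code_eq0 code_decode ?dx //; move: hn; rewrite mem_tid; case: n.
  have E : xor3 x y = code (decode x + decode y)%R by rewrite code_add !code_decode ?dx.
  rewrite E H; last by rewrite -code_eq0 -E -lt0n; have := xor3_tid hx hy ne; rewrite mem_tid => /andP[].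
  by rewrite mulmxDl code_add -!H ?d0 // !code_decode ?dx.
move=> h.
pose t := tb s.
(* The basis vectors of F_2^3 have the codes 4, 2 and 1. *)
pose A : 'M['F_2]_3 := (\matrix_i (if i == ord0 then decode (tapp t 4)
   else if i == inord 1 then decode (tapp t 2) else decode (tapp t 1)))%R.
have tt x : x \in tid -> tapp t x \in tid by move=> hx; rewrite tapp_tb // succ_tid.
have dx n : n \in tid -> n < 8 by rewrite mem_tid => /andP[].
have cA (v : V3) : v != 0%R -> code (v *m A)%R = tapp t (code v).
  have vA : (v *m A = v 0 ord0 *: decode (tapp t 4) + v 0 (inord 1) *: decode (tapp t 2)
      + v 0 (inord 2) *: decode (tapp t 1))%R.
    rewrite mulmx_sum_row !big_ord_recl big_ord0 addr0 !rowK /=.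
    have -> : lift ord0 ord0 = inord 1 :> 'I_3 by apply: val_inj; rewrite /= inordK.
    have -> : lift ord0 (lift ord0 ord0) = inord 2 :> 'I_3 by apply: val_inj; rewrite /= inordK.
    have -> : (inord 2 == inord 1 :> 'I_3) = false by rewrite -val_eqE /= !inordK.
    by rewrite !eqxx addrA.
  have dt x : x \in tid -> code (decode (tapp t x)) = tapp t x.
    by move=> hx; rewrite code_decode // dx // tt.
  rewrite -code_eq0 vA /code.
  case: (F2_cases (v 0%R ord0)) => ->; case: (F2_cases (v 0%R (inord 1))) => ->;
  case: (F2_cases (v 0%R (inord 2))) => ->; rewrite -/(code _) // => _;
    rewrite ?scale1r ?scale0r ?add0r ?addr0 ?code_add ?dt // -!h //.
(* A nonzero kernel vector would have an image of code 0, but the table takes values in 1, ..., 7.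
   Over F_2 an invertible determinant equals 1. *)
have uA : A \in unitmx.
  rewrite -row_free_unit -kermx_eq0; apply/rowV0P => v /sub_kermxP vA0.
  apply/eqP; apply: contraTT isT => v0; have := tt _ (code_tid v0).
  by rewrite -cA // vA0 code0.
exists A; apply/andP; split.
  by have := unitmxE A; rewrite uA; case: (F2_cases (\det A)%R) => -> //; rewrite unitr0.
apply/forallP => v; apply/implyP => v0; rewrite !rho_code sapp_eq ?cA ?eqxx //.
- exact: code_tid.
- by apply: tt; apply: code_tid.
Qed.

Lemma Sigma_b'E s : (s \in Sigma_b') = in_b' (tb s).
Proof.
pose u : 'S_7 := tperm (lab 6) (lab 7).
have tu : tb u = t67.
  have h x : x \in tid -> x != 6 -> x != 7 -> (u (lab x)).+1 = x.
    by move=> hx h6 h7; rewrite tpermD ?lab_val -?mem_tid // lab_eq // eq_sym.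
  by rewrite /tb /= (h 1) // (h 2) // (h 3) // (h 4) // (h 5) // /u tpermL tpermR !lab_val.
have -> : in_b' (tb s) = in_b (tb (u * s * u)%g) by rewrite !tb_M tu.
rewrite -Sigma_bE !in_set; apply: eq_existsb => A; congr (_ && _).
apply: eq_forallb => v; congr (_ ==> _).
by rewrite /rho' -/u !permM -(inj_eq (@perm_inj _ u)) {2}/u tpermK.
Qed.

(* Sorting the images of 7, 6, ..., 3 leaves the identity or a transposition, which decides the parity. *)
Definition sort_step (t : table) (n : nat) : table := tcomp t (tw (up 7 n (tapp t n))).
Definition sorted_table (t : table) : table := foldl sort_step t [:: 7; 6; 5; 4; 3].

Lemma b_even : all (fun t => if in_b t then sorted_table t == tid else true) (permutations tid).
Proof. by vm_compute. Qed.

Lemma sorted_table_pw (s : 'S_7) : exists w, tb (s * pw w)%g = sorted_table (tb s).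
Proof.
rewrite /sorted_table; elim/last_ind: [:: _; _; _; _; _] => [|l n [w IH]].
  by exists [::]; rewrite mulg1.
exists (w ++ up 7 n (tapp (foldl sort_step (tb s) l) n)).
by rewrite foldl_rcons /sort_step pw_cat mulgA tb_M IH tb_pw.
Qed.

Lemma sorted_even (s : 'S_7) : sorted_table (tb s) = tid -> s \in 'Alt_('I_7).
Proof.
have [w <-] := sorted_table_pw s; rewrite -tb_1 => /tb_inj e.
by rewrite -(groupMr s (pw_even w)) e group1.
Qed.

Lemma tb_permutations s : tb s \in permutations tid.
Proof.
have /and3P[/eqP st ut /allP mt] := tb_valid s; rewrite mem_permutations.
apply: uniq_perm => //.
by have [|] := uniq_min_size ut mt; rewrite ?st ?size_iota.
Qed.

Lemma Sigma_b_even s : s \in Sigma_b -> s \in 'Alt_('I_7).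
Proof.
rewrite Sigma_bE => hs; have := allP b_even _ (tb_permutations s).
by rewrite hs => /eqP /sorted_even.
Qed.

Definition swap67 : 'S_7 := tperm (lab 6) (lab 7).

Lemma tb_swap67 : tb swap67 = t67.
Proof.
have h x : x \in tid -> x != 6 -> x != 7 -> (swap67 (lab x)).+1 = x.
  by move=> hx h6 h7; rewrite tpermD ?lab_val -?mem_tid // lab_eq // eq_sym.
by rewrite /tb /= (h 1) // (h 2) // (h 3) // (h 4) // (h 5) // /swap67 tpermL tpermR !lab_val.
Qed.

Lemma Sigma_b_conj : (Sigma_b :^ swap67 = Sigma_b')%g.
Proof.
apply/setP => s; rewrite mem_conjg Sigma_bE Sigma_b'E /in_b' -tb_swap67 -!tb_M.
by rewrite tpermV conjgE tpermV mulgA.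
Qed.

Lemma Sigma_b_group : group_set Sigma_b.
Proof.
apply/group_setP; split.
  rewrite in_set; apply/existsP; exists 1%:M%R; rewrite det1 eqxx /=.
  by apply/forallP => v; rewrite perm1 mulmx1 eqxx implybT.
move=> x y; rewrite !Sigma_bE tb_M => /in_bP hx /in_bP hy; apply/in_bP => a b ha hb ne.
have tc t c : c \in tid -> tapp (tcomp (tb x) t) c = tapp t (tapp (tb x) c).
  move=> hc; rewrite /tapp (nth_map 0) //; have /and3P[/eqP -> _ _] := tb_valid x.
  by move: hc; rewrite mem_tid; case: c.
have hx1 c : c \in tid -> tapp (tb x) c \in tid by move=> hc; rewrite tapp_tb // succ_tid.
rewrite !tc // ?xor3_tid // hx // hy ?hx1 //.
by rewrite !tapp_tb // eqSS val_eqE (inj_eq perm_inj) lab_eq.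
Qed.

Definition setwise (P : pred 'S_7) : {set 'S_7} := [set s | P s].

Lemma setwise_group (P : pred 'S_7) : P 1%g -> (forall s s' : 'S_7, P s -> P s' -> P (s * s')%g) ->
  group_set (setwise P).
Proof.
move=> h1 hM; apply/group_setP; split; first by rewrite in_set.
by move=> x y; rewrite !in_set; apply: hM.
Qed.

Definition fix7_pred (s : 'S_7) := s (lab 7) == lab 7.
Definition block567_pred (s : 'S_7) := [set s i | i in [set lab 5; lab 6; lab 7]] == [set lab 5; lab 6; lab 7].
Definition total_pred (s : 'S_7) := (s (lab 7) == lab 7) &&
  ([set [set [set s i | i in B] | B : {set 'I_7} in p] | p : {set {set 'I_7}} in t0] == t0).

Lemma imset_permM (s s' : 'S_7) (B : {set 'I_7}) :
  [set (s * s')%g i | i in B] = [set s' i | i in [set s i | i in B]].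
Proof. by rewrite -imset_comp; apply: eq_imset => i; rewrite permM. Qed.

Lemma imset_perm1 (B : {set 'I_7}) : [set (1%g : 'S_7) i | i in B] = B.
Proof. by rewrite -[RHS]imset_id; apply: eq_imset => i; rewrite perm1. Qed.

Lemma fix7_pred_group : group_set (setwise fix7_pred).
Proof.
apply: setwise_group => [|s s' /eqP h /eqP h']; first by rewrite /fix7_pred perm1.
by rewrite /fix7_pred permM h h'.
Qed.

Lemma block567_pred_group : group_set (setwise block567_pred).
Proof.
apply: setwise_group => [|s s' /eqP h /eqP h']; first by rewrite /block567_pred imset_perm1.
by rewrite /block567_pred imset_permM h h'.
Qed.

Lemma total_pred_group : group_set (setwise total_pred).
Proof.
apply: setwise_group => [|s s' /andP[/eqP h7 /eqP h] /andP[/eqP h7' /eqP h']].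
  rewrite /total_pred perm1 eqxx /=; apply/eqP; rewrite -[RHS]imset_id; apply: eq_imset => p.
  by rewrite -[RHS]imset_id; apply: eq_imset => B; rewrite imset_perm1.
rewrite /total_pred permM h7 h7' eqxx /=; apply/eqP; rewrite -[RHS]h' -[in RHS]h -imset_comp.
apply: eq_imset => p /=; rewrite -imset_comp; apply: eq_imset => B /=.
exact: imset_permM.
Qed.

Lemma Alt_conj (s : 'S_7) : ('Alt_('I_7) :^ s = 'Alt_('I_7))%g.
Proof. by apply: (normP _); apply: (subsetP (normal_norm (Alt_normal _))); rewrite inE. Qed.

Lemma setwise_conj (P : pred 'S_7) (u : 'S_7) : group_set (setwise P) -> P u ->
  (('Alt_('I_7) :&: setwise P) :^ u = 'Alt_('I_7) :&: setwise P)%g.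
Proof.
move=> gP hu; rewrite conjIg Alt_conj; congr (_ :&: _).
by apply: (@conjGid _ (Group gP)); rewrite /= in_set.
Qed.

(** Indexed like [reps]: two of the six orbits have stabilizers conjugate to [Sigma_c], and
    [Sigma_b], [Sigma_b'] account for one orbit each. *)
Definition Sig (i : nat) : {set 'S_7} :=
  match i with 0 => Sigma_a | 1 => Sigma_b | 2 => Sigma_b' | 3 | 4 => Sigma_c | _ => Sigma_d end.

Definition sigp (i : nat) (t : table) : bool := (nth ([::], in_d) reps i).2 t.

Lemma SigE i s : (s \in Sig i) = (s \in 'Alt_('I_7)) && sigp i (tb s).
Proof.
case: i => [|[|[|[|[|[|i]]]]]]; rewrite /sigp /=.
- by rewrite in_set /in_a -sapp_eq.
- rewrite -Sigma_bE; apply/idP/andP => [h|[] //]; split=> //; exact: Sigma_b_even.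
- rewrite -Sigma_b'E; apply/idP/andP => [h|[] //]; split=> //.
  by move: h; rewrite -Sigma_b_conj => /imsetP [x /Sigma_b_even hx ->]; rewrite -(Alt_conj swap67) memJ_conjg.
- by rewrite in_set in_cE.
- by rewrite in_set in_cE.
- by rewrite in_set in_dE.
by rewrite nth_nil in_set; change ((s \in 'Alt_('I_7)) && total_pred s = (s \in 'Alt_('I_7)) && in_d (tb s)); rewrite in_dE.
Qed.

Lemma Sigma_aI : Sigma_a = 'Alt_('I_7) :&: setwise fix7_pred.
Proof. by apply/setP => s; rewrite !in_set. Qed.
Lemma Sigma_cI : Sigma_c = 'Alt_('I_7) :&: setwise block567_pred.
Proof. by apply/setP => s; rewrite !in_set. Qed.
Lemma Sigma_dI : Sigma_d = 'Alt_('I_7) :&: setwise total_pred.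
Proof. by apply/setP => s; rewrite !in_set. Qed.

Lemma Sig_group i : group_set (Sig i).
Proof.
have gI (P : pred 'S_7) : group_set (setwise P) -> group_set ('Alt_('I_7) :&: setwise P).
  by move=> gP; apply: (groupP ('Alt_('I_7) :&: Group gP)%G).
have ga := gI _ fix7_pred_group; have gc := gI _ block567_pred_group; have gd := gI _ total_pred_group.
case: i => [|[|[|[|[|i]]]]] /=; rewrite ?Sigma_aI ?Sigma_cI ?Sigma_dI //.
  exact: Sigma_b_group.
rewrite -Sigma_b_conj; exact: (groupP (Group Sigma_b_group :^ swap67)%G).
Qed.

(** Labellings of a component differ by elements of S_7, so S arises up to conjugation by an
    arbitrary s. An odd s is corrected by the odd u, at the price of replacing S by S'. *)
Lemma odd_A7_conj (u s : 'S_7) (S S' : {set 'S_7}) :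
  odd_perm u -> S = (S' :^ u)%g -> A7_conj (S :^ s)%g S \/ A7_conj (S :^ s)%g S'.
Proof.
move=> ou e; case os: (odd_perm s).
  right; exists (u * s)%g; last by rewrite conjsgM -e.
  by rewrite Alt_even odd_permM ou os.
by left; exists s; rewrite // Alt_even os.
Qed.

Lemma odd_tperm12 : odd_perm (tperm (lab 1) (lab 2) : 'S_7).
Proof. by rewrite odd_tperm lab_eq. Qed.

Lemma fix7_pred_odd : fix7_pred (tperm (lab 1) (lab 2)).
Proof. by rewrite /fix7_pred tpermD // lab_eq. Qed.

Lemma block567_pred_odd : block567_pred (tperm (lab 1) (lab 2)).
Proof. by rewrite /block567_pred !imsetU !imset_set1 !tpermD // ?lab_eq. Qed.

(** The 4-cycle (3 5 4 6) preserves the total [t0]. Its parity is found by sorting it with even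
    words, which leaves the transposition (1 2). *)
Lemma total_pred_odd : exists2 u, odd_perm u & total_pred u.
Proof.
have [u tu] : exists u, tb u = [:: 1; 2; 5; 6; 4; 3; 7] by apply: table_perm.
exists u; last by rewrite /total_pred -in_dE tu.
have [v tv] : exists v, tb v = [:: 2; 1; 3; 4; 5; 6; 7] by apply: table_perm.
have vE : v = tperm (lab 1) (lab 2).
  apply: tb_inj; rewrite tv; have h x : x \in tid -> 2 < x -> tapp (tb (tperm (lab 1) (lab 2))) x = x.
    by move=> hx h2; rewrite tapp_tb // tpermD ?lab_eq ?lab_val -?mem_tid //;
      apply: contraTneq h2 => <-.
  by rewrite /tb /= -!tapp_tb // (h 3) // (h 4) // (h 5) // (h 6) // (h 7) // !tapp_tb // tpermL tpermR !lab_val.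
have [w e] := sorted_table_pw u; have {e}/tb_inj e : tb (u * pw w)%g = tb v by rewrite e tu tv.
have := congr1 (@odd_perm _) e; rewrite odd_permM vE odd_tperm12.
by have := pw_even w; rewrite Alt_even => /negbTE ->; rewrite addbF => ->.
Qed.

(** The S_7-classes of [Sigma_a], [Sigma_c], [Sigma_d] do not split in A_7, since each is normalized
    by an odd permutation; (6 7) exchanges [Sigma_b] and [Sigma_b'], and 3 - i is the other of the
    indices 1 and 2. *)
Lemma Sig_A7_conj i (s : 'S_7) :
  A7_conj (Sig i :^ s)%g (Sig i) \/ (i \in [:: 1; 2] /\ A7_conj (Sig i :^ s)%g (Sig (3 - i))).
Proof.
have own (P : pred 'S_7) u : group_set (setwise P) -> Sig i = 'Alt_('I_7) :&: setwise P -> odd_perm u -> P u ->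
    A7_conj (Sig i :^ s)%g (Sig i).
  move=> gP e ou hu; suff [] : A7_conj (Sig i :^ s)%g (Sig i) \/ A7_conj (Sig i :^ s)%g (Sig i) by [].
  by apply: (odd_A7_conj s ou); rewrite e setwise_conj.
have ha := own _ _ fix7_pred_group _ odd_tperm12 fix7_pred_odd.
have hc := own _ _ block567_pred_group _ odd_tperm12 block567_pred_odd.
have [u ou hu] := total_pred_odd; have hd := own _ _ total_pred_group _ ou hu.
have o67 : odd_perm swap67 by rewrite odd_tperm lab_eq.
case: i {own} ha hc hd => [|[|[|[|[|i]]]]] ha hc hd.
- by left; apply: ha Sigma_aI.
- have [] := @odd_A7_conj swap67 s Sigma_b Sigma_b' o67; [|by left|by right].
  by rewrite -Sigma_b_conj -conjsgM tperm2 conjsg1.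
- have [] := @odd_A7_conj swap67 s Sigma_b' Sigma_b o67; [|by left|by right].
  by rewrite Sigma_b_conj.
- by left; apply: hc Sigma_cI.
- by left; apply: hc Sigma_cI.
by left; apply: hd Sigma_dI.
Qed.

(* These two conjugation invariants separate the four classes of subgroups. *)
Definition has_fixpoint (S : {set 'S_7}) : bool := [exists i, [forall s in S, s i == i]].
Definition has_fix4 (S : {set 'S_7}) : bool := [exists s in S, #|[set i | s i == i]| == 4].

Lemma has_fixpoint_conj (S : {set 'S_7}) (u : 'S_7) : has_fixpoint (S :^ u)%g = has_fixpoint S.
Proof.
have imp S' (v : 'S_7) : has_fixpoint S' -> has_fixpoint (S' :^ v)%g.
  move=> /existsP [i /forall_inP hi]; apply/existsP; exists (v i); apply/forall_inP => s.
  move=> /imsetP [x /hi /eqP xi ->]; by rewrite permJ xi.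
by apply/idP/idP; [move/(imp _ u^-1%g); rewrite conjsgK|exact: imp].
Qed.

Lemma has_fix4_conj (S : {set 'S_7}) (u : 'S_7) : has_fix4 (S :^ u)%g = has_fix4 S.
Proof.
have imp S' (v : 'S_7) : has_fix4 S' -> has_fix4 (S' :^ v)%g.
  move=> /exists_inP [x xS /eqP hx]; apply/exists_inP; exists (x ^ v)%g; first by rewrite memJ_conjg.
  apply/eqP; rewrite -[RHS]hx -(card_imset [set i | x i == i] (@perm_inj _ v)); congr #|pred_of_set _|.
  apply/setP => i; rewrite in_set; apply/eqP/imsetP => [e|[j]].
    exists (v^-1%g i); last by rewrite permKV.
    by rewrite in_set; apply/eqP/(@perm_inj _ v); rewrite -permJ permKV.
  by rewrite in_set => /eqP e ->; rewrite permJ e.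
by apply/idP/idP; [move/(imp _ u^-1%g); rewrite conjsgK|exact: imp].
Qed.

Lemma fixcountE (s : 'S_7) : #|[set i | s i == i]| = fixcount (tb s).
Proof.
rewrite /fixcount (_ : tid = map S (map val (enum 'I_7))); last by rewrite val_enum_ord.
rewrite cardE size_filter enumT -enumT !count_map; apply: eq_count => i.
by rewrite /= tapp_tb ?succ_tid // lab_succ in_set.
Qed.

Lemma has_fix4_words i (t : table) : valid_table t -> sorted_table t = tid -> sigp i t ->
  fixcount t = 4 -> has_fix4 (Sig i).
Proof.
move=> /table_perm [s <-] /sorted_even sA hp f4; apply/exists_inP; exists s.
  by rewrite SigE sA.
by rewrite fixcountE f4.
Qed.

Lemma no_fix4 i : (forall t, sigp i t -> in_b t || in_d t) -> ~~ has_fix4 (Sig i).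
Proof.
move=> h; apply/exists_inP => -[s]; rewrite SigE fixcountE => /andP[_ /h hs] /eqP f4.
have := allP b_d_no_fix4 _ (tb_permutations s); rewrite f4 eqxx.
by rewrite hs.
Qed.

Lemma no_fixpoint i (t : table) : valid_table t -> sorted_table t = tid -> sigp i t ->
  fixcount t = 0 -> ~~ has_fixpoint (Sig i).
Proof.
move=> /table_perm [s <-] /sorted_even sA hp f0; apply/existsP => -[j /forall_inP hj].
have sS : s \in Sig i by rewrite SigE sA.
have := fixcountE s; rewrite f0 => /cards0_eq /setP /(_ j); rewrite in_set in_set0.
by rewrite hj.
Qed.

Lemma fix7 i : (forall t, sigp i t -> in_a t) -> has_fixpoint (Sig i).
Proof.
move=> h; apply/existsP; exists (lab 7); apply/forall_inP => s; rewrite SigE => /andP[_ /h].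
by rewrite /in_a -sapp_eq.
Qed.

(** Single elements without fixed points decide the negative cases: a 7-cycle in [Sigma_b] and (1
    2)(3 4)(5 6 7) in [Sigma_c]. *)
Lemma has_fixpoint_Sig i : has_fixpoint (Sig i) = (i == 0) || (4 < i).
Proof.
have hb : has_fixpoint (Sig 1) = false by apply/negbTE/(@no_fixpoint 1 [:: 2; 4; 6; 3; 1; 7; 5]).
have hc : has_fixpoint (Sig 3) = false by apply/negbTE/(@no_fixpoint 3 [:: 2; 1; 4; 3; 6; 7; 5]).
case: i => [|[|[|[|[|i]]]]] //=; first by apply: (@fix7 0).
  by rewrite -Sigma_b_conj has_fixpoint_conj.
by apply: (@fix7 5) => t /andP[].
Qed.

Lemma has_fix4_Sig i : has_fix4 (Sig i) = (i \in [:: 0; 3; 4]).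
Proof.
have hb : has_fix4 (Sig 1) = false by apply/negbTE/no_fix4 => t; rewrite /sigp /= => ->.
have hc : has_fix4 (Sig 3) by apply: (@has_fix4_words 3 [:: 2; 3; 1; 4; 5; 6; 7]).
case: i => [|[|[|[|[|i]]]]] //=; first by apply: (@has_fix4_words 0 [:: 2; 3; 1; 4; 5; 6; 7]).
  by rewrite -Sigma_b_conj has_fix4_conj.
by apply/negbTE/(@no_fix4 5) => t; rewrite /sigp /= => ->; rewrite orbT.
Qed.

Lemma A7_conj_Sig_eq i j (s : 'S_7) : A7_conj (Sig i :^ s)%g (Sig j) ->
  (i == 0) || (4 < i) = (j == 0) || (4 < j) /\ (i \in [:: 0; 3; 4]) = (j \in [:: 0; 3; 4]).
Proof.
move=> [u _ e]; rewrite -!has_fixpoint_Sig -!has_fix4_Sig.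
by rewrite -(has_fixpoint_conj _ s) -(has_fix4_conj (Sig i) s) e has_fixpoint_conj has_fix4_conj.
Qed.

From mathcomp Require Import classical_sets functions cardinality.
From mathcomp Require Import fraction mpoly finmap ring.

Local Open Scope classical_set_scope.
Local Open Scope ring_scope.

Local Notation "x %:F" := (@FracField.tofrac _ x) : ring_scope.
Local Notation act := Defs.act.

(** * Intersection multiplicities *)

Section Substitution.
Variable k : fieldType.
Implicit Types (U V : 'M[k]_3) (f g : {mpoly k[3]}).

Definition lm U : 'End('rV[k]_3) := linfun (mulmxr U).

Lemma lmE U v : lm U v = v *m U.
Proof. by rewrite lfunE. Qed.

Notation subst U := (comp_mpoly [tuple \sum_j U j i *: 'X_j | i < 3]).

Lemma evalv_subst U f v : evalv (subst U f) v = evalv f (v *m U).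
Proof.
rewrite /evalv comp_mpoly_meval; apply: meval_eq => i.
rewrite tnth_mktuple mxE raddf_sum; refine (eq_bigr _ _) => j _.
by rewrite /= mevalZ mevalXU mulrC.
Qed.

Lemma substX U i : subst U 'X_i = \sum_j U j i *: 'X_j.
Proof. by rewrite comp_mpolyXU -tnth_nth tnth_mktuple. Qed.

Lemma substM U V f : subst U (subst V f) = subst (U *m V) f.
Proof.
elim/mpolyind: f => [|c m p _ _ IH]; first by rewrite !raddf0.
rewrite !comp_mpolyD IH !comp_mpolyZ; congr (_ *: _ + _).
rewrite !comp_mpolyX rmorph_prod; apply: eq_bigr => i _ /=.
rewrite rmorphXn /= !tnth_mktuple; congr (_ ^+ _).
rewrite raddf_sum /=; under eq_bigr do rewrite comp_mpolyZ substX scaler_sumr.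
rewrite exchange_big /=; apply: eq_bigr => j _.
rewrite mxE scaler_suml; apply: eq_bigr => l _.
by rewrite scalerA mulrC.
Qed.

Lemma subst1 f : subst 1%:M f = f.
Proof.
rewrite -[RHS]comp_mpoly_id; congr comp_mpoly; apply: eq_from_tnth => i.
rewrite !tnth_mktuple (bigD1 i) //= mxE eqxx scale1r big1 ?addr0 // => j /negbTE ji.
by rewrite mxE ji scale0r.
Qed.

Lemma dhomog_subst U d f : f \is d.-homog -> subst U f \is d.-homog.
Proof.
move=> /dhomogP hf; rewrite comp_mpolyE big_seq; apply: rpred_sum => m /hf <-.
apply: dhomogZ; rewrite [mf in mf.-homog]mdegE.
apply: (big_rec2 (fun p n => p \is n.-homog)) => [|i n p _ hp]; first exact: dhomog1.
apply: dhomogM => //; rewrite tnth_mktuple -[X in X.-homog]mul1n.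
apply: dhomogMn; apply: rpred_sum => j _; apply: dhomogZ.
by rewrite dhomogX; apply/eqP/mdeg1.
Qed.

End Substitution.

Notation subst U := (comp_mpoly [tuple \sum_j U j i *: 'X_j | i < 3]).

Section FractionMap.
Variables (R S : idomainType) (h : {rmorphism R -> S}).
Hypothesis h_inj : injective h.

Lemma frac_numden (x : {fraction R}) :
  exists2 ab : R * R, ab.2 != 0 & x = ab.1%:F / ab.2%:F.
Proof.
elim/quotW: x => r; exists (frac r) => /=; first exact: denom_ratioP.
rewrite -[RHS]/(FracField.mul _ (FracField.inv _)) !piE /FracField.mulf /FracField.invf.
by rewrite !numden_Ratio ?oner_neq0 ?denom_ratioP // mulr1 mul1r Ratio_numden.
Qed.

Lemma eq_frac (T : idomainType) (a b c d : T) : b != 0 -> d != 0 ->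
  (a%:F / b%:F == c%:F / d%:F) = (a * d == c * b).
Proof. by move=> b0 d0; rewrite eqr_div ?tofrac_eq0 // -!tofracM tofrac_eq. Qed.

(** The extension of an injective morphism to fraction fields. The fraction a / b representing x is
    chosen arbitrarily; [frac_mapE] shows that the result does not depend on it. *)
Definition frac_map (x : {fraction R}) : {fraction S} :=
  let ab := xget (0, 1) [set ab : R * R | ab.2 != 0 /\ x = ab.1%:F / ab.2%:F] in
  (h ab.1)%:F / (h ab.2)%:F.

Lemma h_neq0 a : a != 0 -> h a != 0.
Proof. by rewrite -(rmorph0 h) (inj_eq h_inj). Qed.

Lemma frac_mapE a b : b != 0 -> frac_map (a%:F / b%:F) = (h a)%:F / (h b)%:F.
Proof.
move=> b0; rewrite /frac_map; case: xgetP => [[c d] _ /= [d0 /eqP e]|/(_ (a, b))[]//].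
by apply/eqP; rewrite eq_frac ?h_neq0 // -!rmorphM (inj_eq h_inj) -eq_frac // eq_sym.
Qed.

Lemma addf_frac (T : idomainType) (a b c d : T) : b != 0 -> d != 0 ->
  a%:F / b%:F + c%:F / d%:F = (a * d + c * b)%:F / (b * d)%:F.
Proof. by move=> b0 d0; rewrite addf_div ?tofrac_eq0 // -!tofracM -tofracD. Qed.

Lemma oppf_frac (T : idomainType) (a b : T) :
  - (a%:F / b%:F) = (- a)%:F / b%:F.
Proof. by rewrite tofracN mulNr. Qed.

Lemma mulf_frac (T : idomainType) (a b c d : T) :
  a%:F / b%:F * (c%:F / d%:F) = (a * c)%:F / (b * d)%:F.
Proof. by rewrite mulf_div -!tofracM. Qed.

Lemma frac_mapB : {morph frac_map : x y / x - y}.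
Proof.
move=> x y; have [[a b] /= b0 ->] := frac_numden x; have [[c d] /= d0 ->] := frac_numden y.
rewrite oppf_frac addf_frac // !frac_mapE ?mulf_neq0 //.
by rewrite oppf_frac addf_frac ?h_neq0 // !rmorphD !rmorphM !rmorphN.
Qed.

Lemma frac_mapM : {morph frac_map : x y / x * y}.
Proof.
move=> x y; have [[a b] /= b0 ->] := frac_numden x; have [[c d] /= d0 ->] := frac_numden y.
by rewrite mulf_frac !frac_mapE ?mulf_neq0 // mulf_frac !rmorphM.
Qed.

Lemma frac_map0 : frac_map 0 = 0.
Proof. by rewrite -(subrr 0) frac_mapB subrr. Qed.

Lemma frac_map_sum I (r : seq I) (P : pred I) F :
  frac_map (\sum_(i <- r | P i) F i) = \sum_(i <- r | P i) frac_map (F i).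
Proof.
apply: (big_morph frac_map _ frac_map0) => x y.
by rewrite -[y in x + y]opprK frac_mapB -[- y]sub0r frac_mapB frac_map0 sub0r opprK.
Qed.

Lemma frac_map_tofrac a : frac_map a%:F = (h a)%:F.
Proof. by rewrite -[a%:F]divr1 -tofrac1 frac_mapE ?oner_neq0 // !rmorph1 divr1. Qed.
End FractionMap.

Section MultSubst.
Variable k : fieldType.
Implicit Types (U V : 'M[k]_3) (f g : {mpoly k[3]}) (P : subsp k).

Lemma substK U : U \in unitmx -> cancel (subst U) (subst (invmx U)).
Proof. by move=> uU f; rewrite substM mulVmx // subst1. Qed.

Lemma lm1 : lm (1%:M : 'M[k]_3) = \1%VF.
Proof. by apply/lfunP => v; rewrite lmE mulmx1 id_lfunE. Qed.

Lemma lm_comp U V : (lm V \o lm U)%VF = lm (U *m V).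
Proof. by apply/lfunP => v; rewrite comp_lfunE !lmE mulmxA. Qed.

Lemma lm_imgM U V P : (lm V @: (lm U @: P) = lm (U *m V) @: P)%VS.
Proof. by rewrite -limg_comp lm_comp. Qed.

Lemma lm_imgK U P : U \in unitmx -> (lm (invmx U) @: (lm U @: P) = P)%VS.
Proof. by move=> uU; rewrite lm_imgM mulmxV // lm1 lim1g. Qed.

Lemma lm_imgKV U P : U \in unitmx -> (lm U @: (lm (invmx U) @: P) = P)%VS.
Proof. by move=> uU; rewrite lm_imgM mulVmx // lm1 lim1g. Qed.

Definition fsubst U : {fraction {mpoly k[3]}} -> {fraction {mpoly k[3]}} :=
  frac_map (subst U).

Section Fixed.
Variable U : 'M[k]_3.
Hypothesis uU : U \in unitmx.
Let sI : injective (subst U) := can_inj (substK uU).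
Let uV : invmx U \in unitmx. Proof. by rewrite unitmx_inv. Qed.

Lemma fsubstE a b : b != 0 -> fsubst U (a%:F / b%:F) = (subst U a)%:F / (subst U b)%:F.
Proof. exact: frac_mapE. Qed.
End Fixed.

Lemma fsubstK U : U \in unitmx -> cancel (fsubst U) (fsubst (invmx U)).
Proof.
move=> uU x; have [[a b] /= b0 ->] := frac_numden x.
have uV : invmx U \in unitmx by rewrite unitmx_inv.
by rewrite !fsubstE ?substK // (h_neq0 (can_inj (substK uU))).
Qed.

Lemma evalv_neq0 (f : {mpoly k[3]}) v : evalv f v != 0 -> f != 0.
Proof. by apply: contraNneq => ->; rewrite /evalv meval0. Qed.

Lemma memv_lm_img U v P : v \in P -> v *m U \in (lm U @: P)%VS.
Proof. by move=> vP; rewrite -lmE memv_img. Qed.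

Lemma local_ring_subst U P x : U \in unitmx ->
  local_ring P x -> local_ring (lm (invmx U) @: P) (fsubst U x).
Proof.
move=> uU [d [a [b [ha hb [v vP bv] ->]]]].
exists d, (subst U a), (subst U b); rewrite !dhomog_subst //; split=> //.
  exists (v *m invmx U); first exact: memv_lm_img.
  by rewrite evalv_subst mulmxKV.
by rewrite fsubstE // (evalv_neq0 bv).
Qed.

Lemma local_ideal_subst U f g P x : U \in unitmx ->
  local_ideal f g P x ->
  local_ideal (subst U f) (subst U g) (lm (invmx U) @: P) (fsubst U x).
Proof.
move=> uU [d [a [b [ha hb [v vP bv] [h [l e]] ->]]]].
exists d, (subst U a), (subst U b); rewrite !dhomog_subst //; split=> //.
- exists (v *m invmx U); first exact: memv_lm_img.
  by rewrite evalv_subst mulmxKV.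
- by exists (subst U h), (subst U l); rewrite e rmorphD !rmorphM.
by rewrite fsubstE // (evalv_neq0 bv).
Qed.

Lemma local_ideal_substE U f g P x : U \in unitmx ->
  local_ideal (subst U f) (subst U g) (lm (invmx U) @: P) (fsubst U x) <->
  local_ideal f g P x.
Proof.
move=> uU; split; last exact: local_ideal_subst.
have uV : invmx U \in unitmx by rewrite unitmx_inv.
move=> /(local_ideal_subst uV).
by rewrite !substK // fsubstK // invmxK lm_imgKV.
Qed.

Lemma intersection_mult_subst U f g P n : U \in unitmx ->
  intersection_mult f g P n ->
  intersection_mult (subst U f) (subst U g) (lm (invmx U) @: P) n.
Proof.
move=> uU [e [he hx]]; exists (fun i => fsubst U (e i)).
split=> [i|x]; first exact: local_ring_subst.
have uV : invmx U \in unitmx by rewrite unitmx_inv.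
move=> /(local_ring_subst uV); rewrite invmxK lm_imgKV // => /hx [c [hc uc]].
have E c' : x - \sum_(i < n) (c' i)%:MP_[3]%:F * fsubst U (e i) =
   fsubst U (fsubst (invmx U) x - \sum_(i < n) (c' i)%:MP_[3]%:F * e i).
  have sI := can_inj (substK uU).
  rewrite /fsubst frac_mapB // frac_map_sum // -!/(fsubst _ _).
  have := fsubstK uV x; rewrite invmxK /fsubst => ->; congr (_ - _); apply: eq_bigr => i _.
  by rewrite frac_mapM // frac_map_tofrac //= comp_mpolyC.
exists c; split=> [|c']; rewrite E; first exact: local_ideal_subst.
by move=> /(local_ideal_substE _ _ _ _ uU) /uc.
Qed.
End MultSubst.

Notation i0 := (ord0 : 'I_3).
Notation i1 := (lift ord0 ord0 : 'I_3).
Notation i2 := (lift ord0 (lift ord0 ord0) : 'I_3).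

Lemma ord3P (i : 'I_3) : [\/ i = i0, i = i1 | i = i2].
Proof.
by case: i => [[|[|[|//]]] hi]; [apply: Or31|apply: Or32|apply: Or33]; apply: val_inj.
Qed.

Section Transversal.
Variable k : fieldType.
Implicit Types (f g : {mpoly k[3]}).

Definition vx : 'rV[k]_3 := delta_mx 0 i0.

Lemma evalvX (i : 'I_3) v : evalv ('X_i : {mpoly k[3]}) v = v 0 i.
Proof. by rewrite /evalv mevalXU. Qed.

(** The forms of degree d + 1 in the ideal (X1, X2) of the point (1 : 0 : 0). *)
Definition in_point_ideal d f := exists h l,
  [/\ h \is d.-homog, l \is d.-homog & f = 'X_i1 * h + 'X_i2 * l].

Lemma in_point_ideal0 d : in_point_ideal d 0.
Proof. by exists 0, 0; rewrite !dhomog0; split=> //; rewrite !mulr0 addr0. Qed.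

Lemma in_point_idealDZ d c f g :
  in_point_ideal d f -> in_point_ideal d g -> in_point_ideal d (c *: f + g).
Proof.
move=> [h [l [hh hl ->]]] [h' [l' [hh' hl' ->]]].
exists (c *: h + h'), (c *: l + l'); split; try by apply: dhomogD => //; apply: dhomogZ.
by rewrite !mulrDr scalerDr -!scalerAr addrACA.
Qed.

(** Every monomial of this degree other than the power of X0 vanishes at the point and is divisible
    by X1 or X2. *)
Lemma point_ideal_monomial d (m : 'X_{1..3}) : mdeg m = d.+1 ->
  in_point_ideal d ('X_[m] - (evalv 'X_[m] vx) *: 'X_i0 ^+ d.+1).
Proof.
move=> md.
have aux (i : 'I_3) : i != i0 -> (0 < m i)%N ->
    evalv ('X_[m] : {mpoly k[3]}) vx = 0 /\
    exists2 h : {mpoly k[3]}, h \is d.-homog & 'X_[m] = 'X_i * h.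
  move=> ine mi; split.
    rewrite /evalv mevalX (bigD1 i) //= mxE (negbTE ine) andbF expr0n.
    by rewrite -leqn0 leqNgt mi mul0r.
  have mE : m = (U_(i) + (m - U_(i)))%MM.
    by rewrite addmC submK // lep1mP -lt0n.
  exists 'X_[m - U_(i)]; last by rewrite -mpolyXD -mE.
  by rewrite dhomogX; apply/eqP; move: md; rewrite {1}mE mdegD mdeg1 => -[].
have [m1|m1] := posnP (m i1); last first.
  have [-> [h hh ->]] := aux i1 isT m1.
  by exists h, 0; rewrite dhomog0; split=> //; rewrite scale0r subr0 mulr0 addr0.
have [m2|m2] := posnP (m i2); last first.
  have [-> [h hh ->]] := aux i2 isT m2.
  by exists 0, h; rewrite dhomog0; split=> //; rewrite scale0r subr0 mulr0 add0r.
suff -> : 'X_[m] = 'X_i0 ^+ d.+1 :> {mpoly k[3]}.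
  rewrite {1}/evalv rmorphXn /= -/(evalv _ vx) evalvX mxE !eqxx expr1n scale1r subrr.
  exact: in_point_ideal0.
rewrite mpolyXn; congr 'X_[_]; apply/mnmP => i.
rewrite mulmnE mnm1E -md mdegE !big_ord_recl big_ord0 m1 m2 !addn0.
by case: (ord3P i) => ->; rewrite ?m1 ?m2 //= mul1n.
Qed.

Lemma point_idealP d f : f \is d.+1.-homog -> evalv f vx = 0 -> in_point_ideal d f.
Proof.
move=> /dhomogP hf f0.
suff : in_point_ideal d (f - evalv f vx *: 'X_i0 ^+ d.+1) by rewrite f0 scale0r subr0.
have -> : f - evalv f vx *: 'X_i0 ^+ d.+1 =
    \sum_(m <- msupp f) f@_m *: ('X_[m] - evalv 'X_[m] vx *: 'X_i0 ^+ d.+1).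
  rewrite [in LHS](mpolyE f) {1}/evalv raddf_sum scaler_suml -sumrB.
  by apply: eq_bigr => m _ /=; rewrite mevalZ scalerBr scalerA.
rewrite big_seq; apply: (big_ind (in_point_ideal d)) => [|x y hx hy|m /hf md].
- exact: in_point_ideal0.
- by rewrite -[x]scale1r; apply: in_point_idealDZ.
rewrite -[X in in_point_ideal _ X]addr0; apply: in_point_idealDZ; last exact: in_point_ideal0.
exact: point_ideal_monomial.
Qed.

Lemma evalvZ d f c v : f \is d.-homog -> evalv f (c *: v) = c ^+ d * evalv f v.
Proof.
move=> /dhomogP hf; rewrite /evalv !mevalE mulr_sumr big_seq [RHS]big_seq.
apply: eq_bigr => m /hf md; rewrite mulrCA; congr (_ * _).
under eq_bigr do rewrite mxE exprMn.
rewrite big_split /= -md; congr (_ * _).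
by rewrite prodrXr; congr (_ ^+ _); rewrite [RHS]mdegE.
Qed.

Lemma evalvD f g v : evalv (f + g) v = evalv f v + evalv g v.
Proof. exact: mevalD. Qed.
Lemma evalvB f g v : evalv (f - g) v = evalv f v - evalv g v.
Proof. exact: mevalB. Qed.
Lemma evalvM f g v : evalv (f * g) v = evalv f v * evalv g v.
Proof. exact: mevalM. Qed.
Lemma evalvZl c f v : evalv (c *: f) v = c * evalv f v.
Proof. exact: mevalZ. Qed.

Lemma mderivXU (i j : 'I_3) : ('X_j : {mpoly k[3]})^`M(i) = (i == j)%:R%:MP.
Proof.
rewrite mderivX mnm1E eq_sym; have [->|_] := eqVneq i j; last by rewrite scale0r.
by rewrite scale1r -{1}[U_(j)%MM]add0m addmK mpolyX0 mpolyC1.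
Qed.

Lemma point_ideal_deriv d f h l : h \is d.-homog -> l \is d.-homog ->
  f = 'X_i1 * h + 'X_i2 * l ->
  evalv f^`M(i1) vx = evalv h vx /\ evalv f^`M(i2) vx = evalv l vx.
Proof.
move=> hh hl ->; rewrite !mderivD !mderivM !mderivXU.
by split; rewrite /evalv !rmorphD !rmorphM /= !mevalC !mevalXU !mxE /= !(mul0r, mul1r, addr0, add0r).
Qed.

Lemma homog_neq0_on_line d (b : {mpoly k[3]}) v w : b \is d.-homog -> w \in <[v]>%VS ->
  evalv b w != 0 -> evalv b v != 0.
Proof. by move=> hb /vlineP [c ->]; rewrite (evalvZ _ _ hb) mulf_eq0 negb_or => /andP[]. Qed.

Lemma local_idealDM f g v x y z :
  local_ideal f g <[v]> x -> local_ideal f g <[v]> y -> local_ring <[v]> z ->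
  local_ideal f g <[v]> (z * x + y).
Proof.
move=> [d1 [a1 [b1 [ha1 hb1 [w1 w1P b1w] [h1 [l1 e1]] ->]]]].
move=> [d2 [a2 [b2 [ha2 hb2 [w2 w2P b2w] [h2 [l2 e2]] ->]]]].
move=> [d3 [a3 [b3 [ha3 hb3 [w3 w3P b3w] ->]]]].
have b1v := homog_neq0_on_line hb1 w1P b1w.
have b2v := homog_neq0_on_line hb2 w2P b2w.
have b3v := homog_neq0_on_line hb3 w3P b3w.
exists (d3 + d1 + d2)%N, (a3 * a1 * b2 + a2 * (b3 * b1)), (b3 * b1 * b2); split.
- apply: dhomogD; first by do 2?apply: dhomogM.
  by rewrite addnC; do 2?apply: dhomogM.
- by do 2?apply: dhomogM.
- by exists v; rewrite ?memv_line // !evalvM !mulf_neq0.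
- exists (a3 * b2 * h1 + b3 * b1 * h2), (a3 * b2 * l1 + b3 * b1 * l2).
  by rewrite e1 e2; ring.
by rewrite mulf_frac addf_frac // ?mulf_neq0 ?(evalv_neq0 b1v) ?(evalv_neq0 b2v) ?(evalv_neq0 b3v).
Qed.

Lemma local_ring_const v (c : k) : local_ring <[v]> (c%:MP_[3]%:F).
Proof.
exists 0%N, c%:MP, 1; rewrite dhomog1; split=> //.
- by rewrite -[c%:MP_[3]]mulr1 mul_mpolyC dhomogZ // dhomog1.
- by exists v; rewrite ?memv_line // /evalv meval1 oner_neq0.
by rewrite tofrac1 divr1.
Qed.

Lemma local_ideal0 f g v : local_ideal f g <[v]> 0.
Proof.
exists 0%N, 0, 1; rewrite dhomog1 dhomog0; split=> //.
- by exists v; rewrite ?memv_line // /evalv meval1 oner_neq0.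
- by exists 0, 0; rewrite !mulr0 addr0.
by rewrite tofrac0 mul0r.
Qed.

(** Write f = X1 A + X2 B and g = X1 C + X2 D. The hypothesis says that AD - BC is a unit of the
    local ring, so X1 and X2 lie in the ideal (f, g); the quotient is then spanned by the constants
    and cannot have dimension 2. *)
Lemma mult_transversal f g d d' : f \is d.+1.-homog -> g \is d'.+1.-homog ->
  evalv f vx = 0 -> evalv g vx = 0 ->
  evalv f^`M(i1) vx * evalv g^`M(i2) vx != evalv f^`M(i2) vx * evalv g^`M(i1) vx ->
  ~ intersection_mult f g <[vx]> 2.
Proof.
move=> hf hg f0 g0 D0.
have [A [B [hA hB fE]]] := point_idealP hf f0.
have [C [D [hC hD gE]]] := point_idealP hg g0.
have [fA fB] := point_ideal_deriv hA hB fE; have [gC gD] := point_ideal_deriv hC hD gE.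
move: D0; rewrite {}fA {}fB {}gC {}gD => D0.
set del := A * D - B * C.
have del0 : evalv del vx != 0 by rewrite evalvB !evalvM subr_eq0.
have hdel : del \is (d + d').-homog.
  by apply: rpredB; apply: dhomogM.
have const x : local_ring <[vx]> x ->
    exists c : k, local_ideal f g <[vx]> (x - c%:MP_[3]%:F).
  move=> [e [a [b [ha hb [w wP bw] ->]]]].
  have bv := homog_neq0_on_line hb wP bw.
  pose c := evalv a vx / evalv b vx; exists c.
  have bc : evalv (a - c *: b) vx = 0 by rewrite evalvB evalvZl divfK // subrr.
  have hbc : a - c *: b \is e.-homog by apply: rpredB => //; apply: dhomogZ.
  (* The factor X0 is a unit at the point and makes the degree positive, as [point_idealP]
     requires. *)
  have hbX : ('X_i0 * (a - c *: b) : {mpoly k[3]}) \is e.+1.-homog.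
    by rewrite -[e.+1]add1n dhomogM // dhomogX; apply/eqP/mdeg1.
  have [h [l [hh hl hE]]] : in_point_ideal e ('X_i0 * (a - c *: b)).
    by apply: point_idealP => //; rewrite evalvM bc mulr0.
  exists (e.+1 + (d + d'))%N, ('X_i0 * (a - c *: b) * del), ('X_i0 * b * del); split.
  - exact: dhomogM.
  - apply: dhomogM => //; rewrite -[e.+1]add1n; apply: dhomogM => //.
    by rewrite dhomogX; apply/eqP/mdeg1.
  - exists vx; rewrite ?memv_line // !evalvM !mulf_neq0 // evalvX mxE !eqxx.
    exact: oner_neq0.
  (* Cramer's rule: these combinations of f and g give X1 h + X2 l times the determinant. *)
  - exists (h * D - l * C), (l * A - h * B); rewrite hE fE gE /del.
    ring.
  have X0 : ('X_i0 : {mpoly k[3]}) != 0.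
    by apply: (@evalv_neq0 _ _ vx); rewrite evalvX mxE !eqxx oner_neq0.
  have b0 := evalv_neq0 bv; have del00 := evalv_neq0 del0.
  rewrite -[_%:MP_[_]%:F]divr1 -tofrac1 oppf_frac addf_frac ?oner_neq0 //.
  apply/eqP; rewrite eq_frac ?mulf_neq0 ?oner_neq0 //; apply/eqP.
  by rewrite -mul_mpolyC; ring.
move=> [e [he hu]].
have [c0 hc0] := const _ (he ord0); have [c1 hc1] := const _ (he (lift ord0 ord0)).
have ring0 : local_ring <[vx]> (0 : {fraction {mpoly k[3]}}).
  by have := local_ring_const vx 0; rewrite mpolyC0 tofrac0.
have [c [_ uc]] := hu 0 ring0.
(* The basis elements are congruent to the constants c0 and c1, so a relation between c0 and c1 is a
   second way to write 0 in the quotient. Two scalars always satisfy a nontrivial relation, (1, 0)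
   or (c1, -c0), against uniqueness. *)
have E0 (a0 a1 : k) : a0 * c0 + a1 * c1 = 0 -> a0 = 0 /\ a1 = 0.
  move=> ea.
  pose cf (x0 x1 : k) : {ffun 'I_2 -> k} := [ffun i => if i == ord0 then x0 else x1].
  have z := uc (cf 0 0); have nz := uc (cf a0 a1).
  have : cf a0 a1 = cf 0 0.
    rewrite -z; last first.
      rewrite big1 ?subrr; first exact: local_ideal0.
      by move=> i _; rewrite ffunE if_same mpolyC0 tofrac0 mul0r.
    apply/esym/nz; rewrite !big_ord_recl big_ord0 !ffunE /= addr0 sub0r opprD.
    suff -> : - (a0%:MP_[3]%:F * e ord0) - a1%:MP_[3]%:F * e (lift ord0 ord0) =
        (- a0)%:MP_[3]%:F * (e ord0 - c0%:MP_[3]%:F) +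
        ((- a1)%:MP_[3]%:F * (e (lift ord0 ord0) - c1%:MP_[3]%:F) + 0).
      apply: local_idealDM => //; last exact: local_ring_const.
      apply: local_idealDM => //; [exact: local_ideal0|exact: local_ring_const].
    have -> : 0 = - (a0 * c0 + a1 * c1)%:MP_[3]%:F :> {fraction {mpoly k[3]}}.
      by rewrite ea mpolyC0 tofrac0 oppr0.
    rewrite !mpolyCN mpolyCD !mpolyCM !tofracN tofracD !tofracM; ring.
  by move=> /ffunP E; have := E ord0; have := E (lift ord0 ord0); rewrite !ffunE.
have [c00|/negP c00] := eqVneq c0 0.
  by have [] := E0 1 0; rewrite ?mul1r ?mul0r ?c00 ?addr0 // => /eqP; rewrite oner_eq0.
have [_ /eqP] : c1 = 0 /\ - c0 = 0 by apply: E0; rewrite mulNr mulrC subrr.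
by rewrite oppr_eq0.
Qed.

Lemma evalv_subst_deriv (U : 'M[k]_3) f i v :
  evalv (subst U f)^`M(i) v = \sum_l U i l * evalv f^`M(l) (v *m U).
Proof.
pose chain f := forall v, evalv (subst U f)^`M(i) v = \sum_l U i l * evalv f^`M(l) (v *m U).
have chainM g h : chain g -> chain h -> chain (g * h).
  move=> hg hh w; rewrite rmorphM /= mderivM evalvD !evalvM hg hh !evalv_subst.
  rewrite mulr_suml mulr_sumr -big_split; apply: eq_bigr => l _ /=.
  by rewrite mderivM evalvD !evalvM mulrDr !mulrA; congr (_ + _); rewrite mulrAC mulrC mulrA.
have chainC c : chain c%:MP.
  move=> w; rewrite comp_mpolyC mderivC /evalv meval0 big1 // => l _.
  by rewrite mderivC meval0 mulr0.
have chainX j : chain 'X_j.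
  move=> w; rewrite substX raddf_sum /evalv raddf_sum (bigD1 i) //= big1 => [|l li].
    rewrite addr0 mderivZ mderivXU eqxx mevalZ mevalC mulr1 (bigD1 j) //= big1 ?addr0.
      by rewrite mderivXU eqxx mevalC mulr1.
    by move=> l lj; rewrite mderivXU (negbTE lj) mevalC mulr0.
  by rewrite mderivZ mderivXU eq_sym (negbTE li) mevalZ mevalC mulr0.
move: v; rewrite -/(chain f); elim/mpolyind: f => [|c m p _ _ hp w].
  by have := chainC 0; rewrite mpolyC0.
rewrite comp_mpolyD mderivD evalvD hp -mul_mpolyC.
have -> : chain (c%:MP * 'X_[m]).
  apply: (chainM); first exact: chainC.
  rewrite mpolyXE_id; apply: (big_ind chain) => [|g h|j _].
  - exact: (chainC 1).
  - exact: (chainM).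
  by elim: (m j) => [|n IH]; [exact: (chainC 1)|rewrite exprS; apply: chainM].
by rewrite -big_split; apply: eq_bigr => l _ /=; rewrite mderivD evalvD mulrDr.
Qed.
End Transversal.

(** * Classification of the totally tangent conics *)

Section Forms.
Variable k : fieldType.
Implicit Types (f g q : {mpoly k[3]}) (S : 'M[k]_3) (v w : 'rV[k]_3).

Definition bil S v w : k := (v *m S *m w^T) 0 0.
Definition herm v w : k := \sum_i v 0 i ^+ 5 * w 0 i.

Lemma bilE S v w : bil S v w = \sum_i (v *m S) 0 i * w 0 i.
Proof. by rewrite /bil mxE; apply: eq_bigr => i _; rewrite [w^T i 0]mxE. Qed.

Lemma bilDl S u v w : bil S (u + v) w = bil S u w + bil S v w.
Proof. by rewrite /bil !mulmxDl mxE. Qed.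
Lemma bilDr S u v w : bil S w (u + v) = bil S w u + bil S w v.
Proof. by rewrite /bil linearD /= mulmxDr mxE. Qed.
Lemma bilZl S c v w : bil S (c *: v) w = c * bil S v w.
Proof. by rewrite /bil -!scalemxAl mxE. Qed.
Lemma bilZr S c v w : bil S v (c *: w) = c * bil S v w.
Proof. by rewrite /bil linearZ /= -!scalemxAr mxE. Qed.
Lemma bilC S v w : S^T = S -> bil S v w = bil S w v.
Proof.
move=> sS; have -> : bil S v w = ((v *m S *m w^T)^T) 0 0 by rewrite mxE.
by rewrite !trmx_mul trmxK sS mulmxA.
Qed.

Lemma mulmx_delta v (i j l : 'I_3) : (v *m delta_mx i j) 0 l = v 0 i * (l == j)%:R.
Proof.
rewrite mxE (bigD1 i) //= big1 ?addr0 => [|p /negbTE pi]; rewrite mxE ?eqxx //.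
by rewrite pi mulr0.
Qed.

Lemma sum_delta (V : pzRingType) n (j : 'I_n) (F : 'I_n -> V) : \sum_l (l == j)%:R * F l = F j.
Proof.
rewrite (bigD1 j) //= eqxx mul1r big1 ?addr0 // => l /negbTE ->; exact: mul0r.
Qed.

Definition matrix_of_form q S := [/\ S^T = S, forall v, evalv q v = bil S v v &
  forall v i, evalv q^`M(i) v = 2 * (v *m S) 0 i].

Lemma matrix_of_form_exists q : (2 : k) != 0 -> q \is 2.-homog -> exists S, matrix_of_form q S.
Proof.
move=> two0 /dhomogP hq.
pose good f := exists S, matrix_of_form f S.
have good0 : good 0.
  exists 0; split=> [|v|v i]; rewrite ?trmx0 // /bil ?mulmx0 ?mul0mx /evalv ?mderiv0 meval0 mxE //.
  by rewrite mulr0.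
have goodD f g : good f -> good g -> good (f + g).
  move=> [A [sA fA dA]] [B [sB fB dB]]; exists (A + B); split=> [|v|v i].
  - by rewrite linearD /= sA sB.
  - by rewrite evalvD fA fB /bil mulmxDr mulmxDl [RHS]mxE.
  - by rewrite mderivD evalvD dA dB mulmxDr [in RHS]mxE mulrDr.
have goodZ c f : good f -> good (c *: f).
  move=> [A [sA fA dA]]; exists (c *: A); split=> [|v|v i].
  - by rewrite linearZ /= sA.
  - by rewrite evalvZl fA /bil -scalemxAr -scalemxAl [RHS]mxE.
  - by rewrite mderivZ evalvZl dA -scalemxAr [in RHS]mxE mulrCA.
have goodX (i j : 'I_3) : good ('X_i * 'X_j).
  exists (2^-1 *: (delta_mx i j + delta_mx j i)); split=> [|v|v l].
  - by rewrite linearZ linearD /= !trmx_delta addrC.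
  - rewrite evalvM !evalvX bilE -scalemxAr mulmxDr.
    transitivity (2^-1 * (v 0 i * v 0 j + v 0 j * v 0 i)); first by field.
    rewrite (eq_bigr (fun l => 2^-1 * (v 0 i * ((l == j)%:R * v 0 l)
                                   + v 0 j * ((l == i)%:R * v 0 l)))) => [|l _].
      by rewrite -mulr_sumr big_split /= -!mulr_sumr !sum_delta.
    by rewrite mxE mxE !mulmx_delta; ring.
  - rewrite mderivM !mderivXU evalvD !evalvM !evalvX /evalv !mevalC.
    rewrite -scalemxAr mulmxDr mxE mxE !mulmx_delta ![l == _]eq_sym.
    by rewrite mulrA divff // mul1r ![_ * v 0 _]mulrC addrC eq_sym [l == i]eq_sym.
have -> : q = \sum_(m <- msupp q) q@_m *: 'X_[m] by exact: mpolyE.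
rewrite big_seq; apply: (big_ind good) => // m /hq md; apply: goodZ.
have [i mi] : exists i, (0 < m i)%N.
  apply: contrapT => h.
  have : mdeg m == 0%N.
    rewrite mdeg_eq0; apply/eqP/mnmP => i; rewrite mnm0E; apply/eqP.
    by rewrite -leqn0 leqNgt; apply/negP => mi; apply: h; exists i.
  by rewrite [mdeg m]md.
have mE : m = (U_(i) + (m - U_(i)))%MM by rewrite addmC submK // lep1mP -lt0n.
have : mdeg (m - U_(i)) = 1%N by move: md; rewrite {1}mE /= mdegD mdeg1 => -[].
move=> /eqP; rewrite mdeg_eq1 => /existsP [j /eqP mj].
by rewrite mE mj mpolyXD.
Qed.

Lemma mderiv_exp f n i : (f ^+ n)^`M(i) = f ^+ n.-1 * f^`M(i) *+ n.
Proof.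
elim: n => [|n IH]; first by rewrite expr0 -mpolyC1 mderivC mulr0n.
rewrite exprS mderivM IH; case: n {IH} => [|n].
  by rewrite mulr0n mulr0 addr0 expr0 mulr1 mul1r mulr1n.
by rewrite -!pred_Sn exprS; ring.
Qed.

Lemma evalv_fermat v : evalv (fermat k) v = herm v v.
Proof.
rewrite /evalv raddf_sum; apply: eq_bigr => i _ /=.
by rewrite rmorphXn /= mevalXU exprSr.
Qed.

Lemma fermat_homog : fermat k \is 6.-homog.
Proof.
apply: rpred_sum => i _; rewrite -[6%N]mul1n; apply: dhomogMn.
by rewrite dhomogX; apply/eqP/mdeg1.
Qed.

Lemma evalv_fermat_deriv v i : evalv (fermat k)^`M(i) v = v 0 i ^+ 5 *+ 6.
Proof.
rewrite raddf_sum /= /evalv raddf_sum (bigD1 i) //= big1 => [|j ji].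
  by rewrite addr0 mderiv_exp mderivXU eqxx mulr1 rmorphMn rmorphXn /= mevalXU.
by rewrite mderiv_exp mderivXU eq_sym (negbTE ji) mulr0 mul0rn meval0.
Qed.

Lemma hermDr u v w : herm w (u + v) = herm w u + herm w v.
Proof. by rewrite /herm -big_split; apply: eq_bigr => i _; rewrite mxE mulrDr. Qed.
Lemma hermZr c v w : herm v (c *: w) = c * herm v w.
Proof. by rewrite /herm mulr_sumr; apply: eq_bigr => i _; rewrite mxE mulrCA. Qed.
Lemma hermZl c v w : herm (c *: v) w = c ^+ 5 * herm v w.
Proof. by rewrite /herm mulr_sumr; apply: eq_bigr => i _; rewrite mxE exprMn mulrA. Qed.

Definition mat3 (a b c : 'rV[k]_3) : 'M[k]_3 :=
  \matrix_i (if i == i0 then a else if i == i1 then b else c).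

Lemma row_mat3 a b c : [/\ row i0 (mat3 a b c) = a, row i1 (mat3 a b c) = b
  & row i2 (mat3 a b c) = c].
Proof. by split; rewrite rowK. Qed.

Lemma sum3 (V : nmodType) (F : 'I_3 -> V) : \sum_i F i = F i0 + F i1 + F i2.
Proof. by rewrite !big_ord_recl big_ord0 addr0 addrA. Qed.

Lemma mul_mat3 x a b c : x *m mat3 a b c = x 0 i0 *: a + x 0 i1 *: b + x 0 i2 *: c.
Proof. by rewrite mulmx_sum_row sum3; have [-> -> ->] := row_mat3 a b c. Qed.

Lemma mat3_unit a b c :
  (forall x y z, x *: a + y *: b + z *: c = 0 -> [/\ x = 0, y = 0 & z = 0]) ->
  mat3 a b c \in unitmx.
Proof.
move=> h; rewrite -row_free_unit -kermx_eq0; apply/eqP/row_matrixP => i; rewrite row0.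
have /h[x0 y0 z0] : row i (kermx (mat3 a b c)) 0 i0 *: a + row i (kermx (mat3 a b c)) 0 i1 *: b
   + row i (kermx (mat3 a b c)) 0 i2 *: c = 0.
  by rewrite -mul_mat3 -row_mul mulmx_ker row0.
by apply/rowP => j; rewrite [RHS]mxE; case: (ord3P j) => ->.
Qed.

Lemma vx_mat3 a b c : vx k *m mat3 a b c = a.
Proof. by rewrite mul_mat3 !mxE /= scale1r !scale0r !addr0. Qed.

Lemma lm_line U (v : 'rV[k]_3) : (lm U @: <[v]> = <[v *m U]>)%VS.
Proof. by rewrite limg_line lmE. Qed.

(** In a frame (v, t, u) with u off the tangent line of Q, the partial derivatives at v are (0, 2
    bil(v, u)) for Q and (herm(v, t), herm(v, u)) for the sextic, as 6 = 1 in k. If herm(v, t) were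
    nonzero, the two curves would meet transversally. *)
Lemma tangency (char5 : 5%N \in [pchar k]) q S v t :
  matrix_of_form q S -> q \is 2.-homog -> S \in unitmx -> v != 0 -> bil S v v = 0 ->
  herm v v = 0 -> intersection_mult q (fermat k) <[v]> 2 ->
  bil S v t = 0 -> herm v t = 0.
Proof.
move=> [sS fS dS] hq uS v0 vv hvv hm vt.
apply: contrapT => ht.
have [u hu] : exists u, bil S v u != 0.
  apply: contrapT => h; case/eqP: v0; rewrite -(mulmxK uS v).
  suff -> : v *m S = 0 by rewrite mul0mx.
  apply/rowP => i; rewrite [RHS]mxE; apply: contrapT => /eqP h'; case: h.
  exists (delta_mx 0 i); rewrite bilE (bigD1 i) //= big1 ?addr0.
    by rewrite [X in _ * X]mxE !eqxx mulr1.
  by move=> j /negbTE ji; rewrite [X in _ * X]mxE ji andbF mulr0.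
pose U := mat3 v t u.
have uU : U \in unitmx.
  apply: mat3_unit => x y z e.
  have := congr1 (bil S v) e; rewrite !bilDr !bilZr vv vt !mulr0 !add0r.
  have -> : bil S v 0 = 0 by rewrite -(scale0r 0) bilZr mul0r.
  move=> /eqP; rewrite mulf_eq0 (negbTE hu) orbF => /eqP z0.
  move: e; rewrite z0 scale0r addr0 => e.
  have := congr1 (herm v) e; rewrite hermDr !hermZr hvv mulr0 add0r.
  have -> : herm v 0 = 0 by rewrite -(scale0r 0) hermZr mul0r.
  move=> /eqP; rewrite mulf_eq0 => /orP[/eqP y0|/eqP //].
  move: e; rewrite y0 scale0r addr0 => /eqP; rewrite scaler_eq0 (negbTE v0) orbF.
  by move=> /eqP.
have := intersection_mult_subst uU hm.
rewrite lm_line -(vx_mat3 v t u) -/U mulmxK //.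
apply: (@mult_transversal _ _ _ 1 5).
- exact: dhomog_subst.
- exact/dhomog_subst/fermat_homog.
- by rewrite evalv_subst vx_mat3 fS.
- by rewrite evalv_subst vx_mat3 evalv_fermat.
have six : (6 : k) = 1.
  have /eqP : (5%N)%:R == 0 :> k by rewrite (pcharf0 char5).
  by rewrite (natrD _ 5 1) => ->; rewrite add0r.
have dU j : evalv (subst U (fermat k))^`M(j) (vx k) = herm v (row j U).
  rewrite evalv_subst_deriv vx_mat3; apply: eq_bigr => l _.
  by rewrite evalv_fermat_deriv -mulr_natl six mul1r mulrC [row j U 0 l]mxE.
have dq j : evalv (subst U q)^`M(j) (vx k) = 2 * bil S v (row j U).
  rewrite evalv_subst_deriv vx_mat3 bilE mulr_sumr; apply: eq_bigr => l _.
  by rewrite dS [row j U 0 l]mxE; ring.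
rewrite !dU !dq; have [_ -> ->] := row_mat3 v t u.
rewrite vt mulr0 mul0r eq_sym mulf_neq0 //; last exact/eqP.
rewrite mulf_neq0 //.
have : (5 : k) == 0 by rewrite (pcharf0 char5).
apply: contraTneq => e; have -> : (5 : k) = 2 * 2 + 1 by ring.
by rewrite e mul0r add0r oner_eq0.
Qed.
End Forms.

Lemma card_seqP (T : choiceType) (A : set T) n :
  (A #= `I_n)%card <-> exists s : seq T, [/\ uniq s, size s = n & A = [set` s]].
Proof.
split=> [h|[s [us <- ->]]].
  have fA : finite_set A by exists n.
  exists (fset_set A); split; [exact: fset_uniq| |by rewrite fset_setK].
  by apply/card_eq_fsetP; rewrite fset_setK.
have -> : [set` s] = [set` [fset x in s]%fset].
  by apply/seteqP; split=> x /=; rewrite inE.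
by apply/card_eq_fsetP; rewrite card_fseq undup_id.
Qed.

Lemma closed_root_exists (k : closedFieldType) (a : k) n : (0 < n)%N -> exists x, x ^+ n = a.
Proof.
move=> n0; have [x hx] := @solve_monicpoly k n (fun i => if i == 0%N then a else 0) n0.
exists x; rewrite hx; case: n n0 {hx} => // n _.
by rewrite big_ord_recl /= expr0 mulr1 big1 ?addr0 // => i _; rewrite mul0r.
Qed.

Section Lines.
Variable k : fieldType.
Implicit Types (v w : 'rV[k]_3) (P : subsp k).

Lemma dim1_line P : \dim P = 1%N -> exists2 v, v != 0 & P = <[v]>%VS.
Proof.
move=> d1; exists (vpick P); first by rewrite vpick0 -dimv_eq0 d1.
by apply/esym/eqP; rewrite eqEdim -memvE memv_pick d1 dim_vline vpick0 -dimv_eq0 d1.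
Qed.

Lemma line_eqP v w : v != 0 -> (<[v]> = <[w]>)%VS <-> exists2 c, c != 0 & v = c *: w.
Proof.
move=> v0; split=> [e|[c c0 ->]].
  have /vlineP [c vE] : v \in <[w]>%VS by rewrite -e memv_line.
  by exists c => //; apply: contraNneq v0 => c0; rewrite vE c0 scale0r.
apply/eqP; rewrite eqEsubv -!memvE memvZ ?memv_line //=.
by rewrite -[w in w \in _](scalerK c0) memvZ ?memv_line.
Qed.

Lemma line_scale c v : c != 0 -> (<[c *: v]> = <[v]>)%VS.
Proof.
move=> c0; have [->|v0] := eqVneq v 0; first by rewrite scaler0.
by apply/line_eqP; [rewrite scaler_eq0 negb_or c0|exists c].
Qed.

Lemma zeros_line d q v : q \is d.-homog -> zeros q <[v]>%VS <-> v != 0 /\ evalv q v = 0.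
Proof.
move=> hq; rewrite /zeros /= dim_vline; split=> [[vd h]|[-> e]].
  split; last by apply: h; exact: memv_line.
  by move: vd; case: (v != 0).
by split=> // w /vlineP [c ->]; rewrite (evalvZ _ _ hq) e mulr0.
Qed.

Lemma zerosP d q P : q \is d.-homog ->
  zeros q P <-> exists v, [/\ v != 0, evalv q v = 0 & P = <[v]>%VS].
Proof.
move=> hq; split=> [h|[v [v0 e ->]]]; last by apply/(zeros_line _ hq).
have [v v0 PE] := dim1_line h.1; exists v; split=> //.
by move: h; rewrite PE => /(zeros_line _ hq) [].
Qed.

Lemma Gamma_line v : @Gamma k <[v]>%VS <-> v != 0 /\ herm v v = 0.
Proof. by rewrite -evalv_fermat; apply: zeros_line; exact: fermat_homog. Qed.

Lemma GammaP P : Gamma P <-> exists v, [/\ v != 0, herm v v = 0 & P = <[v]>%VS].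
Proof.
split=> [/(zerosP _ (fermat_homog k)) [v [v0 e ->]]|[v [v0 e ->]]].
  by exists v; rewrite -evalv_fermat.
exact/Gamma_line.
Qed.

Definition Cset (M : 'M[k]_3) : set (subsp k) :=
  [set P | exists x : 'rV[k]_3, [/\ x != 0, x 0 i1 ^+ 2 = x 0 i0 * x 0 i2 & P = <[x *m M]>%VS]].

Definition gram (M : 'M[k]_3) : 'M[k]_3 := \matrix_(i, j) herm (row i M) (row j M).

Definition vec3 (a b c : k) : 'rV[k]_3 :=
  \row_j (if j == i0 then a else if j == i1 then b else c).

Lemma vec3E a b c : (vec3 a b c 0 i0 = a) * (vec3 a b c 0 i1 = b) * (vec3 a b c 0 i2 = c).
Proof. by rewrite !mxE. Qed.

Lemma vec3_eta v : v = vec3 (v 0 i0) (v 0 i1) (v 0 i2).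
Proof. by apply/rowP => j; case: (ord3P j) => ->; rewrite vec3E. Qed.

Lemma vec3_eq0 a b c : (vec3 a b c == 0) = [&& a == 0, b == 0 & c == 0].
Proof.
apply/eqP/and3P => [/rowP e|[/eqP-> /eqP-> /eqP->]].
  by have := e i0; have := e i1; have := e i2; rewrite !vec3E !mxE => -> -> ->.
by apply/rowP => j; case: (ord3P j) => ->; rewrite vec3E mxE.
Qed.

Lemma vec3Z x a b c : x *: vec3 a b c = vec3 (x * a) (x * b) (x * c).
Proof. by apply/rowP => j; case: (ord3P j) => ->; rewrite mxE !vec3E. Qed.

Lemma row_vec3 (M : 'M[k]_3) : [/\ row i0 M = vec3 1 0 0 *m M, row i1 M = vec3 0 1 0 *m M
  & row i2 M = vec3 0 0 1 *m M].
Proof.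
by split; rewrite mulmx_sum_row sum3 !vec3E !scale0r scale1r ?addr0 ?add0r.
Qed.

Hypothesis char5 : 5%N \in [pchar k].

Lemma pow5D (x y : k) : (x + y) ^+ 5 = x ^+ 5 + y ^+ 5.
Proof. by rewrite -!(pFrobenius_autE char5) rmorphD. Qed.

Lemma five0 : 5 = 0 :> k.
Proof. exact: pcharf0 char5. Qed.

Lemma hermDl u v w : herm (u + v) w = herm u w + herm v w.
Proof. by rewrite /herm -big_split; apply: eq_bigr => i _; rewrite mxE pow5D mulrDl. Qed.

Lemma herm_mul (M : 'M[k]_3) x y : herm (x *m M) (y *m M) =
  \sum_i \sum_j x 0 i ^+ 5 * gram M i j * y 0 j.
Proof.
rewrite !mulmx_sum_row !sum3 !hermDl !hermDr !hermZl !hermZr !mxE; ring.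
Qed.

Definition Jm : 'M[k]_3 :=
  \matrix_(i, j) (if (i + j == 2)%N then (if i == i1 then -2 else 1) else 0).

Lemma JmE : (Jm i0 i0 = 0) * (Jm i0 i1 = 0) * (Jm i0 i2 = 1) * (Jm i1 i0 = 0) *
  (Jm i1 i1 = -2) * (Jm i1 i2 = 0) * (Jm i2 i0 = 1) * (Jm i2 i1 = 0) * (Jm i2 i2 = 0).
Proof. by rewrite /Jm; do ![split]; rewrite mxE. Qed.
End Lines.

(** * Polynomials with prescribed double roots *)

Section DoubleRoots.
Variable k : fieldType.

Lemma prod_XsubC_deriv_neq0 (rs : seq k) r : uniq rs -> r \in rs ->
  (\prod_(s <- rs) ('X - s%:P))^`().[r] != 0.
Proof.
move=> us rs_r; rewrite (perm_big _ (perm_to_rem rs_r)) big_cons.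
rewrite derivM derivXsubC mul1r hornerD hornerM hornerXsubC subrr mul0r addr0.
rewrite -/(root _ r) root_prod_XsubC mem_rem_uniq // inE eqxx //.
Qed.

(** After a first division p = h g, the derivative of p at a root equals h g' there, and g' does not
    vanish because its roots are simple; hence h is again divisible by g. *)
Lemma double_roots_dvd (p : {poly k}) (rs : seq k) : uniq rs ->
  (forall r, r \in rs -> root p r /\ root p^`() r) ->
  exists h, p = h * (\prod_(s <- rs) ('X - s%:P) * \prod_(s <- rs) ('X - s%:P)).
Proof.
set g := \prod_(s <- rs) _ => us hr.
have dvd_g (q : {poly k}) : (forall r, r \in rs -> root q r) -> exists h, q = h * g.
  move=> hq; apply/dvdpP; apply: uniq_roots_dvdp; last by rewrite uniq_rootsE.
  exact/allP.
have [h hE] := dvd_g p (fun r rr => (hr r rr).1).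
have [h' h'E] : exists h', h = h' * g.
  apply: dvd_g => r rr; have [pr] := hr r rr.
  rewrite hE derivM rootE hornerD !hornerM.
  have -> : g.[r] = 0 by apply/eqP; rewrite -rootE root_prod_XsubC.
  rewrite mulr0 add0r mulf_eq0 rootE => /orP[//|].
  by rewrite (negbTE (prod_XsubC_deriv_neq0 us rr)).
by exists h'; rewrite mulrA -h'E.
Qed.

(* A form of degree 8 with four double roots is a constant times a square, and the
   vanishing of the coefficients of degrees 7, 6 and 2 leaves X^4 + g for its root. *)
Lemma quartic_square (a b c d e : k) (rs : seq k) :
  (2 : k) != 0 -> a != 0 -> uniq rs -> size rs = 4%N ->
  let p := a *: 'X^8 + d *: 'X^5 + b *: 'X^4 + e *: 'X^3 + c%:P in
  (forall r, r \in rs -> root p r /\ root p^`() r) ->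
  exists g, [/\ d = 0, e = 0, b = 2 * a * g, c = a * g ^+ 2 & forall r, r \in rs -> r ^+ 4 = - g].
Proof.
move=> two0 a0 us sz p hp; have [h hE] := double_roots_dvd us hp.
move: hE; set g := \prod_(s <- rs) _ => hE.
have sg : size g = 5%N by rewrite size_prod_XsubC sz.
have g4 : g`_4%N = 1.
  by have /monicP := monic_prod_XsubC rs predT id; rewrite lead_coefE -/g sg.
have gn n : (4 < n)%N -> g`_n = 0 by move=> n4; rewrite nth_default ?sg.
have pn n : p`_n = a * (n == 8)%:R + d * (n == 5)%:R + b * (n == 4)%:R + e * (n == 3)%:R + c * (n == 0)%:R.
  by rewrite !coefD !coefZ !coefXn coefC; case: (n == 0)%N; rewrite ?mulr1 ?mulr0.
have p0 : p != 0.
  apply: contraNneq a0 => p0; have := pn 8%N; rewrite p0 coef0 /= => ->.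
  by rewrite mulr1 !mulr0 !addr0.
have sp : (size p <= 9)%N.
  by apply/leq_sizeP => j j9; rewrite pn; do ![case: eqP => [e'|_]; first by move: j9; rewrite e'];
    rewrite !mulr0 !addr0.
have [h0 g0] : h != 0 /\ g * g != 0.
  by apply/andP; rewrite -negb_or -mulf_eq0 -hE.
have gg0 : g != 0 by apply: contraNneq g0 => ->; rewrite mul0r.
have sh : (size h <= 1)%N.
  move: sp; rewrite hE size_mul // size_mul // sg /=.
  by case: (size h) => [|[|n]] //; rewrite !addSn /= ltnNge leq_addl.
move: hE; rewrite (size1_polyC sh); set h1 := h`_0 => hE.
have cf n : p`_n = h1 * (g * g)`_n by rewrite hE coefCM.
have h1a : h1 = a.
  have := cf 8%N; rewrite pn /= coefM !big_ord_recr big_ord0 /= /bump /= !subSS !subn0.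
  rewrite !(gn 5%N isT, gn 6%N isT, gn 7%N isT, gn 8%N isT) g4.
  rewrite !(mul0r, mulr0, add0r, addr0) !mulr1 => ->//.
have cf' n : (n < 8)%N -> (g * g)`_n = p`_n / a.
  by move=> _; rewrite cf h1a mulrAC divff // mul1r.
have E7 := cf' 7%N isT; have E6 := cf' 6%N isT; have E5 := cf' 5%N isT.
have E4 := cf' 4%N isT; have E3 := cf' 3%N isT; have E2 := cf' 2%N isT.
have E0 := cf' 0%N isT.
move: E7 E6 E5 E4 E3 E2 E0; rewrite !pn /= !coefM !big_ord_recr !big_ord0 /= /bump /= !subSS !subn0 !(gn 5%N isT, gn 6%N isT, gn 7%N isT) g4.
rewrite !(mul0r, mulr0, add0r, addr0, mulr1, mul1r).
have dbl (x : k) : x + x = 0 -> x = 0.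
  by move=> /eqP; rewrite -mulr2n -mulr_natl mulf_eq0 (negbTE two0) => /eqP.
move=> /dbl g3; rewrite g3 !(mul0r, mulr0, add0r, addr0) => /dbl g2.
rewrite g2 !(mul0r, mulr0, add0r, addr0) => E5 E4 E3 /eqP.
rewrite mulf_eq0 orbb => /eqP g1 E0.
exists g`_0; split.
- by rewrite -[d](divfK a0) -E5 g1 addr0 mul0r.
- by rewrite -[e](divfK a0) -E3 mul0r.
- by rewrite -[b](divfK a0) -E4; ring.
- by rewrite -[c](divfK a0) -E0; ring.
move=> r rr; have : g.[r] = 0 by apply/eqP; rewrite -rootE root_prod_XsubC.
rewrite horner_coef sg !big_ord_recr big_ord0 /= g1 g2 g3 g4.
rewrite !(mul0r, mulr0, add0r, addr0, mulr1, mul1r, expr0) => /eqP.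
by rewrite addrC addr_eq0 => /eqP.
Qed.
End DoubleRoots.

(** * Frames adapted to a conic and to the Hermitian form *)

Section QuadFrame.
Variable k : closedFieldType.
Implicit Types (S M : 'M[k]_3) (v w : 'rV[k]_3).

Lemma bil_nondeg S w : S \in unitmx -> (forall y, bil S w y = 0) -> w = 0.
Proof.
move=> uS h; rewrite -(mulmxK uS w).
suff -> : w *m S = 0 by rewrite mul0mx.
apply/rowP => i; rewrite [RHS]mxE -(h (delta_mx 0 i)) bilE.
rewrite (eq_bigr (fun l => (l == i)%:R * (w *m S) 0 l)) ?sum_delta // => l _.
by rewrite [X in _ * X]mxE mulrC.
Qed.

Lemma bil_nondeg_frame S a b c w : S \in unitmx -> mat3 a b c \in unitmx ->
  bil S w a = 0 -> bil S w b = 0 -> bil S w c = 0 -> w = 0.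
Proof.
move=> uS uM wa wb wc; apply: (bil_nondeg uS) => y.
rewrite -(mulmxKV uM y) mul_mat3 !bilDr !bilZr wa wb wc; ring.
Qed.

Lemma bil0r S v : bil S v 0 = 0.
Proof. by rewrite -(scale0r 0) bilZr mul0r. Qed.

(** Two independent isotropic vectors span a hyperbolic plane: were p = 0, a combination of them
    orthogonal to a third vector would lie in the radical. The vector e1 spans the orthogonal
    complement, and a square root rescales it so that the form becomes 2 p (x0 x2 - x1^2). *)
Lemma quad_frame S e0 e2 : (2 : k) != 0 -> S^T = S -> S \in unitmx ->
  (forall a b, a *: e0 + b *: e2 = 0 -> a = 0 /\ b = 0) ->
  bil S e0 e0 = 0 -> bil S e2 e2 = 0 ->
  exists e1 p, [/\ p != 0, mat3 e0 e1 e2 \in unitmx &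
    [/\ bil S e0 e1 = 0, bil S e2 e1 = 0, bil S e0 e2 = p & bil S e1 e1 = -2 * p]].
Proof.
move=> two0 sS uS ind b00 b22.
have p0 : bil S e0 e2 != 0.
  apply/eqP => b02.
  have [u hu] : exists u, bil S e0 u != 0.
    apply: contrapT => h; have e00 : e0 = 0.
      by apply: (bil_nondeg uS) => y; apply: contrapT => /eqP hy; apply: h; exists y.
    have [/eqP] : (1 : k) = 0 /\ (0 : k) = 0 by apply: ind; rewrite e00 scaler0 scale0r addr0.
    by rewrite oner_eq0.
  have uM : mat3 e0 e2 u \in unitmx.
    apply: mat3_unit => x y z e.
    have /eqP := congr1 (bil S e0) e; rewrite !bilDr !bilZr b00 b02 !mulr0 !add0r bil0r.
    rewrite mulf_eq0 (negbTE hu) orbF => /eqP z0.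
    by move: e; rewrite z0 scale0r addr0 => /ind[].
  have /eqP : e2 - (bil S e2 u / bil S e0 u) *: e0 = 0.
    apply: (bil_nondeg_frame uS uM); rewrite -scaleNr bilDl bilZl.
    - by rewrite b00 mulr0 addr0 bilC.
    - by rewrite b22 b02 mulr0 addr0.
    by rewrite mulNr divfK // subrr.
  rewrite addrC -scaleNr -{2}[e2]scale1r => /eqP /ind [_ /eqP].
  by rewrite oner_eq0.
set p := bil S e0 e2 in p0.
pose A := S *m row_mx e0^T e2^T.
have kA : kermx A != 0.
  rewrite -mxrank_eq0 mxrank_ker -lt0n subn_gt0.
  by apply: leq_ltn_trans (rank_leq_col A) _.
pose e1 := nz_row (kermx A).
have e10 : e1 != 0 by rewrite nz_row_eq0.
have /sub_kermxP : (e1 <= kermx A)%MS by exact: nz_row_sub.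
rewrite mulmxA mul_mx_row -[0]row_mx0 => /eq_row_mx [h0 h2].
have b01 : bil S e0 e1 = 0 by rewrite bilC // /bil h0 mxE.
have b21 : bil S e2 e1 = 0 by rewrite bilC // /bil h2 mxE.
have uM' t : t != 0 -> mat3 e0 (t *: e1) e2 \in unitmx.
  move=> t0; apply: mat3_unit => x y z e.
  have /eqP := congr1 (bil S e0) e; rewrite !bilDr !bilZr b00 b01 !mulr0 !add0r bil0r.
  rewrite mulf_eq0 (negbTE p0) orbF => /eqP z0.
  have /eqP := congr1 (bil S e2) e; rewrite !bilDr !bilZr b21 b22 !mulr0 !addr0 bil0r.
  rewrite (bilC _ _ sS) mulf_eq0 (negbTE p0) orbF => /eqP x0.
  move: e; rewrite x0 z0 !scale0r addr0 add0r => /eqP.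
  by rewrite !scaler_eq0 (negbTE e10) (negbTE t0) !orbF => /eqP.
have r0 : bil S e1 e1 != 0.
  apply: contraNneq e10 => b11; have := uM' 1 (oner_neq0 _); rewrite scale1r => uM.
  by apply/eqP; apply: (bil_nondeg_frame uS uM); rewrite // bilC.
have [t ht] := closed_root_exists (-2 * p / bil S e1 e1) (isT : (0 < 2)%N).
have t0 : t != 0.
  apply/eqP => t0; move: ht; rewrite t0 expr0n /= => /esym/eqP; apply/negP.
  by rewrite !mulf_neq0 ?oppr_eq0 ?invr_eq0 //.
exists (t *: e1), p; split=> //; first exact: uM'.
rewrite !bilZr bilZl b01 b21 !mulr0; split=> //.
by rewrite mulrA -expr2 ht divfK.
Qed.

Lemma herm_mat3 (e0 e1 e2 : 'rV[k]_3) : let M := mat3 e0 e1 e2 in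
  (gram M i0 i0 = herm e0 e0) * (gram M i0 i1 = herm e0 e1) * (gram M i0 i2 = herm e0 e2) *
  (gram M i1 i0 = herm e1 e0) * (gram M i1 i1 = herm e1 e1) * (gram M i1 i2 = herm e1 e2) *
  (gram M i2 i0 = herm e2 e0) * (gram M i2 i1 = herm e2 e1) * (gram M i2 i2 = herm e2 e2).
Proof. by have [r0 r1 r2] := row_mat3 e0 e1 e2; do ![split]; rewrite mxE ?r0 ?r1 ?r2. Qed.

Hypothesis char5 : 5%N \in [pchar k].

Lemma two_neq0 : (2 : k) != 0.
Proof.
have : (5 : k) == 0 by rewrite five0.
apply: contraTneq => e; have -> : (5 : k) = 2 * 2 + 1 by ring.
by rewrite e mul0r add0r oner_eq0.
Qed.

Lemma gramM (A M : 'M[k]_3) : gram (A *m M) = map_mx (fun x => x ^+ 5) A *m gram M *m A^T.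
Proof.
apply/matrixP => i j; rewrite mxE !row_mul (herm_mul char5) !mxE exchange_big /=.
apply: eq_bigr => l _; rewrite !mxE mulr_suml; apply: eq_bigr => m _.
by rewrite !mxE.
Qed.

Lemma gram_unit M : M \in unitmx -> gram M \in unitmx.
Proof.
move=> uM; have -> : gram M = map_mx (pFrobenius_aut char5) M *m M^T.
  by apply/matrixP => i j; rewrite !mxE; apply: eq_bigr => l _; rewrite !mxE.
by rewrite unitmx_mul map_unitmx unitmx_tr uM.
Qed.

Lemma tt_conic_matrix Q : tt_conics Q -> exists q S, [/\ q \is 2.-homog, matrix_of_form q S,
  S \in unitmx, Q = zeros q & (Q `&` @Gamma k #= `I_6)%card /\
  forall P, (Q `&` @Gamma k) P -> intersection_mult q (fermat k) P 2].
Proof.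
move=> [q [[hq ns] QE c6 hm]]; have [S hS] := matrix_of_form_exists two_neq0 hq.
exists q, S; split=> //; rewrite -row_free_unit -kermx_eq0.
apply/eqP/row_matrixP => i; rewrite row0; set v := row i _.
have vS : v *m S = 0 by rewrite -row_mul mulmx_ker row0.
apply: contrapT => /eqP v0; have [sS fS dS] := hS.
have [|j] := ns v v0; first by rewrite fS /bil vS mul0mx mxE.
by rewrite dS vS mxE mulr0 eqxx.
Qed.

(** The scalars (s^2 z, s z, z) keep the equation of the conic. With u = s^2 and g = -u^2 the three
    nonzero Gram entries become u^5 a z^6 times 1, -2, 1, and z is chosen to make this factor 1. *)
Lemma gram_frame (e0 e1 e2 : 'rV[k]_3) a g : a != 0 -> g != 0 ->
  mat3 e0 e1 e2 \in unitmx ->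
  herm e0 e0 = 0 -> herm e0 e1 = 0 -> herm e0 e2 = a ->
  herm e1 e0 = 0 -> herm e1 e1 = 2 * a * g -> herm e1 e2 = 0 ->
  herm e2 e0 = a * g ^+ 2 -> herm e2 e1 = 0 -> herm e2 e2 = 0 ->
  exists x y z, [/\ x != 0, y != 0, z != 0, y ^+ 2 = x * z &
    gram (mat3 (x *: e0) (y *: e1) (z *: e2)) = Jm k].
Proof.
move=> a0 g0 uM h00 h01 h02 h10 h11 h12 h20 h21 h22.
have [s hs] := closed_root_exists (- g) (isT : (0 < 4)%N).
pose u := s ^+ 2.
have s0 : s != 0 by apply/eqP => s0; move: hs; rewrite s0 expr0n /= => /esym/eqP; apply/negP; rewrite oppr_eq0.
have u0 : u != 0 by rewrite expf_neq0.
have [z hz] := closed_root_exists (u ^+ 5 * a)^-1 (isT : (0 < 6)%N).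
have z0 : z != 0.
  apply/eqP => z0; move: hz; rewrite z0 expr0n /= => /esym/eqP; apply/negP.
  by rewrite invr_eq0 mulf_neq0 // expf_neq0.
have gE : g = - u ^+ 2 by rewrite /u -exprM hs opprK.
exists (u * z), (s * z), z; split; rewrite ?mulf_neq0 //; first by rewrite /u; ring.
apply/matrixP => i j.
case: (ord3P i) => ->; case: (ord3P j) => ->; rewrite herm_mat3 JmE hermZl hermZr
  ?h00 ?h01 ?h02 ?h10 ?h11 ?h12 ?h20 ?h21 ?h22 ?mulr0 //.
- have -> : (u * z) ^+ 5 * (z * a) = u ^+ 5 * a * z ^+ 6 by ring.
  by rewrite hz divff // mulf_neq0 // expf_neq0.
- have -> : (s * z) ^+ 5 * (s * z * (2 * a * g)) = -2 * (u ^+ 5 * a * z ^+ 6).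
    by rewrite gE /u; ring.
  by rewrite hz divff ?mulr1 // mulf_neq0 // expf_neq0.
have -> : z ^+ 5 * (u * z * (a * g ^+ 2)) = u ^+ 5 * a * z ^+ 6 by rewrite gE; ring.
by rewrite hz divff // mulf_neq0 // expf_neq0.
Qed.

End QuadFrame.

Section Classification.
Variable k : closedFieldType.
Hypothesis char5 : 5%N \in [pchar k].
Implicit Types (S M : 'M[k]_3) (v w : 'rV[k]_3).

Lemma bil_mat3 S e0 e1 e2 p (x y : 'rV[k]_3) : S^T = S ->
  bil S e0 e0 = 0 -> bil S e2 e2 = 0 -> bil S e0 e1 = 0 -> bil S e2 e1 = 0 ->
  bil S e0 e2 = p -> bil S e1 e1 = -2 * p ->
  bil S (x *m mat3 e0 e1 e2) (y *m mat3 e0 e1 e2) =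
  p * (x 0 i0 * y 0 i2 + x 0 i2 * y 0 i0 - 2 * x 0 i1 * y 0 i1).
Proof.
move=> sS h00 h22 h01 h21 h02 h11.
rewrite !mul_mat3 !(bilDl, bilDr, bilZl, bilZr) (bilC e1 e0) // (bilC e1 e2) // (bilC e2 e0) //.
rewrite h00 h22 h01 h21 h02 h11; ring.
Qed.

Lemma zeros_Cset q S e0 e1 e2 p x y z : q \is 2.-homog -> matrix_of_form q S -> p != 0 ->
  mat3 e0 e1 e2 \in unitmx ->
  bil S e0 e0 = 0 -> bil S e2 e2 = 0 -> bil S e0 e1 = 0 -> bil S e2 e1 = 0 ->
  bil S e0 e2 = p -> bil S e1 e1 = -2 * p ->
  x != 0 -> y != 0 -> z != 0 -> y ^+ 2 = x * z ->
  zeros q = Cset (mat3 (x *: e0) (y *: e1) (z *: e2)).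
Proof.
move=> hq [sS fS _] p0 uM h00 h22 h01 h21 h02 h11 x0 y0 z0 yxz.
have two0 := two_neq0 char5.
have conv (w : 'rV[k]_3) : w *m mat3 (x *: e0) (y *: e1) (z *: e2) =
    vec3 (w 0 i0 * x) (w 0 i1 * y) (w 0 i2 * z) *m mat3 e0 e1 e2.
  by rewrite !mul_mat3 !vec3E !scalerA.
have val w : evalv q (vec3 (w 0 i0 * x) (w 0 i1 * y) (w 0 i2 * z) *m mat3 e0 e1 e2) =
    2 * p * (x * z) * (w 0 i0 * w 0 i2 - w 0 i1 ^+ 2).
  rewrite fS (bil_mat3 (p := p)) // !vec3E.
  transitivity (p * (2 * (w 0 i0 * w 0 i2) * (x * z) - 2 * w 0 i1 ^+ 2 * y ^+ 2)); first by ring.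
  by rewrite yxz; ring.
apply/seteqP; split=> P.
  move=> /(zerosP _ hq) [v [v0 qv ->]].
  pose u := v *m invmx (mat3 e0 e1 e2).
  pose w := vec3 (u 0 i0 / x) (u 0 i1 / y) (u 0 i2 / z).
  have vE : v = w *m mat3 (x *: e0) (y *: e1) (z *: e2).
    by rewrite conv !vec3E !divfK // -vec3_eta /u mulmxKV.
  exists w; split; last by rewrite vE.
    by apply: contraNneq v0 => w0; rewrite vE w0 mul0mx.
  move: qv => /eqP; rewrite vE conv val mulf_eq0 !mulf_eq0.
  rewrite (negbTE two0) (negbTE p0) (negbTE x0) (negbTE z0) /= subr_eq0 => /eqP.
  by [].
move=> [w [w0 wE ->]]; apply/(zeros_line _ hq); split; last first.
  by rewrite conv val wE subrr mulr0.
rewrite conv; apply: contraNneq w0 => e.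
have : vec3 (w 0 i0 * x) (w 0 i1 * y) (w 0 i2 * z) == 0.
  by rewrite -[vec3 _ _ _](mulmxK uM) e mul0mx.
rewrite vec3_eq0 !mulf_eq0 (negbTE x0) (negbTE y0) (negbTE z0) !orbF => /and3P[/eqP a /eqP b /eqP c].
by rewrite (vec3_eta w) a b c vec3_eq0 eqxx.
Qed.

(** Tangency at e0 and e2 kills the Gram entries with e1 in second place. On the parametrized conic
    H(v, v) is r^2 times a polynomial of degree 8 whose double roots are the other four contact
    points; [quartic_square] then determines the remaining entries. *)
Lemma tt_frame Q P1 P2 : tt_conics Q -> (Q `&` @Gamma k) P1 -> (Q `&` @Gamma k) P2 -> P1 <> P2 ->
  exists M, [/\ gram M = Jm k, Q = Cset M, P1 = <[row i0 M]>%VS & P2 = <[row i2 M]>%VS].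
Proof.
move=> /(tt_conic_matrix char5) [q [S [hq mS uS QE [c6 hm]]]] QP1 QP2 neq.
have [sS fS dS] := mS; have two0 := two_neq0 char5.
have [e0 [e0n0 h00 P1E]] := (GammaP P1).1 QP1.2.
have [e2 [e2n0 h22 P2E]] := (GammaP P2).1 QP2.2.
have onQ v : v != 0 -> (Q `&` @Gamma k) <[v]>%VS -> [/\ bil S v v = 0, herm v v = 0 &
    forall t, bil S v t = 0 -> herm v t = 0].
  move=> v0 [Qv Gv]; have hh := ((Gamma_line v).1 Gv).2.
  have qv : bil S v v = 0.
    by rewrite -fS; move: Qv; rewrite QE => /(zeros_line _ hq) [].
  by split=> // t ht; apply: (tangency char5 mS) => //; apply: hm.
have [b00 _ t0] : [/\ bil S e0 e0 = 0, herm e0 e0 = 0 & forall t, bil S e0 t = 0 -> herm e0 t = 0].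
  by apply: onQ => //; rewrite -P1E.
have [b22 _ t2] : [/\ bil S e2 e2 = 0, herm e2 e2 = 0 & forall t, bil S e2 t = 0 -> herm e2 t = 0].
  by apply: onQ => //; rewrite -P2E.
have ind a b : a *: e0 + b *: e2 = 0 -> a = 0 /\ b = 0.
  move=> e; have a0 : a = 0.
    apply: contrapT => /eqP a0; apply: neq; rewrite P1E P2E.
    have b0 : b != 0.
      apply: contraNneq a0 => b0; move: e; rewrite b0 scale0r addr0 => /eqP.
      by rewrite scaler_eq0 (negbTE e0n0) orbF.
    apply/line_eqP => //; exists (- b / a); first by rewrite mulf_neq0 ?oppr_eq0 ?invr_eq0.
    move/eqP: e; rewrite addr_eq0 => /eqP e.
    by rewrite mulrC -scalerA scaleNr -e scalerK.
  split=> //; move/eqP: e; rewrite a0 scale0r add0r scaler_eq0 (negbTE e2n0) orbF.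
  by move=> /eqP.
have [e1 [p [p0 uM [b01 b21 b02 b11]]]] := quad_frame two0 sS uS ind b00 b22.
have h01 := t0 _ b01; have h21 := t2 _ b21.
pose M := mat3 e0 e1 e2.
have hG := gram_unit char5 uM; rewrite -/M in hG.
have G := herm_mat3 e0 e1 e2; rewrite /= -/M in G.
pose a := herm e0 e2; pose d := herm e1 e0; pose b := herm e1 e1; pose e := herm e1 e2.
pose c := herm e2 e0.
have hermM x y : herm (x *m M) (y *m M) = x 0 i0 ^+ 5 * a * y 0 i2 +
   x 0 i1 ^+ 5 * (d * y 0 i0 + b * y 0 i1 + e * y 0 i2) + x 0 i2 ^+ 5 * c * y 0 i0.
  rewrite (herm_mul char5) !sum3 !G h00 h01 h21 h22 -/a -/b -/c -/d -/e; ring.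
have a0 : a != 0.
  apply/eqP => a0; have : vx k *m gram M = 0.
    apply/rowP => j; rewrite mxE sum3 !mxE /= !mul0r !mul1r !addr0.
    have [r0 r1 r2] := row_mat3 e0 e1 e2.
    by case: (ord3P j) => ->; rewrite r0 ?r1 ?r2 ?h00 ?h01.
  move/(congr1 (mulmxr (invmx (gram M)))); rewrite /= mulmxK // mul0mx.
  by move/rowP/(_ i0); rewrite !mxE !eqxx => /eqP; rewrite oner_eq0.
have c0 : c != 0.
  apply/eqP => c0; have : (delta_mx 0 i2 : 'rV[k]_3) *m gram M = 0.
    apply/rowP => j; rewrite mxE sum3 !mxE /= !mul0r !mul1r !add0r.
    have [r0 r1 r2] := row_mat3 e0 e1 e2.
    by case: (ord3P j) => ->; rewrite r2 ?r1 ?r0 ?h22 ?h21.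
  move/(congr1 (mulmxr (invmx (gram M)))); rewrite /= mulmxK // mul0mx.
  by move/rowP/(_ i2); rewrite !mxE !eqxx => /eqP; rewrite oner_eq0.
have QM : Q = Cset M.
  rewrite QE (zeros_Cset hq mS p0 uM b00 b22 b01 b21 b02 b11 (oner_neq0 k) (oner_neq0 k) (oner_neq0 k)) ?expr1n ?mulr1 //.
  by rewrite !scale1r.
pose vr r := vec3 (r ^+ 2) r 1 *m M.
have vr0 r : vr r != 0.
  rewrite /vr; apply/eqP => h.
  have : vec3 (r ^+ 2) r 1 == 0 by rewrite -[vec3 _ _ _](mulmxK uM) h mul0mx.
  by rewrite vec3_eq0 oner_eq0 !andbF.
have param P : (Q `&` @Gamma k) P -> P <> P1 -> P <> P2 -> exists r, r != 0 /\ P = <[vr r]>%VS.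
  rewrite {1}QM => -[[x [x0 xE PE]] _] n1 n2.
  have x20 : x 0 i2 != 0.
    apply/eqP => x20; move/eqP: xE; rewrite x20 mulr0 expf_eq0 /= => /eqP x10.
    apply: n1; rewrite PE P1E mul_mat3 x10 x20 !scale0r !addr0 line_scale //.
    by apply: contraNneq x0 => x00; rewrite (vec3_eta x) x00 x10 x20 vec3_eq0 eqxx.
  have xV : x = x 0 i2 *: vec3 ((x 0 i1 / x 0 i2) ^+ 2) (x 0 i1 / x 0 i2) 1.
    rewrite vec3Z [LHS]vec3_eta; congr vec3; last by rewrite mulr1.
      by rewrite expr_div_n xE -mulf_div divff // mulr1 mulrC divfK.
    by rewrite mulrC divfK.
  exists (x 0 i1 / x 0 i2); split; last by rewrite PE xV -scalemxAl line_scale // -xV.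
  rewrite mulf_neq0 ?invr_eq0 //; apply/eqP => x10; apply: n2.
  move/eqP: xE; rewrite x10 expr0n /= eq_sym mulf_eq0 (negbTE x20) orbF => /eqP x00.
  by rewrite PE P2E mul_mat3 x00 x10 !scale0r !add0r line_scale.
have [s [us s6 sE]] := (card_seqP _ _).1 c6.
pose rest := rem P2 (rem P1 s).
have P1s : P1 \in s by have : [set` s] P1 by rewrite -sE.
have P2s : P2 \in rem P1 s.
  rewrite mem_rem_uniq // inE; apply/andP; split; first by apply/eqP => /esym.
  by have : [set` s] P2 by rewrite -sE.
have rest4 : size rest = 4%N by rewrite !size_rem // s6.
have restP P : P \in rest -> (Q `&` @Gamma k) P /\ exists r, r != 0 /\ P = <[vr r]>%VS.
  rewrite mem_rem_uniq ?rem_uniq // inE mem_rem_uniq // inE => /and3P[/eqP n2 /eqP n1 Ps].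
  have QP : (Q `&` @Gamma k) P by rewrite sE.
  by split=> //; apply: param => //.
pose par P := xget 0 [set r | r != 0 /\ P = <[vr r]>%VS].
have parP P : P \in rest -> par P != 0 /\ P = <[vr (par P)]>%VS.
  by move=> /restP [_ [r hr]]; apply: (@xgetPex _ 0 [set r | r != 0 /\ P = <[vr r]>%VS]); exists r.
pose rs := map par rest.
have urs : uniq rs.
  rewrite map_inj_in_uniq; first by rewrite !rem_uniq.
  by move=> P P' /parP [_ PE] /parP [_ P'E] e'; rewrite PE P'E e'.
have srs : size rs = 4%N by rewrite size_map.
have [] := @quartic_square k a b c d e rs two0 a0 urs srs.
  move=> r /mapP [P Pr rE]; have [r0 PE] := parP _ Pr; rewrite -rE in r0 PE.
  have [QP _] := restP _ Pr; rewrite PE in QP.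
  have [bv hv tv] := onQ _ (vr0 r) QP.
  (* The vector (2 r, 1, 0) is the derivative of (r^2, r, 1), hence tangent to the conic. *)
  have ht : herm (vr r) (vec3 (2 * r) 1 0 *m M) = 0.
    by apply: tv; rewrite (bil_mat3 (p := p)) // !vec3E; ring.
  move: hv ht; rewrite !hermM !vec3E => hv ht.
  have pv : a * r ^+ 8 + d * r ^+ 5 + b * r ^+ 4 + e * r ^+ 3 + c = 0.
    apply: (@mulfI _ (r ^+ 2)); first by rewrite expf_neq0.
    by rewrite mulr0 -hv; ring.
  have dv : 2 * d * r ^+ 5 + b * r ^+ 4 + 2 * c = 0.
    by apply: (@mulfI _ r) => //; rewrite mulr0 -ht; ring.
  split; rewrite rootE ?(derivD, derivZ, derivXn, derivC) !(hornerD, hornerZ, hornerMn, hornerXn, hornerC).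
    by rewrite pv.
  apply/eqP; rewrite addr0.
  apply: (@mulfI _ r) => //; rewrite mulr0.
  (* Modulo 5, r times the derivative is three times the polynomial plus the tangency relation [dv];
     both vanish at r. *)
  have -> : r * (a * (r ^+ 7 *+ 8) + d * (r ^+ 4 *+ 5) + b * (r ^+ 3 *+ 4) + e * (r ^+ 2 *+ 3)) =
     3 * (a * r ^+ 8 + d * r ^+ 5 + b * r ^+ 4 + e * r ^+ 3 + c)
     + (2 * d * r ^+ 5 + b * r ^+ 4 + 2 * c) + 5 * (a * r ^+ 8 - c) by ring.
  by rewrite pv dv (five0 char5) !mulr0 mul0r !addr0.
move=> g [d0 e0' bE cE _].
have g0 : g != 0 by apply: contraNneq c0 => g0; rewrite cE g0 expr0n mulr0.
have [x [y [z [x0 y0 z0 yxz gJ]]]] :=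
  gram_frame a0 g0 uM h00 h01 (erefl a) d0 bE e0' cE h21 h22.
exists (mat3 (x *: e0) (y *: e1) (z *: e2)).
have [-> _ ->] := row_mat3 (x *: e0) (y *: e1) (z *: e2).
split=> //; rewrite ?line_scale //.
by rewrite QE; apply: (zeros_Cset hq mS p0 uM b00 b22 b01 b21 b02 b11).
Qed.
End Classification.

(** * The unitary group *)

Section Action.
Variable k : fieldType.
Implicit Types (g h : 'End('rV[k]_3)) (C Q : set (subsp k)).

Lemma act1 C : act \1%VF C = C.
Proof.
by apply/seteqP; split=> [P [P' CP' <-]|P CP]; [rewrite lim1g|exists P => //; rewrite lim1g].
Qed.

Lemma act_comp g h C : act g (act h C) = act (g \o h)%VF C.
Proof.
apply/seteqP; split=> [P [_ [P' CP' <-] <-]|P [P' CP' <-]].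
  by exists P'; rewrite ?limg_comp.
by exists (h @: P')%VS; [exists P'|rewrite limg_comp].
Qed.

Lemma act_inj g : lker g = 0%VS -> injective (fun P : subsp k => (g @: P)%VS).
Proof.
move=> /eqP k0 P P' /= e; rewrite -[P](lim1g) -(lker0_compVf k0) limg_comp e.
by rewrite -limg_comp lker0_compVf // lim1g.
Qed.

Lemma actI g A B : lker g = 0%VS -> act g (A `&` B) = act g A `&` act g B.
Proof.
move=> k0; apply/seteqP; split=> [P [P' [AP BP] <-]|P [[P' AP' <-] [P'' BP'' /act_inj e]]].
  by split; exists P'.
by exists P' => //; split=> //; rewrite -e.
Qed.

Lemma card_act g A : lker g = 0%VS -> (act g A #= A)%card.
Proof. by move=> k0; apply: inj_card_eq => x y _ _ /(act_inj k0). Qed.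

Lemma card_act_eq g A n : lker g = 0%VS -> (act g A #= `I_n)%card = (A #= `I_n)%card.
Proof. by move=> k0; apply: card_eql; exact: card_act. Qed.

Lemma act_injective g : lker g = 0%VS -> injective (act g).
Proof.
move=> k0 A B e; rewrite -(act1 A) -(act1 B) -(lker0_compVf (introT eqP k0)) -!act_comp.
by rewrite e.
Qed.

Lemma lker_lm (U : 'M[k]_3) : U \in unitmx -> lker (lm U) = 0%VS.
Proof.
move=> uU; apply/eqP/lker0P => v w; rewrite !lmE => e.
by rewrite -(mulmxK uU v) e mulmxK.
Qed.

Lemma lm_act (U V : 'M[k]_3) C : act (lm V) (act (lm U) C) = act (lm (U *m V)) C.
Proof. by rewrite act_comp lm_comp. Qed.

Lemma act_lmK (U : 'M[k]_3) C : U \in unitmx -> act (lm (invmx U)) (act (lm U) C) = C.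
Proof. by move=> uU; rewrite lm_act mulmxV // lm1 act1. Qed.

Lemma act_lmKV (U : 'M[k]_3) C : U \in unitmx -> act (lm U) (act (lm (invmx U)) C) = C.
Proof. by move=> uU; rewrite lm_act mulVmx // lm1 act1. Qed.

Lemma act_zeros (U : 'M[k]_3) d q : U \in unitmx -> q \is d.-homog ->
  act (lm U) (zeros q) = zeros (subst (invmx U) q).
Proof.
move=> uU hq; apply/seteqP; split=> P.
  move=> [P' /(zerosP _ hq) [v [v0 qv ->]] <-]; rewrite lm_line.
  apply/(zeros_line _ (dhomog_subst _ hq)); rewrite evalv_subst mulmxK //; split=> //.
  by apply: contraNneq v0 => e; rewrite -(mulmxK uU v) e mul0mx.
move=> /(zerosP _ (dhomog_subst _ hq)) [v [v0 qv ->]].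
exists <[v *m invmx U]>%VS; last by rewrite lm_line mulmxKV.
apply/(zeros_line _ hq); rewrite -evalv_subst; split=> //.
by apply: contraNneq v0 => e; rewrite -(mulmxKV uU v) e mul0mx.
Qed.

Lemma act_Cset (U M : 'M[k]_3) : act (lm U) (Cset M) = Cset (M *m U).
Proof.
apply/seteqP; split=> P.
  by move=> [_ [x [x0 xE ->]] <-]; exists x; rewrite lm_line mulmxA.
by move=> [x [x0 xE ->]]; exists <[x *m M]>%VS; [exists x|rewrite lm_line mulmxA].
Qed.
End Action.

Section Unitary.
Variable k : closedFieldType.
Hypothesis char5 : 5%N \in [pchar k].
Implicit Types (U V M : 'M[k]_3) (v w : 'rV[k]_3) (Q C : set (subsp k)) (D : set (set (subsp k))).

Local Notation fr := (map_mx (fun x : k => x ^+ 5)).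

Lemma frM U V : fr (U *m V) = fr U *m fr V.
Proof. exact: (map_mxM (pFrobenius_aut char5)). Qed.

Lemma gramE U : gram U = fr U *m U^T.
Proof. by apply/matrixP => i j; rewrite !mxE; apply: eq_bigr => l _; rewrite !mxE. Qed.

Lemma fr_unit U : (fr U \in unitmx) = (U \in unitmx).
Proof. exact: (map_unitmx (pFrobenius_aut char5)). Qed.

Lemma gram_unit_inv U : gram U \in unitmx -> U \in unitmx.
Proof. by rewrite gramE unitmx_mul unitmx_tr => /andP[]. Qed.

(** Let F be the entrywise fifth power. Applying F to F(U) U^T = G gives F(F(U)) F(U)^T = G, and
    transposing it gives U F(U)^T = G; cancelling F(U)^T yields F(F(U)) = U. *)
Lemma gram_rational U G : gram U = G -> G \in unitmx -> fr G = G -> G^T = G ->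
  forall i j, U i j ^+ 25 = U i j.
Proof.
move=> gU uG fG sG i j; have uU : U \in unitmx by apply: gram_unit_inv; rewrite gU.
have e1 : fr (fr U) *m (fr U)^T = G.
  by rewrite -[RHS]fG -gU gramE frM map_trmx.
have e2 : U *m (fr U)^T = G by rewrite -sG -gU gramE trmx_mul trmxK.
have : fr (fr U) = U.
  have uF : (fr U)^T \in unitmx by rewrite unitmx_tr fr_unit.
  by rewrite -[LHS](mulmxK uF) e1 -e2 mulmxK.
by move/matrixP/(_ i j); rewrite !mxE -exprM.
Qed.

Definition unitary U := gram U = 1%:M.

Lemma unitary_unit U : unitary U -> U \in unitmx.
Proof. by move=> h; apply: gram_unit_inv; rewrite h unitmx1. Qed.

Lemma fr1 : fr (1%:M : 'M[k]_3) = 1%:M.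
Proof. exact: (map_mx1 (pFrobenius_aut char5)). Qed.

Lemma unitary_rational U : unitary U -> forall i j, U i j ^+ 25 = U i j.
Proof. by move=> h; apply: (gram_rational h); rewrite ?unitmx1 ?fr1 ?trmx1. Qed.

Lemma unitary1 : unitary 1%:M.
Proof. by rewrite /unitary gramE fr1 trmx1 mulmx1. Qed.

Lemma unitaryM U V : unitary U -> unitary V -> unitary (U *m V).
Proof. by rewrite /unitary => hU hV; rewrite (gramM char5) hV mulmx1 -gramE. Qed.

Lemma unitaryV U : unitary U -> unitary (invmx U).
Proof.
move=> hU; have uU := unitary_unit hU.
have e : gram (invmx U *m U) = fr (invmx U) *m (invmx U)^T by rewrite (gramM char5) hU mulmx1.
by rewrite /unitary gramE -e mulVmx // gramE fr1 trmx1 mulmx1.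
Qed.

Lemma herm_unitary U v w : unitary U -> herm (v *m U) (w *m U) = herm v w.
Proof.
move=> hU; rewrite (herm_mul char5) hU; apply: eq_bigr => i _.
rewrite (bigD1 i) //= big1 ?addr0 ?mxE ?eqxx ?mulr1 // => j ji.
by rewrite mxE eq_sym (negbTE ji) mulr0 mul0r.
Qed.

Lemma act_Gamma U : unitary U -> act (lm U) (@Gamma k) = @Gamma k.
Proof.
have half V : unitary V -> act (lm V) (@Gamma k) `<=` @Gamma k.
  move=> hV P [_ /GammaP [v [v0 vv ->]] <-]; rewrite lm_line; apply/Gamma_line.
  rewrite herm_unitary //; split=> //; apply: contraNneq v0 => e.
  by rewrite -(mulmxK (unitary_unit hV) v) e mul0mx.
move=> hU; apply/seteqP; split; first exact: half.
move=> P GP; exists (lm (invmx U) @: P)%VS; last by rewrite lm_imgKV ?unitary_unit.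
by apply: (half _ (unitaryV hU)); exists P.
Qed.

(** The Fermat form is the Hermitian form evaluated at the vector of variables, since X^6 = X^5 X
    and fifth powers are additive on polynomials in characteristic 5. This keeps the sextic in the
    intersection multiplicities unchanged. *)
Lemma subst_fermat U : unitary U -> subst U (fermat k) = fermat k.
Proof.
move=> hU; rewrite /fermat raddf_sum /=.
have p5 (x y : {mpoly k[3]}) : (x + y) ^+ 5 = x ^+ 5 + y ^+ 5.
  have -> : (x + y) ^+ 5 = x ^+ 5 + y ^+ 5 + 5 * (x ^+ 4 * y + 2 * x ^+ 3 * y ^+ 2
     + 2 * x ^+ 2 * y ^+ 3 + x * y ^+ 4) by ring.
  have -> : (5 : {mpoly k[3]}) = 0.
    by rewrite -(rmorph_nat (mpolyC 3 (R:=k)) 5) /= (five0 char5) mpolyC0.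
  by rewrite mul0r addr0.
have z5 (c : k) (x : {mpoly k[3]}) : (c *: x) ^+ 5 = (c ^+ 5) *: x ^+ 5 by rewrite exprZn.
have e i j : \sum_l U i l ^+ 5 * U j l = (i == j)%:R.
  by have /matrixP /(_ i j) := hU; rewrite !mxE => <-; apply: eq_bigr => l _; rewrite !mxE.
have big5 I (r : seq I) (F : I -> {mpoly k[3]}) : (\sum_(i <- r) F i) ^+ 5 = \sum_(i <- r) F i ^+ 5.
  by apply: (big_morph (fun x => x ^+ 5) p5); rewrite expr0n.
transitivity (\sum_(i < 3) \sum_j \sum_l (U j i ^+ 5 * U l i) *: ('X_j ^+ 5 * 'X_l : {mpoly k[3]})).
  apply: eq_bigr => i _; rewrite rmorphXn /= substX exprSr big5 mulr_suml.
  apply: eq_bigr => j _; rewrite mulr_sumr; apply: eq_bigr => l _.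
  by rewrite exprZn -scalerAl -scalerAr scalerA.
rewrite exchange_big /=; apply: eq_bigr => j _; rewrite exchange_big /= [RHS]exprSr.
under eq_bigr do rewrite -scaler_suml e.
rewrite (bigD1 j) //= eqxx scale1r big1 ?addr0 // => l lj.
by rewrite eq_sym (negbTE lj) scale0r.
Qed.

Lemma tt_conics_act U Q : unitary U -> tt_conics Q -> tt_conics (act (lm U) Q).
Proof.
move=> hU [q [[hq ns] QE c6 hm]]; have uU := unitary_unit hU.
have hV := unitaryV hU; have uV := unitary_unit hV.
exists (subst (invmx U) q); split.
- split=> [|v v0]; first exact: dhomog_subst.
  rewrite evalv_subst => qv; have [|i hi] := ns _ _ qv.
    by apply: contraNneq v0 => e; rewrite -(mulmxKV uU v) e mul0mx.
  apply: contrapT => h; have e0 : invmx U *m (\col_l evalv q^`M(l) (v *m invmx U)) = 0.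
    apply/colP => j; rewrite [RHS]mxE; apply: contrapT => /eqP hj; apply: h; exists j.
    rewrite evalv_subst_deriv; apply: contraNneq hj => <-; rewrite mxE; apply/eqP.
    by apply: eq_bigr => l _; rewrite !mxE.
  have : \col_l evalv q^`M(l) (v *m invmx U) = 0.
    by rewrite -[LHS](mulKVmx uU) e0 mulmx0.
  by move/colP/(_ i); rewrite !mxE => e; rewrite e eqxx in hi.
- by rewrite QE (act_zeros uU hq).
- by rewrite -(act_Gamma hU) -actI ?lker_lm // card_act_eq ?lker_lm.
move=> P; rewrite -{1}(act_Gamma hU) -actI ?lker_lm // => -[P' /hm].
move=> /(intersection_mult_subst uV); rewrite invmxK subst_fermat // => h <-.
exact: h.
Qed.

Lemma rational_pts_act U : unitary U ->
  act (lm U) (@rational_pts k) = @rational_pts k.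
Proof.
have half V : unitary V -> act (lm V) (@rational_pts k) `<=` @rational_pts k.
  move=> hV P [P' [GP' [v PE v25]] <-]; split.
    by rewrite -(act_Gamma hV); exists P'.
  exists (v *m V); first by rewrite PE lm_line.
  move=> j; rewrite mxE.
  have p25 (x y : k) : (x + y) ^+ 25 = x ^+ 25 + y ^+ 25 by rewrite !(exprM _ 5 5) !(pow5D char5).
  rewrite (big_morph (fun x => x ^+ 25) p25 (id1 := 0)) ?expr0n //.
  by apply: eq_bigr => i _; rewrite exprMn v25 (unitary_rational hV).
move=> hU; apply/seteqP; split; first exact: half.
move=> P RP; exists (lm (invmx U) @: P)%VS; last by rewrite lm_imgKV ?unitary_unit.
by apply: (half _ (unitaryV hU)); exists P.
Qed.

Lemma passes_two_act U C L : U \in unitmx -> passes_two C L ->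
  passes_two (act (lm U) C) (lm U @: L)%VS.
Proof.
move=> uU [A [B [CA CB AB AL BL]]]; exists (lm U @: A)%VS, (lm U @: B)%VS; split.
- by exists A.
- by exists B.
- by move=> /(act_inj (lker_lm uU)).
- exact: limgS.
- exact: limgS.
Qed.

Lemma dim_lm U (L : subsp k) : U \in unitmx -> \dim (lm U @: L) = \dim L.
Proof. by move=> uU; rewrite limg_dim_eq // lker_lm // capv0. Qed.

Lemma secants_act U Q : unitary U ->
  secants (act (lm U) Q) = [set (lm U @: L)%VS | L in secants Q].
Proof.
have half V Q' : unitary V -> [set (lm V @: L)%VS | L in secants Q'] `<=` secants (act (lm V) Q').
  move=> hV _ [L [[dL sL] pL] <-]; have uV := unitary_unit hV; split.
    split; first by rewrite dim_lm.
    by rewrite -(rational_pts_act hV); apply: passes_two_act.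
  by rewrite -(act_Gamma hV) -actI ?lker_lm //; apply: passes_two_act.
move=> hU; apply/seteqP; split; last exact: half.
move=> L sL; have uU := unitary_unit hU; exists (lm (invmx U) @: L)%VS; last by rewrite lm_imgKV.
by rewrite -(act_lmK Q uU); apply: half; [exact: unitaryV|exists L].
Qed.

Lemma adj_act U Q Q' : unitary U -> adj Q Q' -> adj (act (lm U) Q) (act (lm U) Q').
Proof.
move=> hU [tQ tQ' neq c4 c3]; have kU := lker_lm (unitary_unit hU); split.
- exact: tt_conics_act.
- exact: tt_conics_act.
- by move=> /(act_injective kU).
- by rewrite -actI // card_act_eq.
by rewrite !secants_act // -!/(act _ _) -actI // card_act_eq.
Qed.

Definition actD U D : set (set (subsp k)) := [set act (lm U) Q | Q in D].

Lemma actDM U V D : actD V (actD U D) = actD (U *m V) D.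
Proof.
apply/seteqP; split=> [_ [_ [Q DQ <-] <-]|_ [Q DQ <-]]; first by exists Q; rewrite ?lm_act.
by exists (act (lm U) Q); [exists Q|rewrite lm_act].
Qed.

Lemma actD1 D : actD 1%:M D = D.
Proof.
apply/seteqP; split=> [_ [Q DQ <-]|Q DQ]; first by rewrite lm1 act1.
by exists Q => //; rewrite lm1 act1.
Qed.

Lemma actDK U D : U \in unitmx -> actD (invmx U) (actD U D) = D.
Proof. by move=> uU; rewrite actDM mulmxV // actD1. Qed.

Definition component Q : set (set (subsp k)) := clos_refl_trans _ (@adj k) Q.

Lemma component_act U Q : unitary U -> actD U (component Q) = component (act (lm U) Q).
Proof.
have half V Q' : unitary V -> actD V (component Q') `<=` component (act (lm V) Q').
  move=> hV _ [R cR <-]; rewrite /component; elim: cR => [x y h|x|x y z _ h1 _ h2].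
  - exact/rt_step/adj_act.
  - exact: rt_refl.
  - exact: rt_trans h1 h2.
move=> hU; apply/seteqP; split; first exact: half.
move=> R cR; have uU := unitary_unit hU.
exists (act (lm (invmx U)) R); last by rewrite act_lmKV.
rewrite -[Q in component Q](act_lmK Q uU).
by apply: (half _ _ (unitaryV hU)); exists R.
Qed.

Lemma adj_sym Q Q' : adj Q Q' -> adj Q' Q.
Proof. by move=> [h1 h2 h3 h4 h5]; split=> //; rewrite ?(setIC Q') ?(setIC (secants Q')) //; apply/nesym. Qed.

Lemma component_eq Q Q' : component Q Q' -> component Q = component Q'.
Proof.
have sym x y : component x y -> component y x.
  by elim=> [a b /adj_sym h|a|a b c _ h1 _ h2]; [exact: rt_step|exact: rt_refl|exact: rt_trans h2 h1].
move=> h; apply/seteqP; split=> R hR; first exact: rt_trans (sym _ _ h) hR.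
exact: rt_trans h hR.
Qed.

Lemma Jm_facts : [/\ Jm k \in unitmx, fr (Jm k) = Jm k & (Jm k)^T = Jm k].
Proof.
have f0 := five0 char5; split.
- pose A : 'M[k]_3 := \matrix_(i, j) (if (i + j == 2)%N then (if i == i1 then 2 else 1) else 0).
  have [] // := @mulmx1_unit _ _ (Jm k) A.
  apply/matrixP => i j; rewrite mxE sum3 !(mxE _ _ _ j).
  have e : -2 * 2 = 1 :> k.
    by rewrite -[LHS]addr0 -f0; ring.
  case: (ord3P i) => ->; rewrite !JmE; case: (ord3P j) => -> /=;
    by rewrite ?(mul0r, mulr0, mul1r, addr0, add0r, e).
- apply/matrixP => i j; rewrite mxE; have e : (-2) ^+ 5 = -2 :> k.
    have -> : (-2) ^+ 5 = -2 + 5 * (- 6) :> k by ring.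
    by rewrite f0 mul0r addr0.
  by case: (ord3P i) => ->; case: (ord3P j) => ->; rewrite JmE ?expr0n ?expr1n.
by apply/matrixP => i j; rewrite mxE; case: (ord3P i) => ->; case: (ord3P j) => ->; rewrite !JmE.
Qed.

Lemma frame_unit M : gram M = Jm k -> M \in unitmx.
Proof. by move=> hM; apply: gram_unit_inv; rewrite hM; case: Jm_facts. Qed.

Lemma frames_unitary M M' : gram M = Jm k -> gram M' = Jm k -> unitary (invmx M *m M').
Proof.
move=> hM hM'; have uM := frame_unit hM.
by rewrite /unitary (gramM char5) hM' -hM -(gramM char5) mulVmx // unitary1.
Qed.

Lemma tt_two_points Q : tt_conics Q -> exists P1 P2,
  [/\ (Q `&` @Gamma k) P1, (Q `&` @Gamma k) P2 & P1 <> P2].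
Proof.
move=> [q [_ _ /card_seqP [[|P1 [|P2 s]] [us s6 sE]] _]] //.
exists P1, P2; rewrite sE /= !inE !eqxx orbT; split=> // e.
by move: us; rewrite /= e inE eqxx.
Qed.

Lemma tt_frame_exists Q : tt_conics Q -> exists2 M, gram M = Jm k & Q = Cset M.
Proof.
move=> tQ; have [P1 [P2 [h1 h2 n]]] := tt_two_points tQ.
by have [M [hM QE _ _]] := tt_frame char5 tQ h1 h2 n; exists M.
Qed.

(** Total tangency is transported from a given conic by a unitary matrix; this is how it reaches the
    explicit base conic. *)
Lemma tt_Cset Q M : tt_conics Q -> gram M = Jm k -> tt_conics (Cset M).
Proof.
move=> tQ hM; have [M' hM' QE] := tt_frame_exists tQ.
have -> : Cset M = act (lm (invmx M' *m M)) Q.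
  by rewrite QE act_Cset mulKVmx // frame_unit.
by apply: tt_conics_act => //; apply: frames_unitary.
Qed.
End Unitary.

(** * Unitary invariance of types, stabilizers and labellings *)

Section Transfer.
Variable k : closedFieldType.
Hypothesis char5 : 5%N \in [pchar k].
Implicit Types (U V M : 'M[k]_3) (Q C : set (subsp k)) (D : set (set (subsp k))).

Lemma card_actD U D n : U \in unitmx -> (actD U D #= `I_n)%card = (D #= `I_n)%card.
Proof.
move=> uU; apply: card_eql; apply: inj_card_eq => x y _ _.
exact/act_injective/lker_lm.
Qed.

Lemma meeting_act U Q D' n : unitary U ->
  meeting (act (lm U) Q) (actD U D') n = actD U (meeting Q D' n).
Proof.
move=> hU; have uU := unitary_unit hU; have kU := lker_lm uU.
have E Q' : (act (lm U) Q `&` act (lm U) Q' `&` @Gamma k #= `I_n)%card =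
    (Q `&` Q' `&` @Gamma k #= `I_n)%card.
  by rewrite -{1}(act_Gamma char5 hU) -!actI // card_act_eq.
apply/seteqP; split=> [_ [[Q' DQ' <-]]|_ [Q' [DQ' h] <-]].
  by rewrite E => h; exists Q'.
by split; [exists Q'|rewrite E].
Qed.

Lemma t_is_act U Q D' t : unitary U -> t_is (act (lm U) Q) (actD U D') t <-> t_is Q D' t.
Proof.
move=> hU; have uU := unitary_unit hU.
by case: t => /=; rewrite !meeting_act // !card_actD.
Qed.

Lemma of_t_act U D D' t : unitary U -> of_t (actD U D) (actD U D') t = actD U (of_t D D' t).
Proof.
move=> hU; apply/seteqP; split=> [_ [[Q DQ <-]]|_ [Q [DQ h] <-]].
  by move=> /(t_is_act _ _ _ hU) h; exists Q.
by split; [exists Q|apply/t_is_act].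
Qed.

Lemma T_is_act U D D' T : unitary U -> T_is (actD U D) (actD U D') T <-> T_is D D' T.
Proof.
move=> hU; have uU := unitary_unit hU.
have all t : (forall Q, actD U D Q -> t_is Q (actD U D') t) <-> (forall Q, D Q -> t_is Q D' t).
  split=> h Q; first by move=> DQ; apply/(t_is_act _ _ _ hU)/h; exists Q.
  by move=> [Q' DQ' <-]; apply/t_is_act/h.
case: T; [exact: all|exact: all| |]; by rewrite /T_is !of_t_act // !card_actD.
Qed.

Lemma act_Aut_Gamma U g : unitary U -> Aut_Gamma g ->
  Aut_Gamma (lm (invmx U) \o (g \o lm U))%VF.
Proof.
move=> hU [kg hg]; have uU := unitary_unit hU.
have uV : invmx U \in unitmx by rewrite unitmx_inv.
split.
  apply/eqP/lker0P => v w; rewrite !comp_lfunE => /(lker0P (introT eqP (lker_lm uV))).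
  by move=> /(lker0P (introT eqP kg)) /(lker0P (introT eqP (lker_lm uU))).
by rewrite -!act_comp act_Gamma // hg act_Gamma //; apply: unitaryV.
Qed.

Lemma stab_act U D g : unitary U -> stab (actD U D) g ->
  stab D (lm (invmx U) \o (g \o lm U))%VF.
Proof.
move=> hU [ag hg]; have uU := unitary_unit hU; split; first exact: act_Aut_Gamma.
apply/seteqP; split=> [_ [Q DQ <-]|Q DQ].
  rewrite -!act_comp; have : actD U D (act g (act (lm U) Q)).
    by rewrite -[in X in X _]hg; exists (act (lm U) Q) => //; exists Q.
  by move=> [Q' DQ' <-]; rewrite act_lmK.
have : actD U D (act (lm U) Q) by exists Q.
rewrite -{1}hg => -[_ [Q' DQ' <-] e]; exists Q' => //.
by rewrite -!act_comp e act_lmK.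
Qed.

Lemma perm_image_act U D D' phi : unitary U ->
  perm_image (actD U D) (phi \o act (lm (invmx U))) (stab (actD U D) `&` stab (actD U D')) =
  perm_image D phi (stab D `&` stab D').
Proof.
have half V E E' psi : unitary V ->
  perm_image (actD V E) (psi \o act (lm (invmx V))) (stab (actD V E) `&` stab (actD V E')) \subset
  perm_image E psi (stab E `&` stab E').
  move=> hV; have uV := unitary_unit hV.
  apply/fintype.subsetP => s; rewrite !inE => /asboolP [g [s1 s2] hg]; apply/asboolP.
  exists (lm (invmx V) \o (g \o lm V))%VF; first by split; apply: stab_act.
  move=> Q EQ; have := hg (act (lm V) Q); rewrite /= act_lmK // -!act_comp => -> //.
  by exists Q.
move=> hU; have uU := unitary_unit hU; apply/eqP; rewrite finset.eqEsubset half //=.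
have := half _ (actD U D) (actD U D') (phi \o act (lm (invmx U))) (unitaryV char5 hU).
rewrite !actDK // invmxK.
by have -> : (phi \o act (lm (invmx U))) \o act (lm U) = phi by apply/funext => Q /=; rewrite act_lmK.
Qed.

Definition criterion D D' phi :=
  let H := perm_image D phi (stab D `&` stab D') in
  [/\ T_is D D' beta21 <-> A7_conj H Sigma_b \/ A7_conj H Sigma_b',
      T_is D D' gamma21 <-> A7_conj H Sigma_d,
      T_is D D' alpha15_gamma6 <-> A7_conj H Sigma_a &
      T_is D D' alpha3_gamma18 <-> A7_conj H Sigma_c].

Lemma criterion_act U D D' phi : unitary U ->
  criterion (actD U D) (actD U D') (phi \o act (lm (invmx U))) -> criterion D D' phi.
Proof.
move=> hU; have E T : T_is (actD U D) (actD U D') T = T_is D D' T by apply/propext/T_is_act.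
by rewrite /criterion; cbv zeta; rewrite perm_image_act // !E.
Qed.

Lemma T7_iso_act U D phi : unitary U -> T7_iso D phi ->
  T7_iso (actD U D) (phi \o act (lm (invmx U))).
Proof.
move=> hU [[h1 h2 h3] hadj]; have uU := unitary_unit hU; split.
  split.
  - by move=> _ [Q DQ <-]; rewrite /= act_lmK //; apply: h1.
  - move=> x y; rewrite !in_setE => -[Q DQ <-] [Q' DQ' <-] /=; rewrite !act_lmK // => e.
    by congr act; apply: h2; rewrite ?in_setE.
  by move=> A /h3 [Q DQ <-]; exists (act (lm U) Q); [exists Q|rewrite /= act_lmK].
move=> _ _ [Q DQ <-] [Q' DQ' <-]; rewrite /= !act_lmK // -(hadj Q Q') //.
split=> [/(adj_act char5 (unitaryV char5 hU))|]; first by rewrite !act_lmK.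
exact: adj_act.
Qed.

(** The number of conics of D' that miss Q on Gamma, 18, 16 or 15, already determines t(Q, D'). A
    member of D is supplied because the two uniform types would hold vacuously for an empty D. *)
Lemma T_is_excl D D' Q0 T T' : D Q0 -> T_is D D' T -> T_is D D' T' -> T = T'.
Proof.
move=> DQ0.
have det n m (A : set (set (subsp k))) : (A #= `I_n)%card -> (A #= `I_m)%card -> n = m.
  by move=> h1 h2; apply/card_eq_II/(card_eq_trans _ h2); rewrite card_eq_sym.
pose zeros_of t := match t with alpha => 18%N | beta => 16%N | gamma => 15%N end.
have zeros_ofP Q t : t_is Q D' t -> (meeting Q D' 0 #= `I_(zeros_of t))%card.
  by case: t => -[].
have texcl Q t t' : t_is Q D' t -> t_is Q D' t' -> t = t'.
  by move=> /zeros_ofP h /zeros_ofP /(det _ _ _ h); case: t {h}; case: t'.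
have nz n t : (of_t D D' t #= `I_n.+1)%card -> exists2 Q, D Q & t_is Q D' t.
  move=> /card_seqP [[|Q s] [us ss sE]] //; exists Q;
   by have [] : of_t D D' t Q by rewrite sE /= inE eqxx.
have no t t' n : t' <> t -> (forall Q, D Q -> t_is Q D' t) -> ~ (of_t D D' t' #= `I_n.+1)%card.
  by move=> ne h /nz [Q DQ /texcl e]; apply: ne; apply: e; exact: h.
case: T; case: T' => //; rewrite /T_is.
- by move=> /(_ _ DQ0) h /(_ _ DQ0) /(texcl _ _ _ h).
- by move=> h [h1 _]; case: (no beta alpha 14%N _ h h1).
- by move=> h [h1 _]; case: (no beta alpha 2%N _ h h1).
- by move=> /(_ _ DQ0) h /(_ _ DQ0) /(texcl _ _ _ h).
- by move=> h [h1 _]; case: (no gamma alpha 14%N _ h h1).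
- by move=> h [h1 _]; case: (no gamma alpha 2%N _ h h1).
- by move=> [h1 _] h; case: (no beta alpha 14%N _ h h1).
- by move=> [h1 _] h; case: (no gamma alpha 14%N _ h h1).
- by move=> [h1 _] [h2 _]; have := det _ _ _ h1 h2.
- by move=> [h1 _] h; case: (no beta alpha 2%N _ h h1).
- by move=> [h1 _] h; case: (no gamma alpha 2%N _ h h1).
by move=> [h1 _] [h2 _]; have := det _ _ _ h1 h2.
Qed.
End Transfer.

(** * The base component *)

Section Evaluation.
Variable k : closedFieldType.
Hypothesis char5 : 5%N \in [pchar k].
Variable r2 : k.
Hypothesis r2E : r2 ^+ 2 = 2.

Definition ev (x : F25) : k := x.1%:R + x.2%:R * r2.
Definition evv (v : vec) : 'rV[k]_3 := let: (x, y, z) := v in vec3 (ev x) (ev y) (ev z).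
Definition evm (A : mat) : 'M[k]_3 := let: (a, b, c) := A in mat3 (evv a) (evv b) (evv c).

Lemma evvE x y z : evv (x, y, z) = vec3 (ev x) (ev y) (ev z).
Proof. by []. Qed.

Lemma evmE a b c : evm (a, b, c) = mat3 (evv a) (evv b) (evv c).
Proof. by []. Qed.

Lemma ev_nat n : ev (n, 0%N) = n%:R.
Proof. by rewrite /ev mul0r addr0. Qed.

Lemma natr_mod5 n : (n %% 5)%:R = n%:R :> k.
Proof. by rewrite {2}(divn_eq n 5) natrD natrM (pcharf0 char5) mulr0 add0r. Qed.

Lemma evD x y : ev (fadd x y) = ev x + ev y.
Proof. by rewrite /ev /= !natr_mod5 !natrD; ring. Qed.

Lemma evM x y : ev (fmul x y) = ev x * ev y.
Proof.
rewrite /ev /= !natr_mod5 !natrD !natrM.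
transitivity (x.1%:R * y.1%:R + r2 ^+ 2 * (x.2%:R * y.2%:R) + (x.1%:R * y.2%:R + x.2%:R * y.1%:R) * r2).
  by rewrite r2E; ring.
ring.
Qed.

Lemma natr_pow5 n : n%:R ^+ 5 = n%:R :> k.
Proof. by rewrite -(pFrobenius_autE char5) pFrobenius_aut_nat. Qed.

Lemma ev_conj x : ev (fconj x) = ev x ^+ 5.
Proof.
rewrite /ev (pow5D char5) exprMn !natr_pow5 /= natr_mod5 natrM.
have -> : r2 ^+ 5 = r2 * (r2 ^+ 2) ^+ 2 by ring.
rewrite r2E; ring.
Qed.

Lemma evv_scale c v : evv (vscale c v) = ev c *: evv v.
Proof. by case: v => [[x y] z]; rewrite /= vec3Z !evM. Qed.

Lemma evv_add v w : evv (vadd v w) = evv v + evv w.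
Proof.
case: v => [[x y] z]; case: w => [[x' y'] z'].
by apply/rowP => j; case: (ord3P j) => ->; rewrite [RHS]mxE /= !vec3E evD.
Qed.

Lemma evv_mul v A : evv (vmul v A) = evv v *m evm A.
Proof.
case: v => [[x y] z]; case: A => [[a b] c] /=.
by rewrite mul_mat3 !vec3E !evv_add !evv_scale.
Qed.

Lemma ev_herm v w : ev (vherm v w) = herm (evv v) (evv w).
Proof.
case: v => [[x y] z]; case: w => [[x' y'] z'].
by rewrite /herm sum3 !vec3E /= !evD !evM !ev_conj.
Qed.

Lemma ev0 : ev (0%N, 0%N) = 0.
Proof. by rewrite /ev mul0r addr0. Qed.

Lemma ev1 : ev (1%N, 0%N) = 1.
Proof. by rewrite /ev mul0r addr0. Qed.

(** The norm a^2 - 2 b^2 is anisotropic because 2 is not a square modulo 5; [ev_eq0] deduces from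
    this that [ev] has trivial kernel on reduced pairs. *)
Lemma F25s_norm : all (fun x : F25 => ((x.1 * x.1 + 3 * (x.2 * x.2)) %% 5 == 0) ==> (x == (0, 0)))%N F25s.
Proof. by []. Qed.

Lemma F25s_sub : all (fun x => all (fun y => (fadd x (fmul (4, 0) y) \in F25s) &&
  ((fadd x (fmul (4, 0) y) == (0, 0)) ==> (x == y))) F25s)%N F25s.
Proof. by vm_compute. Qed.

Lemma ev_eq0 x : x \in F25s -> ev x = 0 -> x = (0%N, 0%N).
Proof.
move=> /(allP F25s_norm) /implyP h e; apply/eqP/h.
have : (x.1 * x.1 + 3 * (x.2 * x.2))%:R = 0 :> k.
  rewrite natrD !natrM.
  have -> : x.1%:R * x.1%:R + 3%:R * (x.2%:R * x.2%:R) =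
     ev x * (x.1%:R - x.2%:R * r2) + 5 * (x.2%:R * x.2%:R) + (x.2%:R * x.2%:R) * (r2 ^+ 2 - 2) :> k.
    by rewrite /ev; ring.
  by rewrite e r2E subrr (five0 char5) !(mul0r, mulr0) !addr0.
by move=> /eqP; rewrite -(dvdn_pcharf char5).
Qed.

Lemma ev_inj : {in F25s &, injective ev}.
Proof.
move=> x y hx hy e; have /andP[h1 /implyP h2] := allP (allP F25s_sub x hx) y hy.
apply/eqP/h2/eqP/ev_eq0 => //; rewrite evD evM e /ev /= mul0r addr0.
have -> : 4 = 5 - 1 :> k by ring.
rewrite (five0 char5); ring.
Qed.

Lemma F25s_conj2 : all (fun x => fconj (fconj x) == x) F25s.
Proof. by []. Qed.

(** Otherwise x and the 25 values of [ev] would be 26 distinct roots of X^25 - X. *)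
Lemma ev_surj (x : k) : x ^+ 25 = x -> exists2 y, y \in F25s & x = ev y.
Proof.
move=> hx; apply: contrapT => h.
pose rs := x :: map ev F25s.
have urs : uniq rs.
  rewrite cons_uniq (map_inj_in_uniq ev_inj) andbT.
  by apply/negP => /mapP [y hy xy]; apply: h; exists y.
have s26 : size ('X^25 - 'X : {poly k}) = 26%N.
  by rewrite size_polyDl size_polyXn // size_polyN size_polyX.
have p0 : 'X^25 - 'X != 0 :> {poly k} by rewrite -size_poly_eq0 s26.
have rp y : y ^+ 25 = y -> root ('X^25 - 'X) y.
  by move=> e; rewrite rootE !(hornerD, hornerN, hornerXn, hornerX) e subrr.
have : all (root ('X^25 - 'X)) rs.
  apply/allP => y; rewrite inE => /orP[/eqP->|/mapP [z hz ->]]; first exact: rp.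
  apply: rp; rewrite (exprM _ 5 5) -!ev_conj.
  by have /eqP -> := allP F25s_conj2 z hz.
by move=> /(max_poly_roots p0) /(_ urs); rewrite s26 (_ : size rs = 26%N) ?ltnn.
Qed.

Lemma ev_fixed y : y \in F25s -> ev y ^+ 25 = ev y.
Proof. by move=> hy; rewrite (exprM _ 5 5) -!ev_conj; have /eqP -> := allP F25s_conj2 y hy. Qed.

Definition red (v : vec) : bool := let: (x, y, z) := v in [&& x \in F25s, y \in F25s & z \in F25s].

Lemma evv_inj : {in red &, injective evv}.
Proof.
move=> [[x y] z] [[x' y'] z'] /and3P[hx hy hz] /and3P[hx' hy' hz'] /= e.
have e0 := congr1 (fun v : 'rV[k]_3 => v 0 i0) e.
have e1 := congr1 (fun v : 'rV[k]_3 => v 0 i1) e.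
have e2 := congr1 (fun v : 'rV[k]_3 => v 0 i2) e.
move: e0 e1 e2; rewrite /= !vec3E => e0 e1 e2.
by rewrite (ev_inj hx hx' e0) (ev_inj hy hy' e1) (ev_inj hz hz' e2).
Qed.

Lemma lines25P v : v \in lines25 -> [\/ v = ((0, 0), (0, 0), (1, 0))%N,
  exists2 c, c \in F25s & v = ((0, 0), (1, 0), c)%N |
  exists b c, [/\ b \in F25s, c \in F25s & v = ((1, 0), b, c)%N]].
Proof.
rewrite inE mem_cat => /or3P[/eqP ->|/mapP [c hc ->]|/allpairsP [[b c] [hb hc ->]]].
- exact: Or31.
- by apply: Or32; exists c.
by apply: Or33; exists b, c.
Qed.

Lemma lines25_red v : v \in lines25 -> red v.
Proof. by move=> /lines25P [->|[c hc ->]|[b [c [hb hc ->]]]]; rewrite /red ?hb ?hc. Qed.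

Lemma evv_neq0 v : v \in lines25 -> evv v != 0.
Proof.
move=> /lines25P [->|[c hc ->]|[b [c [hb hc ->]]]]; rewrite /= vec3_eq0 ?ev1 ?oner_eq0 ?andbF //.
Qed.

Lemma lines25_inj v w : v \in lines25 -> w \in lines25 ->
  (<[evv v]> = <[evv w]>)%VS -> v = w.
Proof.
move=> hv hw e; apply: (evv_inj (lines25_red hv) (lines25_red hw)).
have [c c0 H] := (line_eqP _ (evv_neq0 hv)).1 e.
suff c1 : c = 1 by rewrite H c1 scale1r.
have E j : evv v 0 j = c * evv w 0 j by rewrite H mxE.
have n10 : (1 : k) <> 0 by apply/eqP/oner_neq0.
have c0' : 0 <> c by apply/eqP; rewrite eq_sym.
have := E i0; have := E i1; have := E i2.
by case: (lines25P hv) => [->|[a _ ->]|[a [b [_ _ ->]]]];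
   case: (lines25P hw) => [->|[a' _ ->]|[a' [b' [_ _ ->]]]];
   rewrite /= !vec3E ?ev1 ?ev0 ?mulr1 ?mulr0.
Qed.

Lemma lines25_cover (v : 'rV[k]_3) : v != 0 -> (forall i, v 0 i ^+ 25 = v 0 i) ->
  exists2 w, w \in lines25 & (<[v]> = <[evv w]>)%VS.
Proof.
move=> v0 v25; have div25 i j : exists2 y, y \in F25s & v 0 i / v 0 j = ev y.
  by apply: ev_surj; rewrite expr_div_n !v25.
have [z0|nz0] := eqVneq (v 0 i0) 0; last first.
  have [b hb bE] := div25 i1 i0; have [c hc cE] := div25 i2 i0.
  exists ((1, 0), b, c)%N.
    rewrite inE mem_cat; apply/or3P/Or33/allpairsP; exists (b, c); split=> //.
  apply/line_eqP => //; exists (v 0 i0) => //.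
  by rewrite {1}(vec3_eta v) /= vec3Z ev1 -bE -cE mulr1 !(mulrC (v 0 i0)) !divfK.
have [z1|nz1] := eqVneq (v 0 i1) 0; last first.
  have [c hc cE] := div25 i2 i1.
  exists ((0, 0), (1, 0), c)%N.
    by rewrite inE mem_cat; apply/or3P/Or32/mapP; exists c.
  apply/line_eqP => //; exists (v 0 i1) => //.
  by rewrite {1}(vec3_eta v) /= vec3Z ev1 ev0 -cE z0 mulr1 mulr0 mulrC divfK.
have nz2 : v 0 i2 != 0.
  by apply: contraNneq v0 => z2; rewrite (vec3_eta v) z0 z1 z2 vec3_eq0 eqxx.
exists ((0, 0), (0, 0), (1, 0))%N; first by rewrite inE eqxx.
apply/line_eqP => //; exists (v 0 i2) => //.
by rewrite {1}(vec3_eta v) /= vec3Z ev1 ev0 z0 z1 mulr1 mulr0.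
Qed.

Definition pt (n : nat) : subsp k := <[evv (nth vzero points n)]>%VS.

Lemma ptE n : pt n = <[evv (nth vzero points n)]>%VS.
Proof. by []. Qed.

Lemma pointsE : points = [seq v <- lines25 | vherm v v == (0, 0)%N].
Proof. by vm_compute. Qed.

Lemma size_points : size points = 126%N.
Proof. by []. Qed.

Lemma uniq_points : uniq points.
Proof. by vm_compute. Qed.

Lemma nth_points n : (n < 126)%N -> nth vzero points n \in lines25 /\
  vherm (nth vzero points n) (nth vzero points n) = (0, 0)%N.
Proof.
move=> hn; have : nth vzero points n \in points by rewrite mem_nth // size_points.
by rewrite {2}pointsE mem_filter => /andP[/eqP].
Qed.

Lemma pt_Gamma n : (n < 126)%N -> Gamma (pt n).
Proof.
move=> /nth_points [h1 h2]; apply/Gamma_line; split; first exact: evv_neq0.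
by rewrite -ev_herm h2 ev0.
Qed.

Lemma pt_inj n m : (n < 126)%N -> (m < 126)%N -> pt n = pt m -> n = m.
Proof.
move=> hn hm; have [h1 _] := nth_points hn; have [h2 _] := nth_points hm.
by move=> /(lines25_inj h1 h2) /eqP; rewrite nth_uniq ?size_points ?uniq_points // => /eqP.
Qed.

Lemma vherm_red v w : vherm v w \in F25s.
Proof.
have fred x y : fadd x y \in F25s.
  by apply/allpairsP; exists (fadd x y); split=> //; rewrite mem_iota ltn_mod.
by case: v => [[x y] z]; case: w => [[x' y'] z']; apply: fred.
Qed.

Lemma rational_pt (v : 'rV[k]_3) : v != 0 -> (forall i, v 0 i ^+ 25 = v 0 i) -> herm v v = 0 ->
  exists2 n, (n < 126)%N & <[v]>%VS = pt n.
Proof.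
move=> v0 v25 hv; have [w hw e] := lines25_cover v0 v25.
have wp : w \in points.
  rewrite pointsE mem_filter hw andbT; apply/eqP/ev_eq0; first exact: vherm_red.
  have : Gamma <[v]>%VS by apply/Gamma_line.
  by rewrite e ev_herm => /Gamma_line [].
exists (index w points); first by rewrite -size_points index_mem.
by rewrite /pt nth_index.
Qed.

Lemma gen_pt g n : (g < 3)%N -> (n < 126)%N ->
  (pact g n < 126)%N /\ (lm (evm (gen g)) @: pt n)%VS = pt (pact g n).
Proof.
move=> hg hn; have := check_gens_true => /allP /(_ g); rewrite mem_iota => /(_ hg).
move=> /andP[/allP /(_ n)]; rewrite mem_iota => /(_ hn) /and4P[h1 h2 h3 /eqP h4] _.
split=> //; rewrite /pt lm_line -evv_mul -h4 evv_scale line_scale //.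
by apply: contraNneq h3 => /(ev_eq0 h2) ->.
Qed.

Lemma evv_units : [/\ evv (ve 1 0 0) = vec3 1 0 0, evv (ve 0 1 0) = vec3 0 1 0
  & evv (ve 0 0 1) = vec3 0 0 1].
Proof. by rewrite /evv /= ev1 ev0. Qed.

Lemma gen_unitary g : (g < 3)%N -> unitary (evm (gen g)).
Proof.
move=> hg; have := check_gens_true => /allP /(_ g); rewrite mem_iota => /(_ hg).
move=> /andP[_ h]; have [u0 u1 u2] := evv_units.
have H i j : i \in [:: ve 1 0 0; ve 0 1 0; ve 0 0 1] -> j \in [:: ve 1 0 0; ve 0 1 0; ve 0 0 1] ->
    herm (evv i *m evm (gen g)) (evv j *m evm (gen g)) = (i == j)%:R.
  move=> hi hj; have /eqP e := allP (allP h i hi) j hj.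
  by rewrite -!evv_mul -ev_herm e; case: ifP; rewrite ?ev1 ?ev0.
have [r0 r1 r2'] := row_vec3 (evm (gen g)).
apply/matrixP => i j; rewrite !mxE.
by case: (ord3P i) => ->; case: (ord3P j) => ->; rewrite ?r0 ?r1 ?r2' -?u0 -?u1 -?u2 H ?inE ?eqxx ?orbT.
Qed.
End Evaluation.

(** * Contact points of a totally tangent conic *)

Section ConicPoints.
Variable k : closedFieldType.
Hypothesis char5 : 5%N \in [pchar k].

Lemma fermat_little_roots (r : k) : r ^+ 5 = r -> r \in [:: 0; 1; 2; 3; 4].
Proof.
move=> e; have : r * ((r - 1) * ((r - 2) * ((r - 3) * (r - 4)))) = 0.
  have -> : r * ((r - 1) * ((r - 2) * ((r - 3) * (r - 4)))) =
    (r ^+ 5 - r) + 5 * (- 2 * r ^+ 4 + 7 * r ^+ 3 - 10 * r ^+ 2 + 5 * r) by ring.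
  by rewrite e (five0 char5) mul0r subrr addr0.
by move=> /eqP; rewrite !mulf_eq0 !subr_eq0 !inE.
Qed.

Lemma herm_frame M x : gram M = Jm k ->
  herm (x *m M) (x *m M) = x 0 i0 ^+ 5 * x 0 i2 - 2 * x 0 i1 ^+ 6 + x 0 i2 ^+ 5 * x 0 i0.
Proof. by move=> hM; rewrite (herm_mul char5) hM !sum3 !JmE; ring. Qed.

(** At the parameter r the Hermitian form equals (r^5 - r)^2, so the contact points correspond to
    the projective line over F_5, the first row of M being the point at infinity. *)
Lemma Cset_Gamma M P : gram M = Jm k -> (Cset M `&` @Gamma k) P <->
  P = <[vec3 1 0 0 *m M]>%VS \/ exists2 r, r \in [:: 0; 1; 2; 3; 4] & P = <[vec3 (r ^+ 2) r 1 *m M]>%VS.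
Proof.
move=> hM; have uM := frame_unit char5 hM.
have inC (x : 'rV[k]_3) : x != 0 -> x 0 i1 ^+ 2 = x 0 i0 * x 0 i2 -> herm (x *m M) (x *m M) = 0 ->
    (Cset M `&` @Gamma k) <[x *m M]>%VS.
  move=> x0 xE xh; split; first by exists x.
  apply/Gamma_line; split=> //; apply: contraNneq x0 => e.
  by rewrite -(mulmxK uM x) e mul0mx.
split=> [[[x [x0 xE ->]] /Gamma_line [_ hx]]|[->|[r hr ->]]]; last 2 first.
- apply: inC; rewrite ?vec3_eq0 ?oner_eq0 ?vec3E ?expr0n ?mulr0 //.
  by rewrite (herm_frame _ hM) !vec3E; ring.
- apply: inC; rewrite ?vec3_eq0 ?oner_eq0 ?andbF ?vec3E ?mulr1 //.
  rewrite (herm_frame _ hM) !vec3E.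
  have -> : (r ^+ 2) ^+ 5 * 1 - 2 * r ^+ 6 + 1 ^+ 5 * r ^+ 2 = (r ^+ 5 - r) ^+ 2 by ring.
  suff -> : r ^+ 5 = r by rewrite subrr expr0n.
  move: hr; rewrite !inE => /or4P[/eqP->|/eqP->|/eqP->|/orP[]/eqP->];
    by rewrite ?expr0n ?expr1n // natr_pow5.
have [x20|x2] := eqVneq (x 0 i2) 0.
  left; move/eqP: xE; rewrite x20 mulr0 expf_eq0 /= => /eqP x10.
  have xV : x = x 0 i0 *: vec3 1 0 0 by rewrite vec3Z mulr1 !mulr0 {1}(vec3_eta x) x10 x20.
  rewrite xV -scalemxAl line_scale //.
  by apply: contraNneq x0 => x00; rewrite (vec3_eta x) x00 x10 x20 vec3_eq0 eqxx.
right; pose r := x 0 i1 / x 0 i2.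
have xV : x = x 0 i2 *: vec3 (r ^+ 2) r 1.
  rewrite vec3Z [LHS]vec3_eta; congr vec3; last by rewrite mulr1.
    by rewrite /r expr_div_n xE -mulf_div divff // mulr1 mulrC divfK.
  by rewrite /r mulrC divfK.
exists r; last by rewrite {1}xV -scalemxAl line_scale.
apply: fermat_little_roots; apply/eqP; rewrite -subr_eq0 -sqrf_eq0.
have := hx; rewrite {1 2}xV -!scalemxAl hermZl hermZr => /eqP.
rewrite mulrA mulf_eq0 (negbTE (mulf_neq0 (expf_neq0 5 x2) x2)) /= (herm_frame _ hM) !vec3E.
by have -> : (r ^+ 2) ^+ 5 * 1 - 2 * r ^+ 6 + 1 ^+ 5 * r ^+ 2 = (r ^+ 5 - r) ^+ 2 by ring.
Qed.

Lemma tt_rational Q P : tt_conics Q -> (Q `&` @Gamma k) P -> exists v : 'rV[k]_3,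
  [/\ v != 0, forall i, v 0 i ^+ 25 = v 0 i, herm v v = 0 & P = <[v]>%VS].
Proof.
move=> tQ QP; have [M hM QE] := tt_frame_exists char5 tQ.
have [uJ fJ sJ] := Jm_facts char5.
have M25 := gram_rational char5 hM uJ fJ sJ.
have GP : Gamma P := QP.2.
have rat (x : 'rV[k]_3) : (forall i, x 0 i ^+ 5 = x 0 i) -> forall i, (x *m M) 0 i ^+ 25 = (x *m M) 0 i.
  move=> hx i; rewrite mxE sum3 (exprM _ 5 5) !(pow5D char5) -!exprM !exprMn !M25.
  by rewrite !(exprM _ 5 5) !hx.
have fin (x : 'rV[k]_3) : P = <[x *m M]>%VS -> (forall i, x 0 i ^+ 5 = x 0 i) ->
    exists v : 'rV[k]_3, [/\ v != 0, forall i, v 0 i ^+ 25 = v 0 i, herm v v = 0 & P = <[v]>%VS].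
  move=> PE hx; move: GP; rewrite PE => /Gamma_line [n0 h0].
  by exists (x *m M); split=> //; apply: rat.
have r5 (r : k) : r \in [:: 0; 1; 2; 3; 4] -> r ^+ 5 = r.
  by rewrite !inE => /or4P[/eqP->|/eqP->|/eqP->|/orP[]/eqP->];
    rewrite ?expr0n ?expr1n // natr_pow5.
move: QP; rewrite QE => /(Cset_Gamma _ hM) [/fin|[r hr /fin]]; apply=> i;
  case: (ord3P i) => ->; rewrite vec3E ?expr0n ?expr1n //; last exact: r5.
by rewrite exprAC r5.
Qed.

(** On the parametrization of Q the equation of Q' is a quartic that vanishes at the six points of
    the projective line over F_5, hence identically. Thus a totally tangent conic is determined by
    its contact points. *)
Lemma tt_points_sub Q Q' : tt_conics Q -> tt_conics Q' ->
  Q `&` @Gamma k `<=` Q' `&` @Gamma k -> Q `<=` Q'.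
Proof.
move=> tQ tQ' sub; have [M hM QE] := tt_frame_exists char5 tQ.
have [q [S [hq [sS fS _] uS Q'E _]]] := tt_conic_matrix char5 tQ'.
have uM := frame_unit char5 hM.
pose N i j := bil S (row i M) (row j M).
have [r0 r1 r2] := row_vec3 M.
have NC i j : N i j = N j i by rewrite /N bilC.
have qE x : evalv q (x *m M) = x 0 i0 ^+ 2 * N i0 i0 + x 0 i1 ^+ 2 * N i1 i1 + x 0 i2 ^+ 2 * N i2 i2 +
   2 * (x 0 i0 * x 0 i1 * N i0 i1 + x 0 i0 * x 0 i2 * N i0 i2 + x 0 i1 * x 0 i2 * N i1 i2).
  rewrite fS mulmx_sum_row sum3 !(bilDl, bilDr, bilZl, bilZr) /N.
  rewrite (bilC (row i1 M) (row i0 M) sS) (bilC (row i2 M) (row i0 M) sS) (bilC (row i2 M) (row i1 M) sS).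
  ring.
have vanish v : (Cset M `&` @Gamma k) <[v]>%VS -> evalv q v = 0.
  by rewrite -QE => /sub [+ _]; rewrite Q'E => /(zeros_line _ hq) [].
have a0 : N i0 i0 = 0.
  have : evalv q (vec3 1 0 0 *m M) = 0 by apply: vanish; apply/(Cset_Gamma _ hM); left.
  by rewrite qE !vec3E => <-; ring.
have ar r : r \in [:: 0; 1; 2; 3; 4 : k] ->
    2 * r ^+ 3 * N i0 i1 + r ^+ 2 * (2 * N i0 i2 + N i1 i1) + 2 * r * N i1 i2 + N i2 i2 = 0.
  move=> hr; have : evalv q (vec3 (r ^+ 2) r 1 *m M) = 0.
    by apply: vanish; apply/(Cset_Gamma _ hM); right; exists r.
  by rewrite qE !vec3E a0 => <-; ring.
have f5 := five0 char5.
have e0 := ar 0; have e1 := ar 1; have e2 := ar 2; have e3 := ar 3; have e4 := ar 4.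
move: e0 e1 e2 e3 e4; rewrite !inE !eqxx !orbT => /(_ isT) e0 /(_ isT) e1 /(_ isT) e2 /(_ isT) e3 /(_ isT) e4.
have n22 : N i2 i2 = 0 by rewrite -e0; ring.
move: e1 e2 e3 e4; set b := N i0 i1; set d := 2 * N i0 i2 + N i1 i1; set e := N i1 i2; rewrite n22.
move=> e1 e2 e3 e4.
(* The values at r = 1 and r = 4 = -1 are added, so that the odd terms cancel modulo 5; the explicit
   multiple of 5 collects the integer remainder. The other coefficients follow by similar
   combinations. *)
have d0 : d = 0.
  have -> : d = 3 * ((2 * 1 ^+ 3 * b + 1 ^+ 2 * d + 2 * 1 * e + 0) + (2 * 4 ^+ 3 * b + 4 ^+ 2 * d + 2 * 4 * e + 0))
     + 5 * (-78 * b - 10 * d - 6 * e) by ring.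
  by rewrite e1 e4 f5; ring.
have b0 : b = 0.
  have -> : b = 3 * ((2 * 2 ^+ 3 * b + 2 ^+ 2 * d + 2 * 2 * e + 0)
      - 2 * (2 * 1 ^+ 3 * b + 1 ^+ 2 * d + 2 * 1 * e + 0)) - 5 * (7 * b) - 6 * d by ring.
  by rewrite e1 e2 d0 f5; ring.
have ez : e = 0.
  have -> : e = 3 * (2 * 1 ^+ 3 * b + 1 ^+ 2 * d + 2 * 1 * e + 0) - 6 * b - 3 * d - 5 * e by ring.
  by rewrite e1 b0 d0 f5; ring.
move=> P; rewrite {1}QE => -[x [x0 xE ->]]; rewrite Q'E; apply/(zeros_line _ hq); split.
  by apply: contraNneq x0 => e'; rewrite -(mulmxK uM x) e' mul0mx.
rewrite qE xE a0 n22 -/b -/e b0 ez.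
transitivity (x 0 i0 * x 0 i2 * d); first by rewrite /d; ring.
by rewrite d0 mulr0.
Qed.

Lemma tt_eq_points Q Q' : tt_conics Q -> tt_conics Q' ->
  (forall P, (Q `&` @Gamma k) P <-> (Q' `&` @Gamma k) P) -> Q = Q'.
Proof.
move=> tQ tQ' h; apply/seteqP.
by split; apply: tt_points_sub => // P /h.
Qed.
End ConicPoints.

(** * Conics encoded by indices of their contact points *)

Section ConicLists.
Variable k : closedFieldType.
Hypothesis char5 : 5%N \in [pchar k].
Variable r2 : k.
Hypothesis r2E : r2 ^+ 2 = 2.
Local Notation ev := (ev r2).
Local Notation evv := (evv r2).
Local Notation evm := (evm r2).
Local Notation pt := (pt r2).
Implicit Types (Q : set (subsp k)) (l : seq nat) (L : seq (seq nat)).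

Definition Q0 : set (subsp k) := Cset (evm M0).

Lemma M0_frame : gram (evm M0) = Jm k.
Proof.
have [u0 u1 u2] := evv_units r2; have [s0 s1 s2] := row_vec3 (evm M0).
have f5 := five0 char5.
have e3 : ev (3, 0)%N = -2.
  rewrite ev_nat; have -> : -2 = 3 - 5 :> k by ring.
  by rewrite f5 subr0.
have H v w c : (v, w, c) \in Jlist -> herm (evv v *m evm M0) (evv w *m evm M0) = ev c.
  by move=> h; have /eqP /= <- := allP M0_gram _ h; rewrite (ev_herm char5 r2E) !(evv_mul char5 r2E).
apply/matrixP => i j; rewrite mxE.
case: (ord3P i) => ->; case: (ord3P j) => ->; rewrite ?s0 ?s1 ?s2 -?u0 -?u1 -?u2 JmE.
- by rewrite (H _ _ (0, 0)%N) ?ev0.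
- by rewrite (H _ _ (0, 0)%N) ?ev0.
- by rewrite (H _ _ (1, 0)%N) ?ev1.
- by rewrite (H _ _ (0, 0)%N) ?ev0.
- by rewrite (H _ _ (3, 0)%N) ?e3.
- by rewrite (H _ _ (0, 0)%N) ?ev0.
- by rewrite (H _ _ (1, 0)%N) ?ev1.
- by rewrite (H _ _ (0, 0)%N) ?ev0.
by rewrite (H _ _ (0, 0)%N) ?ev0.
Qed.

Lemma scaled_pointP u n : scaled_point u n -> (n < 126)%N /\ <[evv u]>%VS = pt n.
Proof.
move=> /and4P[h1 h2 h3 /eqP h4]; split=> //.
rewrite ptE -h4 (evv_scale char5 r2E) line_scale //.
by apply: contraNneq h3 => /(ev_eq0 char5 r2E h2) ->.
Qed.

Definition has_idx Q l : Prop := [/\ tt_conics Q, good l &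
  forall P, (Q `&` @Gamma k) P <-> exists2 n, n \in l & P = pt n].

Lemma good_lt l n : good l -> n \in l -> (n < 126)%N.
Proof. by move=> /and3P[_ /allP h _] /h. Qed.

Lemma good_uniq l : good l -> uniq l.
Proof. by move=> /and3P[h _ _]; exact: (sorted_uniq ltn_trans ltnn h). Qed.

Lemma good_eq l l' : good l -> good l' -> l =i l' -> l = l'.
Proof.
move=> /and3P[h _ _] /and3P[h' _ _].
by apply: (irr_sorted_eq ltn_trans ltnn).
Qed.

Lemma has_idx_inj Q Q' l : has_idx Q l -> has_idx Q' l -> Q = Q'.
Proof.
by move=> [tQ _ h] [tQ' _ h']; apply: (tt_eq_points char5) => // P; rewrite h h'.
Qed.

Lemma has_idx_fun Q l l' : has_idx Q l -> has_idx Q l' -> l = l'.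
Proof.
move=> [_ g h] [_ g' h']; apply: good_eq => // n.
have sub l1 l2 : good l1 -> good l2 -> (forall P, (Q `&` @Gamma k) P <-> exists2 n, n \in l1 & P = pt n) ->
   (forall P, (Q `&` @Gamma k) P <-> exists2 n, n \in l2 & P = pt n) -> n \in l1 -> n \in l2.
  move=> g1 g2 h1 h2 nl; have /h2 [m ml e] : (Q `&` @Gamma k) (pt n) by apply/h1; exists n.
  by rewrite (pt_inj char5 r2E (good_lt g1 nl) (good_lt g2 ml) e).
by apply/idP/idP; apply: sub.
Qed.

Lemma params_map : [seq evv v | v <- params] =
  [:: vec3 1 0 0; vec3 (0 ^+ 2) 0 1; vec3 (1 ^+ 2) 1 1; vec3 (2 ^+ 2) 2 1; vec3 (3 ^+ 2) 3 1; vec3 (4 ^+ 2) 4 1].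
Proof.
have f5 := five0 char5.
have e9 : 3 ^+ 2 = 4 :> k by rewrite -[RHS]addr0 -f5; ring.
have e16 : 4 ^+ 2 = 1 :> k by rewrite -[RHS]addr0 -(mulr0 3) -f5; ring.
have e4 : 2 ^+ 2 = 4 :> k by ring.
have E a b c : (a < 5)%N -> (b < 5)%N -> (c < 5)%N -> evv (ve a b c) = vec3 a%:R b%:R c%:R.
  by move=> a5 b5 c5; rewrite /ve evvE /fe !modn_small // !divn_small // !ev_nat.
by rewrite -[RHS]/[:: _; _; _; _; _; _] !map_cons !E // e9 e16 e4 expr0n expr1n.
Qed.

Lemma Q0_idx : tt_conics Q0 -> has_idx Q0 conic0.
Proof.
move=> tQ; split=> // P; rewrite (Cset_Gamma char5 _ M0_frame).
have key : (P = <[vec3 1 0 0 *m evm M0]>%VS \/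
    exists2 r, r \in [:: 0; 1; 2; 3; 4] & P = <[vec3 (r ^+ 2) r 1 *m evm M0]>%VS) <->
    exists2 v, v \in [seq evv v | v <- params] & P = <[v *m evm M0]>%VS.
  rewrite params_map; split=> [[->|[r hr ->]]|[v hv ->]].
  - by exists (vec3 1 0 0); rewrite // inE eqxx.
  - exists (vec3 (r ^+ 2) r 1) => //; rewrite inE; apply/orP; right.
    by move: hr; rewrite !inE => /or4P[/eqP->|/eqP->|/eqP->|/orP[]/eqP->]; rewrite eqxx ?orbT.
  move: hv; rewrite inE => /orP[/eqP ->|]; first by left.
  move=> hv; right; move: hv; rewrite !inE => /or4P[/eqP->|/eqP->|/eqP->|/orP[]/eqP->].
  - by exists 0; rewrite // !inE eqxx ?orbT.
  - by exists 1; rewrite // !inE eqxx ?orbT.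
  - by exists 2; rewrite // !inE eqxx ?orbT.
  - by exists 3; rewrite // !inE eqxx ?orbT.
  - by exists 4; rewrite // !inE eqxx ?orbT.
rewrite key -six_points_conic0.
have mem_s n : (n \in sort leq six_points) = (n \in six_points) by rewrite mem_sort.
have := six_points_ok; rewrite all2E => /andP[/eqP sz /allP z0].
have z x : x \in zip params six_points -> <[evv x.1 *m evm M0]>%VS = pt x.2.
  by move=> /z0 /scaled_pointP [_ <-]; rewrite (evv_mul char5 r2E).
split=> [[_ /mapP [v hv ->] ->]|[n]].
  have hi : (index v params < size six_points)%N by rewrite -sz index_mem.
  exists (nth 0%N six_points (index v params)); first by rewrite mem_s mem_nth.
  apply: (z (v, nth 0%N six_points (index v params))).
  rewrite -{1}(nth_index (vzero : vec) hv) -nth_zip // mem_nth // size_zip sz minnn //.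
rewrite mem_s => hn ->.
have hi : (index n six_points < size params)%N by rewrite sz index_mem.
exists (evv (nth vzero params (index n six_points))); first exact/map_f/mem_nth.
apply/esym/(z (nth vzero params (index n six_points), n)).
rewrite -{2}(nth_index 0%N hn) -nth_zip // mem_nth // size_zip sz minnn //.
Qed.
End ConicLists.

Section ConicSets.
Variable k : closedFieldType.
Hypothesis char5 : 5%N \in [pchar k].
Variable r2 : k.
Hypothesis r2E : r2 ^+ 2 = 2.
Local Notation evm := (evm r2).
Local Notation pt := (pt r2).
Local Notation has_idx := (has_idx r2).
Implicit Types (Q : set (subsp k)) (l : seq nat) (L : seq (seq nat)) (w : seq nat).

Definition letters w : bool := all (fun g => g < 3)%N w.
Definition mw w : 'M[k]_3 := foldl (fun M g => M *m evm (gen g)) 1%:M w.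

Lemma mw_rcons w g : mw (rcons w g) = mw w *m evm (gen g).
Proof. by rewrite /mw foldl_rcons. Qed.

Lemma mw_unitary w : letters w -> unitary (mw w).
Proof.
elim/last_ind: w => [_|w g IH]; first exact: unitary1.
rewrite /letters all_rcons => /andP[hg /IH hw]; rewrite mw_rcons.
exact: (unitaryM char5 hw (gen_unitary char5 r2E hg)).
Qed.

Lemma pact_lt g n : (g < 3)%N -> (n < 126)%N -> (pact g n < 126)%N.
Proof. by move=> hg hn; have [] := gen_pt char5 r2E hg hn. Qed.

Lemma gen_ptE g n : (g < 3)%N -> (n < 126)%N -> (lm (evm (gen g)) @: pt n)%VS = pt (pact g n).
Proof. by move=> hg hn; have [] := gen_pt char5 r2E hg hn. Qed.

Lemma cactE g l : cact g l = sort leq (map (pact g) l).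
Proof. by []. Qed.

Lemma cact_good g l : (g < 3)%N -> good l -> good (cact g l).
Proof.
move=> hg gl; have ul := good_uniq gl; move: (gl) => /and3P[_ _ /eqP sl].
have uU := unitary_unit (gen_unitary char5 r2E hg).
have um : uniq (map (pact g) l).
  rewrite map_inj_in_uniq // => n m nl ml e.
  apply: (pt_inj char5 r2E (good_lt gl nl) (good_lt gl ml)).
  apply: (act_inj (lker_lm uU)) => /=.
  by rewrite !gen_ptE ?(good_lt gl nl) ?(good_lt gl ml) // e.
apply/and3P; split; rewrite cactE.
- by rewrite ltn_sorted_uniq_leq sort_uniq um sort_sorted //; exact: leq_total.
- by rewrite all_sort all_map; apply/allP => n nl /=; rewrite pact_lt // (good_lt gl nl).
by rewrite size_sort size_map sl.
Qed.

Lemma has_idx_act g Q l : (g < 3)%N -> has_idx Q l ->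
  has_idx (act (lm (evm (gen g))) Q) (cact g l).
Proof.
move=> hg [tQ gl hl]; have hU := gen_unitary char5 r2E hg.
have kU := lker_lm (unitary_unit hU); split.
- exact: tt_conics_act.
- exact: cact_good.
move=> P; rewrite -(act_Gamma char5 hU) -actI //; split.
  move=> [P' /hl [n nl ->] <-]; exists (pact g n).
    by rewrite cactE mem_sort map_f.
  by rewrite gen_ptE ?(good_lt gl nl).
move=> [m]; rewrite cactE mem_sort => /mapP [n nl ->] ->.
exists (pt n); first by apply/hl; exists n.
by rewrite gen_ptE ?(good_lt gl nl).
Qed.

Lemma act_mw_rcons w g Q : act (lm (mw (rcons w g))) Q = act (lm (evm (gen g))) (act (lm (mw w)) Q).
Proof. by rewrite mw_rcons lm_act. Qed.

Lemma cactw_rcons w g l : cactw (rcons w g) l = cact g (cactw w l).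
Proof. by rewrite /cactw foldl_rcons. Qed.

Lemma has_idx_word w Q l : letters w -> has_idx Q l -> has_idx (act (lm (mw w)) Q) (cactw w l).
Proof.
move=> hw hQ; elim/last_ind: w hw => [_|w g IH]; first by rewrite /mw /= lm1 act1.
rewrite /letters all_rcons => /andP[hg /IH hw]; rewrite act_mw_rcons cactw_rcons.
exact: has_idx_act.
Qed.

Lemma mw_cat w w' : mw (w ++ w') = mw w *m mw w'.
Proof.
elim/last_ind: w' => [|w' g IH]; first by rewrite cats0 mulmx1.
by rewrite -rcons_cat !mw_rcons IH mulmxA.
Qed.

Definition CS L : set (set (subsp k)) := [set Q | exists2 l, l \in L & has_idx Q l].
(** Counting lists counts conics only when every list is the contact set of a conic. This property
    starts at [D0L] and is propagated along words. *)
Definition real l : Prop := exists Q, has_idx Q l.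
Definition reals L : Prop := forall l, l \in L -> real l.

Lemma reals_act g L : (g < 3)%N -> reals L -> reals (map (cact g) L).
Proof. by move=> hg hL _ /mapP [l /hL [Q hQ] ->]; exists (act (lm (evm (gen g))) Q); apply: has_idx_act. Qed.

Lemma CS_act g L : (g < 3)%N -> reals L -> actD (evm (gen g)) (CS L) = CS (map (cact g) L).
Proof.
move=> hg hL; apply/seteqP; split=> [_ [Q [l lL hQ] <-]|Q [_ /mapP [l lL ->] hQ]].
  by exists (cact g l); [exact: map_f|exact: has_idx_act].
have [Q1 hQ1] := hL l lL; exists Q1; first by exists l.
exact: has_idx_inj (has_idx_act hg hQ1) hQ.
Qed.

Lemma CS_word w L : letters w -> reals L ->
  reals (foldl cact2 L w) /\ actD (mw w) (CS L) = CS (foldl cact2 L w).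
Proof.
move=> hw hL; elim/last_ind: w hw => [_|w g IH]; first by rewrite /mw /= actD1.
rewrite /letters all_rcons => /andP[hg /IH [h1 h2]]; rewrite foldl_rcons; split.
  exact: reals_act.
by rewrite mw_rcons -actDM h2 CS_act.
Qed.

Lemma CS_card L : uniq L -> reals L -> (CS L #= `I_(size L))%card.
Proof.
move=> uL hL; pose R l := xget set0 [set Q | has_idx Q l].
have RP l : l \in L -> has_idx (R l) l.
  by move=> /hL hl; apply: (@xgetPex _ set0 [set Q | has_idx Q l]).
apply/card_seqP; exists (map R L); split.
- by rewrite map_inj_in_uniq // => l l' /RP h /RP h' e; apply: (has_idx_fun char5 r2E h); rewrite e.
- by rewrite size_map.
apply/seteqP; split=> [Q [l lL hQ]|Q /= /mapP [l lL ->]].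
  by apply/mapP; exists l => //; apply: has_idx_inj hQ (RP l lL).
by exists l => //; apply: RP.
Qed.

Lemma common_card Q Q' l l' n : has_idx Q l -> has_idx Q' l' ->
  (Q `&` Q' `&` @Gamma k #= `I_n)%card = (common l l' == n).
Proof.
move=> hQ hQ'; have [_ gl hl] := hQ; have [_ gl' hl'] := hQ'.
have c : (Q `&` Q' `&` @Gamma k #= `I_(common l l'))%card.
  apply/card_seqP; exists (map pt (filter (mem l) l')); split.
  - rewrite map_inj_in_uniq ?filter_uniq ?good_uniq // => a b.
    rewrite !mem_filter => /andP[_ al] /andP[_ bl]; apply: (pt_inj char5 r2E);
      [exact: good_lt al|exact: good_lt bl].
  - by rewrite size_map size_filter.
  apply/seteqP; split=> [P [[QP Q'P] GP]|P /= /mapP [n']].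
    have [a al PE] := (hl P).1 (conj QP GP); have [b bl PE'] := (hl' P).1 (conj Q'P GP).
    have ab : a = b.
      by apply: (pt_inj char5 r2E (good_lt gl al) (good_lt gl' bl)); rewrite -PE -PE'.
    by apply/mapP; exists b => //; rewrite mem_filter bl -ab inE al.
  rewrite mem_filter => /andP[/= nl nl'] ->.
  have [h1 h2] : (Q `&` @Gamma k) (pt n') by apply/hl; exists n'.
  have [h3 _] : (Q' `&` @Gamma k) (pt n') by apply/hl'; exists n'.
  by [].
apply/idP/eqP => [h|<-//].
by apply/card_eq_II/(card_eq_trans _ h); rewrite card_eq_sym.
Qed.

Lemma meeting_CS Q l L n : has_idx Q l ->
  meeting Q (CS L) n = CS [seq l' <- L | common l l' == n].
Proof.
move=> hQ; apply/seteqP; split=> [Q' [[l' lL hQ']]|Q' [l']].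
  by rewrite (common_card _ hQ hQ') => h; exists l'; rewrite // mem_filter h.
rewrite mem_filter => /andP[h lL] hQ'; split; first by exists l'.
by rewrite (common_card _ hQ hQ').
Qed.

Lemma CS_filter_card L (p : pred (seq nat)) n : uniq L -> reals L ->
  count p L = n -> (CS (filter p L) #= `I_n)%card.
Proof.
move=> uL hL <-; rewrite -size_filter; apply: CS_card; first exact: filter_uniq.
by move=> l; rewrite mem_filter => /andP[_ /hL].
Qed.

Definition tcount t : seq nat -> seq (seq nat) -> bool :=
  match t with alpha => talpha | beta => tbeta | gamma => tgamma end.

Lemma t_is_CS Q l L t : uniq L -> reals L -> has_idx Q l -> t_is Q (CS L) t <-> tcount t l L.
Proof.
move=> uL hL hQ.
have H n m : (meeting Q (CS L) n #= `I_m)%card = (meet_count l L n == m).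
  have c : (meeting Q (CS L) n #= `I_(meet_count l L n))%card.
    by rewrite (meeting_CS _ _ hQ); apply: CS_filter_card.
  apply/idP/eqP => [h|<-//].
  by apply/card_eq_II/(card_eq_trans _ h); rewrite card_eq_sym.
case: t; rewrite /t_is !H /=; split.
- by move=> [h1 h2]; apply/andP.
- by move=> /andP.
- by move=> [h1 h2 h3]; apply/and3P.
- by move=> /and3P.
- by move=> [h1 h2]; apply/andP.
by move=> /andP.
Qed.

Lemma of_t_CS L L' t n : uniq L -> reals L -> uniq L' -> reals L' ->
  count (tcount t ^~ L') L = n -> (of_t (CS L) (CS L') t #= `I_n)%card.
Proof.
move=> uL hL uL' hL' cn.
have -> : of_t (CS L) (CS L') t = CS [seq l <- L | tcount t l L'].
  apply/seteqP; split=> [Q [[l lL hQ]]|Q [l]].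
    by move=> /(t_is_CS _ uL' hL' hQ) h; exists l; rewrite // mem_filter h.
  rewrite mem_filter => /andP[h lL] hQ; split; first by exists l.
  exact/(t_is_CS _ uL' hL' hQ).
exact: CS_filter_card.
Qed.

Lemma all_t_CS L L' t : uniq L' -> reals L' ->
  all (tcount t ^~ L') L -> forall Q, CS L Q -> t_is Q (CS L') t.
Proof. by move=> uL' hL' /allP h Q [l /h hl hQ]; apply/(t_is_CS _ uL' hL' hQ). Qed.
End ConicSets.

(** * The adjacency of the base conic and one neighbour *)

Section Adjacency.
Variable k : closedFieldType.
Hypothesis char5 : 5%N \in [pchar k].
Variable r2 : k.
Hypothesis r2E : r2 ^+ 2 = 2.
Local Notation ev := (ev r2).
Local Notation evv := (evv r2).
Local Notation evm := (evm r2).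
Local Notation pt := (pt r2).
Local Notation has_idx := (has_idx r2).
Local Notation Q0 := (Q0 r2).
Local Notation mw := (mw r2).
Implicit Types (Q : set (subsp k)) (l : seq nat).

Lemma evm_row (A : mat) v : evv v *m evm A = evv (vmul v A).
Proof. by rewrite (evv_mul char5 r2E). Qed.

Lemma evm_mul A B : evm (mmul A B) = evm A *m evm B.
Proof.
apply/row_matrixP => i; rewrite row_mul; case: A => [[a b] c].
have [r0 r1 r2'] := row_mat3 (evv a) (evv b) (evv c).
have [s0 s1 s2] := row_mat3 (evv (vmul a B)) (evv (vmul b B)) (evv (vmul c B)).
by case: (ord3P i) => ->; rewrite /= ?s0 ?s1 ?s2 ?r0 ?r1 ?r2' evm_row.
Qed.

Lemma evm_id : evm mid = 1%:M.
Proof.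
have [u0 u1 u2] := evv_units r2; rewrite /mid evmE u0 u1 u2.
apply/matrixP => i j; rewrite mxE.
by case: (ord3P i) => ->; case: (ord3P j) => ->; rewrite !mxE.
Qed.

Lemma evm_wmat w : evm (wmat w) = mw w.
Proof.
elim/last_ind: w => [|w g IH]; first exact: evm_id.
by rewrite /wmat foldl_rcons evm_mul -/(wmat w) IH mw_rcons.
Qed.

Definition Q1 := act (lm (mw w1)) Q0.

Lemma Q1_idx : tt_conics Q0 -> has_idx Q1 conic1.
Proof.
move=> tQ; exact: (has_idx_word char5 r2E (w := w1) isT (Q0_idx char5 r2E tQ)).
Qed.

Lemma N1_mx : evm M0 *m mw w1 *m invmx (evm M0) = evm N1.
Proof.
have uM := frame_unit char5 (M0_frame char5 r2E).
rewrite -N1E evm_mul (evm_mul M0) evm_wmat; congr (_ *m _).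
rewrite -[RHS]mul1mx -(mulVmx uM) -mulmxA -evm_mul M0iE evm_id mulmx1 //.
Qed.

Definition quartic_at (cs : seq F25) (s : k) : k :=
  \sum_(i < 5) ev (nth (0, 0)%N cs i) * s ^+ (4 - i).

Lemma ev4 : ev (4, 0)%N = -1.
Proof.
rewrite ev_nat; have -> : 4 = 5 - 1 :> k by ring.
by rewrite (five0 char5) sub0r.
Qed.

Lemma ev2 : ev (2, 0)%N = 2.
Proof. exact: ev_nat. Qed.

Lemma quartic_coefsE A s : let y := vec3 (s ^+ 2) s 1 *m evm A in
  y 0 i1 ^+ 2 - y 0 i0 * y 0 i2 = quartic_at (quartic_coefs A) s.
Proof.
case: A => [[[[a0 a1] a2] [[b0 b1] b2]] [[c0 c1] c2]] /=.
rewrite !mul_mat3 !vec3E /quartic_at !big_ord_recl big_ord0 /=.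
rewrite !(mxE, vec3E) /= !(evD char5, evM char5 r2E, ev4, ev2).
rewrite /bump /= !subSS !subn0; ring.
Qed.

Lemma quartic_infE A : let y := vec3 1 0 0 *m evm A in
  y 0 i1 ^+ 2 - y 0 i0 * y 0 i2 = ev (head (0, 0)%N (quartic_coefs A)).
Proof.
case: A => [[[[a0 a1] a2] [[b0 b1] b2]] [[c0 c1] c2]] /=.
rewrite !mul_mat3 !vec3E !(mxE, vec3E) /= !(evD char5, evM char5 r2E, ev4); ring.
Qed.

Lemma elem_symE a b d e c s : quartic_at (elem_sym [:: a; b; d; e] c) s =
  ev c * ((s - ev a) * ((s - ev b) * ((s - ev d) * (s - ev e)))).
Proof.
rewrite /quartic_at !big_ord_recl big_ord0 /= !(evD char5, evM char5 r2E, ev4).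
rewrite /bump /= !subSS !subn0; ring.
Qed.

(** In the coordinates of [M0], Q1 is parametrized by (s^2, s, 1) [N1], and substitution into the
    equation of Q0 gives the quartic with roots [roots1]. *)
Lemma Q01_points P : (Q0 `&` Q1) P <->
  exists2 s, s \in map ev roots1 & P = <[vec3 (s ^+ 2) s 1 *m (evm M0 *m mw w1)]>%VS.
Proof.
have uM := frame_unit char5 (M0_frame char5 r2E).
have uW : mw w1 \in unitmx by apply: unitary_unit; apply: (mw_unitary char5 r2E (w := w1) isT).
have uMW : evm M0 *m mw w1 \in unitmx by rewrite unitmx_mul uM.
have onQ0 (x : 'rV[k]_3) : x != 0 -> Q0 <[x *m (evm M0 *m mw w1)]>%VS <->
    (x *m evm N1) 0 i1 ^+ 2 = (x *m evm N1) 0 i0 * (x *m evm N1) 0 i2.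
  move=> x0; have E : x *m (evm M0 *m mw w1) = x *m evm N1 *m evm M0.
    by rewrite -N1_mx !mulmxA mulmxKV.
  have y0 : x *m evm N1 != 0.
    by apply: contraNneq x0 => e; rewrite -(mulmxK uMW x) E e !mul0mx.
  rewrite E; split; last by move=> h; exists (x *m evm N1).
  move=> [y [yn0 yE /line_eqP]]; case.
    by apply: contraNneq y0 => e; rewrite -(mulmxK uM (x *m _)) e mul0mx.
  move=> c c0; rewrite scalemxAl => /(can_inj (mulmxK uM)) ->.
  by rewrite !(mxE _ _ 0) exprMn yE; ring.
have onQ1 : Q1 = Cset (evm M0 *m mw w1) by rewrite /Q1 act_Cset.
pose c := head (0, 0)%N (quartic_coefs N1).
have c0 : ev c != 0.
  by apply/negP => /eqP /(ev_eq0 char5 r2E (isT : c \in F25s)).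
have fE s : quartic_at (quartic_coefs N1) s = 0 <-> s \in map ev roots1.
  rewrite quartic1 elem_symE -/c; split.
    move=> /eqP; rewrite mulf_eq0 (negbTE c0) /= !mulf_eq0 !subr_eq0 => h.
    by rewrite /roots1 /= !inE.
  rewrite /roots1 /= !inE => h; apply/eqP.
  by rewrite mulf_eq0 (negbTE c0) /= !mulf_eq0 !subr_eq0.
split.
  move=> [h0]; rewrite onQ1 => -[x [x0 xE PE]]; rewrite PE in h0 *.
  (* The parameter at infinity is excluded because the leading coefficient c of the quartic is
     nonzero. *)
  have [x20|x2] := eqVneq (x 0 i2) 0.
    move/eqP: xE; rewrite x20 mulr0 expf_eq0 /= => /eqP x10.
    have xV : x = x 0 i0 *: vec3 1 0 0 by rewrite vec3Z mulr1 !mulr0 {1}(vec3_eta x) x10 x20.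
    have x00 : x 0 i0 != 0.
      by apply: contraNneq x0 => x00; rewrite (vec3_eta x) x00 x10 x20 vec3_eq0 eqxx.
    move: h0; rewrite xV -scalemxAl line_scale // => /onQ0.
    rewrite vec3_eq0 oner_eq0 => /(_ isT) h; case/eqP: c0.
    by rewrite /c -quartic_infE /= h subrr.
  pose s := x 0 i1 / x 0 i2.
  have xV : x = x 0 i2 *: vec3 (s ^+ 2) s 1.
    rewrite vec3Z [LHS]vec3_eta; congr vec3; last by rewrite mulr1.
      by rewrite /s expr_div_n xE -mulf_div divff // mulr1 mulrC divfK.
    by rewrite /s mulrC divfK.
  exists s; last by rewrite xV -scalemxAl line_scale.
  move: h0; rewrite xV -scalemxAl line_scale // => /onQ0.
  rewrite vec3_eq0 oner_eq0 !andbF => /(_ isT) h.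
  by apply/fE; rewrite -quartic_coefsE /= h subrr.
move=> [s /fE hs ->].
have v0 : vec3 (s ^+ 2) s 1 != 0 by rewrite vec3_eq0 oner_eq0 !andbF.
split; last first.
  by rewrite onQ1; exists (vec3 (s ^+ 2) s 1); rewrite !vec3E mulr1.
apply/onQ0 => //; apply/eqP; rewrite -subr_eq0; apply/eqP.
by rewrite -hs -quartic_coefsE.
Qed.

Lemma Q01_card : (Q0 `&` Q1 #= `I_4)%card.
Proof.
have uM := frame_unit char5 (M0_frame char5 r2E).
have uW : mw w1 \in unitmx by apply: unitary_unit; apply: (mw_unitary char5 r2E (w := w1) isT).
have uMW : evm M0 *m mw w1 \in unitmx by rewrite unitmx_mul uM.
pose f s := <[vec3 (s ^+ 2) s 1 *m (evm M0 *m mw w1)]>%VS.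
have f_inj : injective f.
  move=> s t /line_eqP; case.
    apply/eqP => e; have : vec3 (s ^+ 2) s 1 = 0 by rewrite -(mulmxK uMW (vec3 _ _ _)) e mul0mx.
    by move=> /eqP; rewrite vec3_eq0 oner_eq0 !andbF.
  move=> c _; rewrite scalemxAl => /(can_inj (mulmxK uMW)); rewrite vec3Z => /rowP e.
  have := e i2; have := e i1; rewrite !vec3E mulr1 => -> <-.
  by rewrite mul1r.
apply/card_seqP; exists (map f (map ev roots1)); split=> //.
  rewrite map_inj_uniq // map_inj_in_uniq // => x y hx hy.
  have sub : {subset roots1 <= F25s} by apply/allP.
  by apply: (ev_inj char5 r2E); apply: sub.
apply/seteqP; split=> [P /Q01_points [s hs ->]|P hP].
  have : f s \in map f (map ev roots1) by apply: map_f.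
  by [].
have /mapP [s hs ->] : P \in map f (map ev roots1) by exact: hP.
by apply/Q01_points; exists s.
Qed.

Lemma pt_dim n : (n < 126)%N -> \dim (pt n) = 1%N.
Proof. by move=> hn; rewrite dim_vline evv_neq0 //; case: (nth_points hn). Qed.

Lemma line_dim i j : (i < 126)%N -> (j < 126)%N -> i <> j -> \dim (pt i + pt j) = 2%N.
Proof.
move=> hi hj ne; apply/eqP; rewrite eqn_leq; apply/andP; split.
  by apply: leq_trans (dimv_add_leqif _ _) _; rewrite !pt_dim.
rewrite ltnNge; apply/negP => d1; apply: ne; apply: (pt_inj char5 r2E) => //.
have e1 : pt i = (pt i + pt j)%VS by apply/eqP; rewrite eqEdim addvSl pt_dim.
have e2 : pt j = (pt i + pt j)%VS by apply/eqP; rewrite eqEdim addvSr pt_dim.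
by rewrite e1 -e2.
Qed.

Lemma pt_rational n : (n < 126)%N -> rational_pts (pt n).
Proof.
move=> hn; split; first exact: pt_Gamma.
exists (evv (nth vzero points n)) => // i.
have [/lines25_red + _] := nth_points hn.
case: (nth _ _ _) => [[x y] z] /and3P[hx hy hz].
by case: (ord3P i) => ->; rewrite vec3E (ev_fixed char5 r2E).
Qed.

Lemma secantsP Q l L : has_idx Q l ->
  secants Q L <-> exists2 ij, ij \in pairs l & L = (pt ij.1 + pt ij.2)%VS.
Proof.
move=> [_ gl hl]; split.
  move=> [[dL _] [A [B [/hl [i il ->] /hl [j jl ->] ne iL jL]]]].
  have ij : i <> j by move=> e; apply: ne; rewrite e.
  have LE : L = (pt i + pt j)%VS.
    by apply/esym/eqP; rewrite eqEdim subv_add iL jL dL (line_dim (good_lt gl il) (good_lt gl jl) ij).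
  have [lt|gt|e] := ltngtP i j; last by case: ij.
    by exists (i, j) => //; rewrite mem_filter lt; apply/allpairsP; exists (i, j).
  exists (j, i); last by rewrite LE addvC.
  by rewrite mem_filter gt; apply/allpairsP; exists (j, i).
move=> [[i j]]; rewrite mem_filter => /andP[/= lt /allpairsP [[i' j'] [/= il jl [ei ej]]]] ->.
subst i' j'; have ij : i <> j by move=> e; rewrite e ltnn in lt.
have hi := good_lt gl il; have hj := good_lt gl jl.
have ne : pt i <> pt j by move/(pt_inj char5 r2E hi hj).
split; [split|]; first exact: line_dim.
  by exists (pt i), (pt j); rewrite addvSl addvSr; split=> //; apply: pt_rational.
exists (pt i), (pt j); rewrite addvSl addvSr; split=> //; apply/hl; first by exists i.
by exists j.
Qed.

Definition dotk (n v : 'rV[k]_3) : k := \sum_i n 0 i * v 0 i.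

Lemma ev_dot n v : ev (vdot n v) = dotk (evv n) (evv v).
Proof.
case: n => [[x y] z]; case: v => [[x' y'] z'].
by rewrite /dotk sum3 !vec3E /= !(evD char5) !(evM char5 r2E).
Qed.

Lemma dot_line n i j a : (i < 126)%N -> (j < 126)%N -> (a < 126)%N ->
  on_line n i -> on_line n j -> (pt a <= pt i + pt j)%VS -> on_line n a.
Proof.
move=> hi hj ha /eqP ni /eqP nj /= h.
have : evv (nth vzero points a) \in (pt i + pt j)%VS.
  by apply: subvP h _ _; exact: memv_line.
move=> /memv_addP [_ /vlineP [x ->] [_ /vlineP [y ->] e]].
have dotD (u v w : 'rV[k]_3) : dotk u (v + w) = dotk u v + dotk u w.
  by rewrite /dotk -big_split; apply: eq_bigr => m _; rewrite mxE mulrDr.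
have dotZ (u v : 'rV[k]_3) c : dotk u (c *: v) = c * dotk u v.
  by rewrite /dotk mulr_sumr; apply: eq_bigr => m _; rewrite mxE mulrCA.
have red0 v w : vdot v w \in F25s.
  have fred x1 x2 : fadd x1 x2 \in F25s.
    by apply/allpairsP; exists (fadd x1 x2); split=> //; rewrite mem_iota ltn_mod.
  by case: v => [[? ?] ?]; case: w => [[? ?] ?]; apply: fred.
apply/eqP/(ev_eq0 char5 r2E (red0 _ _)).
by rewrite ev_dot e dotD !dotZ -!ev_dot ni nj ev0 !mulr0 addr0.
Qed.

Lemma in_spanP i j a : in_span (i, j) a -> (pt a <= pt i + pt j)%VS.
Proof.
move=> /hasP [x _ /hasP [y _ /eqP e]].
rewrite -memvE -e (evv_add char5) !(evv_scale char5 r2E).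
by apply: memv_add; apply: memvZ; exact: memv_line.
Qed.

Lemma pairs_lt l i j : good l -> (i, j) \in pairs l -> [/\ (i < 126)%N, (j < 126)%N & i <> j].
Proof.
move=> gl; rewrite mem_filter => /andP[/= lt /allpairsP [[a b] [/= al bl [ei ej]]]].
subst a b; split; [exact: good_lt al|exact: good_lt bl|].
by move=> e; rewrite e ltnn in lt.
Qed.

Lemma Q01_secants : tt_conics Q0 -> (secants Q0 `&` secants Q1 #= `I_3)%card.
Proof.
move=> tQ; have h0 := Q0_idx char5 r2E tQ; have h1 := Q1_idx tQ.
have [_ g0 _] := h0; have [_ g1 _] := h1.
pose ln ij := (pt ij.1 + pt ij.2)%VS.
have inl ij a : ij \in pairs conic0 -> (a < 126)%N -> (pt a <= ln ij)%VS -> on_line (normal_vec ij) a.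
  case: ij => i j hij ha; have [hi hj _] := pairs_lt g0 hij.
  have /and3P[n1 n2 _] := allP secants01_lines _ hij.
  exact: dot_line.
have sub01 ij : ij \in secants01 -> ij \in pairs conic0.
  by move=> h; have /andP[] := allP secants01_distinct _ h.
apply/card_seqP; exists (map ln secants01); split=> //.
  rewrite map_inj_in_uniq // => x y hx hy e; apply/eqP.
  have /andP[_ /allP /(_ y hy) /orP[//|/negP[]]] := allP secants01_distinct _ hx.
  have [y1 y2 _] : [/\ (y.1 < 126)%N, (y.2 < 126)%N & y.1 <> y.2].
    by apply: (pairs_lt g0); rewrite -surjective_pairing sub01.
  by apply/andP; split; apply: (inl _ _ (sub01 _ hx)) => //; rewrite e ?addvSl ?addvSr.
apply/seteqP; split=> [L [/(secantsP _ h0) [ij hij ->] /(secantsP _ h1) [ab hab e]]|L hL].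
  suff : ln ij \in map ln secants01 by [].
  apply: map_f; have /and3P[_ _ /allP /(_ ab hab) /implyP] := allP secants01_lines _ hij; apply.
  have [a1 a2 _] : [/\ (ab.1 < 126)%N, (ab.2 < 126)%N & ab.1 <> ab.2].
    by apply: (pairs_lt g1); rewrite -surjective_pairing.
  by rewrite !(inl _ _ hij) // /ln e ?addvSl ?addvSr.
have /mapP [ij hij ->] : L \in map ln secants01 by exact: hL.
split; first by apply/(secantsP _ h0); exists ij => //; apply: sub01.
apply/(secantsP _ h1); have /hasP [ab hab /andP[s1 s2]] := allP secants01_common _ hij.
exists ab => //; case: ij hij s1 s2 => i j hij s1 s2; case: ab hab s1 s2 => a b hab /= s1 s2.
have [hi hj nij] := pairs_lt g0 (sub01 _ hij); have [ha hb nab] := pairs_lt g1 hab.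
apply/esym/eqP; rewrite eqEdim subv_add !in_spanP //=.
by rewrite (line_dim hi hj nij) (line_dim ha hb nab).
Qed.

Lemma Q01_adj : tt_conics Q0 -> adj Q0 Q1.
Proof.
move=> tQ; have h0 := Q0_idx char5 r2E tQ; have h1 := Q1_idx tQ; have [tQ1 _ _] := h1.
split=> //; [|exact: Q01_card|exact: Q01_secants].
by move=> e; have := has_idx_fun char5 r2E h0; rewrite e => /(_ _ h1).
Qed.
End Adjacency.

Lemma card_subset_eq (T : choiceType) (A B : set T) n :
  A `<=` B -> (A #= `I_n)%card -> (B #= `I_n)%card -> A = B.
Proof.
move=> AB /card_seqP [s [us ss AE]] /card_seqP [t [ut st BE]].
have sub : {subset s <= t}.
  by move=> x xs; have : [set` t] x by rewrite -BE; apply: AB; rewrite AE.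
have [|_ e] := uniq_min_size us sub; first by rewrite ss st.
by rewrite AE BE; apply/seteqP; split=> x /=; rewrite e.
Qed.

Lemma card_pairs7 : ([set A : {set 'I_7} | #|A| = 2%N] #= `I_21)%card.
Proof.
apply/card_seqP; exists (enum [set A : {set 'I_7} | #|A| == 2%N]%SET); split.
- exact: enum_uniq.
- by rewrite -cardE card_draws card_ord.
by apply/seteqP; split=> A /=; rewrite mem_enum inE => /eqP.
Qed.

Lemma T7_iso_card (k : fieldType) (D : set (set (subsp k))) phi : T7_iso D phi -> (D #= `I_21)%card.
Proof.
move=> [[p1 p2 p3] _]; apply: card_eq_trans card_pairs7; rewrite card_eq_sym.
have <- : [set phi Q | Q in D] = [set A : {set 'I_7} | #|A| = 2%N].
  by apply/seteqP; split=> [_ [Q DQ <-]|A /p3 //]; exact: p1.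
exact: inj_card_eq.
Qed.

(** The labelling [phi] composed with the inverse of [phi0] is an automorphism of T(7), hence
    induced by a permutation of the labels. *)
Lemma T7_iso_unique (k : fieldType) (D : set (set (subsp k))) phi phi0 :
  T7_iso D phi -> T7_iso D phi0 ->
  exists s : 'S_7, forall Q, D Q -> phi Q = [set s i | i in phi0 Q]%SET.
Proof.
move=> [[p1 p2 p3] padj] [[q1 q2 q3] qadj].
pose g A := xget set0 [set Q | D Q /\ phi0 Q = A].
have gP (A : {set 'I_7}) : #|A| = 2%N -> D (g A) /\ phi0 (g A) = A.
  by move=> /q3 [Q DQ QA]; apply: (@xgetPex _ set0 [set Q | D Q /\ phi0 Q = A]); exists Q.
have [] := @triangular_aut (fun A => phi (g A)).
- by move=> A /gP [DA _]; apply: p1.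
- move=> A B /gP [DA AE] /gP [DB BE] e; rewrite -AE -BE; congr phi0.
  by apply: p2; rewrite ?in_setE.
- move=> A B /gP [DA AE] /gP [DB BE].
  by rewrite -(padj _ _ DA DB) (qadj _ _ DA DB) AE BE.
move=> s hs; exists s => Q DQ.
have c2 := q1 Q DQ; have [DQ' e] := gP _ c2; rewrite -hs //.
by congr phi; apply: q2; rewrite ?in_setE.
Qed.

Section Component.
Variable k : closedFieldType.
Hypothesis char5 : 5%N \in [pchar k].
Variable r2 : k.
Hypothesis r2E : r2 ^+ 2 = 2.
Local Notation has_idx := (has_idx r2).
Local Notation Q0 := (Q0 r2).
Local Notation Q1 := (Q1 r2).
Local Notation mw := (mw r2).
Local Notation CS := (CS r2).
Hypothesis tQ0 : tt_conics Q0.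
Implicit Types (Q : set (subsp k)) (l : seq nat).

Let h0 := Q0_idx char5 r2E tQ0.

Lemma letters01_letters w : letters01 w -> letters w.
Proof. by apply: sub_all => g /leq_trans -> //. Qed.

Definition conicw w : set (subsp k) := act (lm (mw w)) Q0.

Lemma D0st_idx x : x \in D0st -> has_idx (conicw x.1) x.2.1.
Proof.
move=> /(allP D0st_words) /and4P[/letters01_letters hw /eqP <- _ _].
exact: has_idx_word.
Qed.

Lemma D0L_mem l : l \in D0L -> exists2 x, x \in D0st & l = x.2.1.
Proof. by move=> /mapP. Qed.

Lemma D0L_reals : reals r2 D0L.
Proof. by move=> l /D0L_mem [x hx ->]; exists (conicw x.1); apply: D0st_idx. Qed.

Lemma D0nb_sub x : x \in D0nb -> x \in D0st.
Proof. by rewrite D0nbE mem_filter => /andP[]. Qed.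

Lemma nb_adj x : x \in D0nb -> adj Q0 (conicw x.1).
Proof.
move=> hx; have /hasP [u _ /and3P[/letters01_letters hu /eqP u0 /eqP u1]] := allP D0nb_stab x hx.
have hU := mw_unitary char5 r2E hu.
have := adj_act char5 hU (Q01_adj char5 r2E tQ0).
have -> : act (lm (mw u)) Q0 = Q0.
  by have := has_idx_word char5 r2E hu h0; rewrite u0 => h; exact: (has_idx_inj char5 h h0).
have -> // : act (lm (mw u)) Q1 = conicw x.1.
apply: (has_idx_inj char5 (l := x.2.1)); last exact/D0st_idx/D0nb_sub.
by rewrite -u1; apply: has_idx_word => //; apply: Q1_idx.
Qed.

(** A neighbour keeps one of the two labels of A0 and takes the other from the five labels outside,
    which leaves 2 * 5 choices. *)
Lemma pair_neighbours (A0 : {set 'I_7}) : #|A0| = 2%N ->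
  (#|[set A : {set 'I_7} | [&& #|A| == 2%N, A0 != A & A0 :&: A != finset.set0]]%SET| <= 10)%N.
Proof.
move=> c2; set X := [set A | _]%SET.
pose f (p : 'I_7 * 'I_7) := [set p.1; p.2]%SET.
have sub : X \subset (f @: finset.setX A0 (finset.setC A0))%SET.
  apply/fintype.subsetP => A; rewrite inE => /and3P[/eqP cA ne me].
  have [j [x [y [A0E AE jx jy xy]]]] := meeting_pairs c2 cA ne me.
  apply/imsetP; exists (j, y); last by rewrite AE.
  by rewrite inE /= inE A0E !inE eqxx /= negb_or ![y == _]eq_sym jy xy.
apply: leq_trans (subset_leq_card sub) _; apply: leq_trans (leq_imset_card _ _) _.
by rewrite cardsX [X in (_ * X)%N]cardsCs finset.setCK card_ord c2.
Qed.

Variable phi : set (subsp k) -> {set 'I_7}.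
Hypothesis hphi : T7_iso (component Q0) phi.

Lemma nb_all Q : adj Q0 Q -> exists2 x, x \in D0nb & has_idx Q x.2.1.
Proof.
move=> hadj; have [[p1 p2 p3] padj] := hphi.
have D00 : component Q0 Q0 by exact: rt_refl.
have Dadj R : adj Q0 R -> component Q0 R by exact: rt_step.
pose s := [seq phi (conicw x.1) | x <- D0nb].
pose X := [set A : {set 'I_7} | [&& #|A| == 2%N, phi Q0 != A & phi Q0 :&: A != finset.set0]]%SET.
have inX R : adj Q0 R -> phi R \in X.
  move=> h; have DR := Dadj R h; rewrite inE (p1 R DR) eqxx /=.
  by apply/andP/(padj _ _ D00 DR).
have us : uniq s.
  rewrite map_inj_in_uniq => [|x y hx hy e]; first exact: map_uniq D0nb_uniq.
  have e' : conicw x.1 = conicw y.1.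
    by apply: p2 => //; rewrite in_setE; apply/Dadj/nb_adj.
  apply: (uniq_map_inj D0nb_uniq) => //.
  have := D0st_idx (D0nb_sub hy); rewrite -e'.
  exact: (has_idx_fun char5 r2E (D0st_idx (D0nb_sub hx))).
have sub : {subset s <= enum X}.
  by move=> _ /mapP [x hx ->]; rewrite mem_enum; apply/inX/nb_adj.
have [|_ e] := uniq_min_size us sub.
  by rewrite -cardE size_map D0nb_size; apply: pair_neighbours; apply: p1.
have : phi Q \in s by rewrite e mem_enum inX.
move=> /mapP [x hx e']; exists x => //.
have -> : Q = conicw x.1 by apply: p2 => //; rewrite in_setE; apply: Dadj => //; apply: nb_adj.
exact/D0st_idx/D0nb_sub.
Qed.

Lemma adj_D0 x Q Q' : x \in D0st -> has_idx Q x.2.1 ->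
  adj Q Q' <-> exists2 z, z \in D0st /\ lmeet z.2.2 x.2.2 & has_idx Q' z.2.1.
Proof.
move=> hx hQ; have /and4P[/letters01_letters hw /eqP wx _ _] := allP D0st_words _ hx.
have hU := mw_unitary char5 r2E hw; have uU := unitary_unit hU.
have QE : Q = act (lm (mw x.1)) Q0.
  by apply: (has_idx_inj char5 hQ); rewrite -wx; apply: has_idx_word.
rewrite QE; split.
  move=> /(adj_act char5 (unitaryV char5 hU)); rewrite act_lmK // => /nb_all [y hy hy'].
  have /hasP [z hz /andP[/eqP ze zm]] := allP (allP D0_adj1 x hx) y hy.
  exists z => //; rewrite ze -[Q'](act_lmKV _ uU).
  exact: has_idx_word.
move=> [z [hz zm] hQ']; have /implyP /(_ zm) /hasP [y hy /eqP ze] := allP (allP D0_adj2 x hx) z hz.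
have -> : Q' = act (lm (mw x.1)) (conicw y.1).
  apply: (has_idx_inj char5 hQ'); rewrite ze; apply: has_idx_word => //.
  exact/D0st_idx/D0nb_sub.
by apply: adj_act => //; apply: nb_adj.
Qed.

(** The 21 listed conics are closed under adjacency, which gives one inclusion. Equality of
    cardinalities, 21 on the left by the isomorphism with T(7), gives the other in place of an
    explicit path to each conic. *)
Lemma component_D0 : component Q0 = CS D0L.
Proof.
have closed Q Q' : clos_refl_trans _ (@adj k) Q Q' -> CS D0L Q -> CS D0L Q'.
  elim=> [a b hab [_ /D0L_mem [x hx ->] ha]|//|a b c _ h1 _ h2 /h1 /h2 //].
  have [z [hz _] hb] := (adj_D0 b hx ha).1 hab.
  by exists z.2.1 => //; apply/mapP; exists z.
apply: (@card_subset_eq _ _ _ 21).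
- move=> Q hQ; apply: closed hQ _; exists conic0 => //.
- exact: T7_iso_card hphi.
exact: (CS_card char5 r2E D0L_uniq D0L_reals).
Qed.

Definition phi0 Q : {set 'I_7} :=
  let x := xget ([::], (conic0, (1, 2)))%N [set x | x \in D0st /\ has_idx Q x.2.1] in lset x.2.2.

Lemma phi0E x Q : x \in D0st -> has_idx Q x.2.1 -> phi0 Q = lset x.2.2.
Proof.
move=> hx hQ; rewrite /phi0; case: xgetP => [y _ [hy hQ']|/(_ x)[]//].
have e := has_idx_fun char5 r2E hQ hQ'.
by have -> : x = y by apply: (uniq_map_inj D0L_uniq).
Qed.

Lemma lab_inj a b : (0 < a < 8)%N -> (0 < b < 8)%N -> lab a = lab b -> a = b.
Proof.
move=> /andP[a0 a8] /andP[b0 b8] /(congr1 val); rewrite /= !inordK ?prednK // => e.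
by rewrite -(prednK a0) -(prednK b0) e.
Qed.

Lemma D0lab_bounds x : x \in D0st -> (0 < x.2.2.1 < 8)%N /\ (0 < x.2.2.2 < 8)%N /\ (x.2.2.1 < x.2.2.2)%N.
Proof.
move=> /(allP D0st_words) /and4P[_ _ _ /and3P[h1 h2 h3]].
by rewrite h1 h2 h3 (ltn_trans h2 h3) (ltn_trans h1 h2).
Qed.

Lemma lset_card x : x \in D0st -> #|lset x.2.2| = 2%N.
Proof.
move=> /D0lab_bounds [h1 [h2 h3]]; rewrite cards2.
by case: eqP => // /(lab_inj h1 h2) e; rewrite e ltnn in h3.
Qed.

Lemma lset_inj x z : x \in D0st -> z \in D0st -> lset x.2.2 = lset z.2.2 -> x.2.2 = z.2.2.
Proof.
move=> hx hz; have [x1 [x2 x12]] := D0lab_bounds hx; have [z1 [z2 z12]] := D0lab_bounds hz.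
case: x {hx} x1 x2 x12 => [wx [lx [a b]]] /= x1 x2 x12.
case: z {hz} z1 z2 z12 => [wz [lz [c d]]] /= z1 z2 z12 /setP e.
have := e (lab a); have := e (lab b); rewrite !inE !eqxx ?orbT => /esym h2 /esym h1.
have d1 u v (hu : (0 < u < 8)%N) (hv : (0 < v < 8)%N) : (lab u == lab v) = (u == v).
  by apply/eqP/eqP => [/(lab_inj hu hv)|->].
move: h1 h2; rewrite !d1 // => /orP[] /eqP e1 /orP[] /eqP e2; subst a b => //.
- by rewrite ltnn in x12.
- by have := ltn_trans x12 z12; rewrite ltnn.
by rewrite ltnn in x12.
Qed.

Lemma lset_surj (A : {set 'I_7}) : #|A| = 2%N -> exists2 x, x \in D0st & lset x.2.2 = A.
Proof.
move=> cA; have /cards2P [i [j [ij ->]]] : #|A| == 2%N by rewrite cA.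
have H (a b : 'I_7) : (a < b)%N -> exists2 x, x \in D0st & lset x.2.2 = [set a; b]%SET.
  move=> ab; have ia (c : 'I_7) : c.+1 \in tid by rewrite mem_iota /= ltnS ltn_ord.
  have /implyP /(_ ab) /mapP [x hx e] := allP (allP D0lab_full _ (ia a)) _ (ia b).
  by exists x; rewrite // -e /lset /= !lab_succ.
have [lt|gt|/val_inj e] := ltngtP i j; first exact: H.
  by rewrite finset.setUC; apply: H.
by rewrite e eqxx in ij.
Qed.

Lemma lset_meet x z : x \in D0st -> z \in D0st ->
  lmeet z.2.2 x.2.2 <-> lset x.2.2 != lset z.2.2 /\ lset x.2.2 :&: lset z.2.2 != finset.set0.
Proof.
move=> hx hz; have [x1 [x2 x12]] := D0lab_bounds hx; have [z1 [z2 z12]] := D0lab_bounds hz.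
rewrite /lmeet; move: hx hz; case: x x1 x2 x12 => [wx [lx [a b]]] /= x1 x2 x12.
case: z z1 z2 z12 => [wz [lz [c d]]] /= z1 z2 z12 hx hz.
split.
  move=> /andP[ne me]; split; last first.
    apply/set0Pn; case/or4P: me => /eqP e; [exists (lab a)|exists (lab b)|exists (lab a)|exists (lab b)];
    by rewrite !inE e !eqxx ?orbT.
  by apply: contraNneq ne => /(lset_inj hx hz) /= [-> ->].
move=> [ne /set0Pn [i]]; rewrite !inE => /andP[hi1 hi2]; apply/andP; split.
  by apply: contraNneq ne => -[-> ->].
case/orP: hi1 => /eqP ->  in hi2 *; case/orP: hi2 => /eqP e.
- by rewrite (lab_inj x1 z1 e) eqxx.
- by rewrite (lab_inj x1 z2 e) eqxx !orbT.
- by rewrite (lab_inj x2 z1 e) eqxx !orbT.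
by rewrite (lab_inj x2 z2 e) eqxx !orbT.
Qed.

Lemma phi0_iso : T7_iso (component Q0) phi0.
Proof.
rewrite component_D0; split; first split.
- move=> Q [_ /D0L_mem [x hx ->] hQ] /=.
  by rewrite (phi0E hx hQ) lset_card.
- move=> Q Q'; rewrite !in_setE => -[_ /D0L_mem [x hx ->] hQ] [_ /D0L_mem [z hz ->] hQ'].
  rewrite (phi0E hx hQ) (phi0E hz hQ') => /(lset_inj hx hz) e; apply: (has_idx_inj char5 hQ).
  by have -> : x = z by apply: (uniq_map_inj D0lab_uniq).
- move=> A /= /lset_surj [x hx <-]; exists (conicw x.1); last exact/phi0E/D0st_idx.
  by exists x.2.1; [apply/mapP; exists x|exact: D0st_idx].
move=> Q Q' [_ /D0L_mem [x hx ->] hQ] [_ /D0L_mem [z hz ->] hQ'].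
rewrite (adj_D0 _ hx hQ) (phi0E hx hQ) (phi0E hz hQ') -lset_meet //; split.
  move=> [z' [hz' m] h]; have e := has_idx_fun char5 r2E hQ' h.
  by have -> : z = z' by apply: (uniq_map_inj D0L_uniq).
by move=> m; exists z.
Qed.
End Component.

(** * Stabilizers *)

Section Rigidity.
Variable k : closedFieldType.
Hypothesis char5 : 5%N \in [pchar k].
Implicit Types (M : 'M[k]_3) (g : 'End('rV[k]_3)).

Lemma scalar_act g c : c != 0 -> (forall v, g v = c *: v) -> forall C, act g C = C.
Proof.
move=> c0 gc C.
have gP P : (g @: P)%VS = P.
  apply/eqP; rewrite eqEsubv; apply/andP; split; apply/subvP => v.
    by move=> /memv_imgP [u uP ->]; rewrite gc memvZ.
  move=> vP; apply/memv_imgP; exists (c^-1 *: v); first exact: memvZ.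
  by rewrite gc scalerA divff // scale1r.
by apply/seteqP; split=> [P [P' CP' <-]|P CP]; [rewrite gP|exists P; rewrite ?gP].
Qed.

Lemma fixed_line g (v : 'rV[k]_3) : lker g = 0%VS -> v != 0 -> (g @: <[v]> = <[v]>)%VS ->
  exists2 c, c != 0 & g v = c *: v.
Proof.
move=> kg v0; rewrite limg_line => e; have gv0 : g v != 0.
  by apply: contraNneq v0 => gv; apply/eqP/(lker0P (introT eqP kg)); rewrite gv linear0.
by have /(line_eqP _ gv0) := e.
Qed.

(** Fixing the points 0 and infinity of the parametrization leaves only the image (x, c, y) of the
    middle vector free. Invariance of the conic is a quadratic relation in r for every r != 0, and
    forces x = y = 0; the point (1, 1, 1) then makes g scalar. *)
Lemma conic_rigid g M : M \in unitmx -> lker g = 0%VS -> act g (Cset M) = Cset M ->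
  (g @: <[vec3 1 0 0 *m M]> = <[vec3 1 0 0 *m M]>)%VS ->
  (g @: <[vec3 0 0 1 *m M]> = <[vec3 0 0 1 *m M]>)%VS ->
  (g @: <[vec3 1 1 1 *m M]> = <[vec3 1 1 1 *m M]>)%VS ->
  exists2 c, c != 0 & forall v, g v = c *: v.
Proof.
move=> uM kg gC.
have nz (v : 'rV[k]_3) : v != 0 -> v *m M != 0.
  by apply: contra_neq => e; rewrite -(mulmxK uM v) e mul0mx.
have n0 a b c : [|| a != 0, b != 0 | c != 0] -> vec3 a b c *m M != 0.
  by move=> h; apply: nz; rewrite vec3_eq0 !negb_and.
move=> /(fixed_line kg) [|a a0 ga]; first by rewrite n0 // oner_neq0.
move=> /(fixed_line kg) [|b b0 gb]; first by rewrite n0 // oner_neq0 !orbT.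
move=> /(fixed_line kg) [|d d0 gd]; first by rewrite n0 // oner_neq0.
have [x [c [y gc]]] : exists x c y, g (vec3 0 1 0 *m M) = vec3 x c y *m M.
  pose v := g (vec3 0 1 0 *m M) *m invmx M.
  by exists (v 0 i0), (v 0 i1), (v 0 i2); rewrite -vec3_eta mulmxKV.
have gE p q r : g (vec3 p q r *m M) = vec3 (a * p + x * q) (c * q) (y * q + b * r) *m M.
  have -> : vec3 p q r = p *: vec3 1 0 0 + q *: vec3 0 1 0 + r *: vec3 0 0 1.
    by apply/rowP => j; case: (ord3P j) => ->; rewrite !mxE /=; ring.
  rewrite !mulmxDl -!scalemxAl !linearD !linearZ /= ga gb gc.
  rewrite !scalemxAl -!mulmxDl; congr (_ *m M).
  by apply/rowP => j; case: (ord3P j) => ->; rewrite !mxE /=; ring.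
have inj u v : u *m M = v *m M -> u = v by move=> e; rewrite -(mulmxK uM u) e mulmxK.
have conic r : (a * r ^+ 2 + x * r) * (y * r + b) = c ^+ 2 * r ^+ 2.
  have : Cset M (g @: <[vec3 (r ^+ 2) r 1 *m M]>)%VS.
    rewrite -gC; exists <[vec3 (r ^+ 2) r 1 *m M]>%VS => //.
    exists (vec3 (r ^+ 2) r 1); rewrite !vec3E mulr1; split=> //.
    by rewrite vec3_eq0 oner_eq0 !andbF.
  move=> [w [w0 wE]]; rewrite limg_line gE => /esym /(line_eqP _ (nz _ w0)) [l l0].
  rewrite scalemxAl => /inj e; rewrite e !mxE /= in wE.
  apply: (mulfI (expf_neq0 2 l0)); apply/esym.
  transitivity ((l * (c * r)) ^+ 2); first by ring.
  by rewrite wE; ring.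
have red r : r != 0 -> a * y * r ^+ 2 + (a * b + x * y - c ^+ 2) * r + x * b = 0.
  move=> r0; apply: (mulfI r0); rewrite mulr0.
  transitivity ((a * r ^+ 2 + x * r) * (y * r + b) - c ^+ 2 * r ^+ 2); first by ring.
  by rewrite conic subrr.
have t0 := two_neq0 char5.
have h1 := red 1 (oner_neq0 _); have h2 := red 2 t0.
have h3 : a * y * 3 ^+ 2 + (a * b + x * y - c ^+ 2) * 3 + x * b = 0.
  apply: red; have -> : 3 = - 2 + 5 :> k by ring.
  by rewrite (five0 char5) addr0 oppr_eq0.
set B := a * b + x * y - c ^+ 2 in h1 h2 h3.
(* The second difference of the relations at r = 1, 2, 3 isolates 2 a y. *)
have ay : a * y = 0.
  apply: (mulfI t0); rewrite mulr0.
  transitivity ((a * y * 3 ^+ 2 + B * 3 + x * b) - 2 * (a * y * 2 ^+ 2 + B * 2 + x * b)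
    + (a * y * 1 ^+ 2 + B * 1 + x * b)); first by ring.
  by rewrite h1 h2 h3; ring.
have y0 : y = 0 by apply: (mulfI a0); rewrite ay mulr0.
have xb : x * b = 0.
  transitivity (2 * (a * y * 1 ^+ 2 + B * 1 + x * b) - (a * y * 2 ^+ 2 + B * 2 + x * b)
    + 2 * (a * y)); first by ring.
  by rewrite h1 h2 ay; ring.
have x0 : x = 0 by apply: (mulIf b0); rewrite xb mul0r.
have := gE 1 1 1; rewrite gd scalemxAl => /inj /rowP e.
have := e i0; have := e i1; have := e i2; rewrite !mxE /= x0 y0 ?mulr1 ?mul0r ?addr0 ?add0r => -> ca ba.
exists a => // v; rewrite -(mulmxKV uM v) scalemxAl.
rewrite [v *m invmx M]vec3_eta gE vec3Z x0 y0 -ca -ba.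
by congr (vec3 _ _ _ *m M); ring.
Qed.
End Rigidity.

Definition triple_word (x : seq nat * seq nat) : seq nat := flatten (map loop x.1).
Lemma triples_ok : all (fun x => [&& letters01 (triple_word x),
  cactw (triple_word x) conic0 == conic0 &
  x.2 == map (pactw (triple_word x)) (take 3 six_points)]) triples.
Proof. by vm_compute. Qed.

Section Stabilizer.
Variable k : closedFieldType.
Hypothesis char5 : 5%N \in [pchar k].
Variable r2 : k.
Hypothesis r2E : r2 ^+ 2 = 2.
Local Notation evm := (evm r2).
Local Notation evv := (evv r2).
Local Notation pt := (pt r2).
Local Notation has_idx := (has_idx r2).
Local Notation Q0 := (Q0 r2).
Local Notation mw := (mw r2).
Hypothesis tQ0 : tt_conics Q0.
Variable phi : set (subsp k) -> {set 'I_7}.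
Hypothesis hphi : T7_iso (component Q0) phi.
Local Notation phi0 := (phi0 r2).
Implicit Types (Q : set (subsp k)) (l : seq nat) (g : 'End('rV[k]_3)).

Let h0 := Q0_idx char5 r2E tQ0.
Let compE := component_D0 char5 r2E tQ0 hphi.

Lemma mw01_unitary w : letters01 w -> unitary (mw w).
Proof. by move=> /letters01_letters; apply: mw_unitary. Qed.

Lemma gen_phi0 n Q : (n < 2)%N -> component Q0 Q ->
  component Q0 (act (lm (evm (gen n))) Q) /\
  phi0 (act (lm (evm (gen n))) Q) = [set pg n i | i in phi0 Q]%SET.
Proof.
move=> n2; rewrite compE => -[_ /D0L_mem [x hx ->] hQ].
have n3 : (n < 3)%N by apply: leq_trans n2 _.
have nl : n \in [:: 0; 1]%N by case: n n2 {n3} => [|[|]].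
have /mapP [y hy yE] := allP (allP D0st_closed x hx) n nl.
have hA : has_idx (act (lm (evm (gen n))) Q) y.2.1 by rewrite -yE; apply: has_idx_act.
split; first by exists y.2.1 => //; apply/mapP; exists y.
rewrite (phi0E char5 r2E hx hQ) (phi0E char5 r2E hy hA) -yE /=.
have [/andP[a0 a8] [/andP[b0 b8] _]] := D0lab_bounds hx.
by rewrite lset_imset ?tb_pg // mem_tid ?a0 ?b0.
Qed.

Lemma word_phi0 w Q : letters01 w -> component Q0 Q ->
  component Q0 (act (lm (mw w)) Q) /\
  phi0 (act (lm (mw w)) Q) = [set pw w i | i in phi0 Q]%SET.
Proof.
move=> hw hQ; elim/last_ind: w hw => [_|w n IH].
  by rewrite /mw /= lm1 act1 imset_perm1.
rewrite /letters01 all_rcons => /andP[n2 /IH [h1 h2]].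
have [h3 h4] := gen_phi0 n2 h1; rewrite act_mw_rcons; split=> //.
by rewrite h4 h2 pw_rcons imset_permM.
Qed.

Lemma component_refl Q : component Q Q.
Proof. exact: rt_refl. Qed.

Lemma word_component w : letters01 w -> actD (mw w) (component Q0) = component Q0.
Proof.
move=> hw; rewrite (component_act char5 _ (mw01_unitary hw)); apply/esym/component_eq.
by have [] := word_phi0 hw (component_refl Q0).
Qed.

Lemma word_Aut w : letters01 w -> Aut_Gamma (lm (mw w)).
Proof.
move=> hw; have hU := mw01_unitary hw.
by split; [exact/lker_lm/unitary_unit|exact: act_Gamma].
Qed.

Lemma word_act_pt w n : letters w -> (n < 126)%N ->
  (pactw w n < 126)%N /\ (lm (mw w) @: pt n)%VS = pt (pactw w n).
Proof.
move=> hw hn; elim/last_ind: w hw => [_|w m IH]; first by rewrite /mw /= lm1 lim1g.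
rewrite /letters all_rcons => /andP[m3 /IH [h1 h2]].
have [h3 h4] := gen_pt char5 r2E m3 h1.
by rewrite /pactw foldl_rcons -/(pactw w n) mw_rcons -lm_imgM h2 h4.
Qed.

Lemma Aut_Gamma_comp g h : Aut_Gamma g -> Aut_Gamma h -> Aut_Gamma (g \o h)%VF.
Proof.
move=> [/eqP kg hg] [/eqP kh hh]; split; last by rewrite -act_comp hh.
by apply/eqP/lker0P => v w; rewrite !comp_lfunE => /(lker0P kg) /(lker0P kh).
Qed.

Lemma six_pts : [/\ pt (nth 0 six_points 0)%N = <[vec3 1 0 0 *m evm M0]>%VS,
  pt (nth 0 six_points 1)%N = <[vec3 0 0 1 *m evm M0]>%VS &
  pt (nth 0 six_points 2)%N = <[vec3 1 1 1 *m evm M0]>%VS].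
Proof.
have /and4P[s0 s1 s2 _] := six_points_ok.
have E (v : vec) n : scaled_point (vmul v M0) n -> pt n = <[evv v *m evm M0]>%VS.
  by move=> /(scaled_pointP char5 r2E) [_ <-]; rewrite (evv_mul char5 r2E).
case: (params_map char5 r2) => e0 e1 e2 _ _ _.
rewrite (E _ _ s0) (E _ _ s1) (E _ _ s2); split; congr (<[_ *m _]>)%VS.
- exact: e0.
- by apply: (etrans e1); rewrite expr2 mulr0.
by apply: (etrans e2); rewrite expr1n.
Qed.

(** By [check_triples] some word fixing Q0 agrees with g on three contact points. Composing g with
    the inverse of that word gives a map to which [conic_rigid] applies, so g and the word differ by
    a scalar. *)
Lemma stab_Q0 g : Aut_Gamma g -> act g Q0 = Q0 ->
  exists2 w, letters01 w & forall C, act g C = act (lm (mw w)) C.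
Proof.
move=> ag gQ0; have [kg gG] := ag; have [_ gc hc] := h0.
have img n : n \in six_points -> exists2 m, m \in six_points & (g @: pt n)%VS = pt m.
  move=> hn; have mem m : (m \in six_points) = (m \in conic0).
    by rewrite -six_points_conic0 mem_sort.
  have : (Q0 `&` @Gamma k) (g @: pt n)%VS.
    rewrite -gQ0 -gG -actI //; exists (pt n) => //; apply/hc; exists n => //.
    by rewrite -mem.
  by move=> /hc [m hm e]; exists m; rewrite ?mem.
have lt126 n : n \in six_points -> (n < 126)%N by move=> hn; apply: (good_lt gc); rewrite -six_points_conic0 mem_sort.
have ne n m n' m' : n \in six_points -> m \in six_points -> (g @: pt n)%VS = pt n' ->
    (g @: pt m)%VS = pt m' -> n != m -> n' != m'.
  move=> hn hm e e'; apply: contra_neq => nm; rewrite -nm -e in e'.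
  by have := act_inj kg e' => /(pt_inj char5 r2E (lt126 _ hm) (lt126 _ hn)) ->.
pose p j := nth 0%N six_points j.
have [ms0 ms1 ms2] : [/\ p 0%N \in six_points, p 1%N \in six_points & p 2%N \in six_points] by [].
have [a ha ga] := img _ ms0; have [b hb gb] := img _ ms1; have [c hc' gc'] := img _ ms2.
have uabc : uniq [:: a; b; c].
  by rewrite /= !inE (ne _ _ _ _ ms1 ms2 gb gc') // negb_or (ne _ _ _ _ ms0 ms1 ga gb) //
    (ne _ _ _ _ ms0 ms2 ga gc').
have /implyP /(_ uabc) /hasP [x hx /eqP xE] := allP (allP (allP check_triples a ha) b hb) c hc'.
have /and3P[hw /eqP wc /eqP xE'] := allP triples_ok x hx; rewrite xE in xE'.
case: xE' => aE bE cE; set w := triple_word x in hw wc aE bE cE.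
have hl := letters01_letters hw; have hU := mw01_unitary hw; have uU := unitary_unit hU.
pose h := (lm (invmx (mw w)) \o g)%VF.
have [kh hG] : Aut_Gamma h.
  apply: Aut_Gamma_comp => //; have hV := unitaryV char5 hU.
  by split; [exact/lker_lm/unitary_unit|exact: act_Gamma].
have hQ : act h Q0 = Q0.
  rewrite -act_comp gQ0; have e : act (lm (mw w)) Q0 = Q0.
    by apply: (has_idx_inj char5 _ h0); rewrite -wc; apply: has_idx_word.
  by rewrite -{1}e act_lmK.
have fix_ n : n \in six_points -> (g @: pt n)%VS = pt (pactw w n) -> (h @: pt n)%VS = pt n.
  move=> hn e; rewrite limg_comp e; have [_ <-] := word_act_pt hl (lt126 n hn).
  by rewrite lm_imgK.
have [q0 q1 q2] := six_pts.
have uM := frame_unit char5 (M0_frame char5 r2E).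
have [c0 c00 hc0] := conic_rigid char5 uM kh hQ
  ltac:(rewrite -q0; apply: fix_ => //; rewrite -aE; exact: ga)
  ltac:(rewrite -q1; apply: fix_ => //; rewrite -bE; exact: gb)
  ltac:(rewrite -q2; apply: fix_ => //; rewrite -cE; exact: gc').
exists w => // C.
by rewrite -[RHS](congr1 _ (scalar_act c00 hc0 C)) -act_comp act_lmKV.
Qed.

Lemma stab_words_all g : Aut_Gamma g -> [set act g Q | Q in component Q0] = component Q0 ->
  exists2 w, letters01 w & forall C, act g C = act (lm (mw w)) C.
Proof.
move=> ag gD; have : component Q0 (act g Q0) by rewrite -gD; exists Q0 => //; apply: component_refl.
rewrite compE => -[_ /D0L_mem [x hx ->] hgQ0].
have /and4P[hw _ _ _] := allP D0st_words x hx.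
have hU := mw01_unitary hw; have uU := unitary_unit hU.
have e := has_idx_inj char5 hgQ0 (D0st_idx char5 r2E tQ0 hx).
pose h := (lm (invmx (mw x.1)) \o g)%VF.
have ah : Aut_Gamma h.
  apply: Aut_Gamma_comp => //; have hV := unitaryV char5 hU.
  by split; [exact/lker_lm/unitary_unit|exact: act_Gamma].
have [|u hu hC] := stab_Q0 ah; first by rewrite -act_comp e act_lmK.
exists (u ++ x.1); first exact: letters01_cat.
by move=> C; rewrite mw_cat -lm_act -hC -act_comp act_lmKV.
Qed.
End Stabilizer.

Definition fam (i : nat) := nth [::] families i.
Definition repw (i : nat) : seq nat := (nth ([::], in_d) reps i).1.
(** Certifies the result of the search: each entry is the image of the representative under its own
    word, and each entry after the first has its conic through point 0 outside the representative,
    hence is a different component. *)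
Definition check_fam (i : nat) : bool :=
  [&& ohead (fam i) == Some ([::], rep_comp i),
    all (fun y => if letters01 y.1 then y.2 == foldl cact2 (rep_comp i) y.1 else false) (fam i),
    all (fun y => rep0 y.2 \notin rep_comp i) (behead (fam i)),
    uniq (rep_comp i) && letters (repw i) & rep_comp i == foldl cact2 D0L (repw i)].
Lemma fams_ok : all check_fam (iota 0 6).
Proof. by vm_compute. Qed.

Lemma rep0_mem L : rep0 L != [::] -> rep0 L \in L.
Proof.
rewrite /rep0; case: (ltnP (find (fun l => head 1%N l == 0%N) L) (size L)) => h; first by rewrite mem_nth.
by rewrite nth_default.
Qed.

Section Stabilizers.
Variable k : closedFieldType.
Hypothesis char5 : 5%N \in [pchar k].
Variable r2 : k.
Hypothesis r2E : r2 ^+ 2 = 2.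
Local Notation evm := (evm r2).
Local Notation has_idx := (has_idx r2).
Local Notation Q0 := (Q0 r2).
Local Notation mw := (mw r2).
Local Notation CS := (CS r2).
Hypothesis tQ0 : tt_conics Q0.
Variable phi : set (subsp k) -> {set 'I_7}.
Hypothesis hphi : T7_iso (component Q0) phi.
Local Notation phi0 := (phi0 r2).
Implicit Types (Q : set (subsp k)) (l : seq nat).

Let D0 := component Q0.
Let compE : D0 = CS D0L := component_D0 char5 r2E tQ0 hphi.

Section Rep.
Variable i : nat.
Hypothesis i6 : (i < 6)%N.

Definition rep_D := CS (rep_comp i).

Let ok : check_fam i := allP fams_ok i ltac:(by rewrite mem_iota).

Lemma repw_letters : letters (repw i).
Proof. by case/and5P: ok => _ _ _ /andP[]. Qed.

Lemma rep_comp_uniq : uniq (rep_comp i).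
Proof. by case/and5P: ok => _ _ _ /andP[]. Qed.

Lemma rep_reals_D : reals r2 (rep_comp i) /\ rep_D = actD (mw (repw i)) D0.
Proof.
case/and5P: ok => _ _ _ _ /eqP e; rewrite /rep_D compE e.
have [h1 h2] := CS_word char5 r2E repw_letters (D0L_reals char5 r2E tQ0).
by split.
Qed.

Lemma fam_CS y : y \in fam i -> [/\ letters01 y.1, reals r2 y.2 & actD (mw y.1) rep_D = CS y.2].
Proof.
move=> hy; case/and5P: ok => _ /allP /(_ y hy) h _ _ _; move: h.
case: ifP => // hw /eqP ->; have [hr _] := rep_reals_D.
by have [] := CS_word char5 r2E (letters01_letters hw) hr.
Qed.

Lemma rep_D_component : exists2 R, tt_conics R & rep_D = component R.
Proof.
have hU := mw_unitary char5 r2E repw_letters.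
by have [_ ->] := rep_reals_D; exists (act (lm (mw (repw i))) Q0);
  [exact: tt_conics_act|rewrite component_act].
Qed.

Lemma fam_component y : y \in fam i -> exists2 R, tt_conics R & CS y.2 = component R.
Proof.
move=> /fam_CS [hw _ <-]; have hU := mw01_unitary char5 r2E hw.
have [R tR ->] := rep_D_component.
by exists (act (lm (mw y.1)) R); [exact: tt_conics_act|rewrite component_act].
Qed.

Lemma fam_check : check_family (fam i) (sigp i).
Proof.
apply: (allP check_families (fam i, nth ([::], in_d) reps i)).
by rewrite -[X in X \in _](nth_zip [::] ([::], in_d)) //; apply: mem_nth; rewrite size_zip.
Qed.

(** The search compares components only by their conic through point 0. That suffices because
    components with a common conic coincide. *)
Lemma fam_step y g : y \in fam i -> (g < 2)%N ->
  exists2 z, z \in fam i & actD (evm (gen g)) (CS y.2) = CS z.2 /\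
    (pw y.1 * pg g * (pw z.1)^-1)%g \in Sig i.
Proof.
move=> hy g2; have g3 : (g < 3)%N by apply: leq_trans g2 _.
have gl : g \in [:: 0; 1]%N by case: g g2 {g3} => [|[|]].
case/andP: fam_check => /andP[/allP /(_ y hy) /allP /(_ g gl) /hasP [z hz]] + _ /allP h3.
case: ifP => // /eqP e hp; exists z => //; split; last first.
  rewrite SigE !tb_M tb_V !tb_pw tb_pg hp andbT.
  by rewrite !groupM ?groupV ?pw_even ?pg_even.
have [hw hr _] := fam_CS hy; have [_ hr' _] := fam_CS hz.
have m' : rep0 z.2 \in z.2 by apply/rep0_mem/h3.
have m : rep0 z.2 \in map (cact g) y.2 by rewrite -e; apply: rep0_mem; rewrite e h3.
have [R hR] := hr' _ m'.
have [A tA AE] := fam_component hy; have [B tB BE] := fam_component hz.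
have hU := gen_unitary char5 r2E g3.
have c1 : component B R by rewrite -BE; exists (rep0 z.2).
have c2 : component (act (lm (evm (gen g))) A) R.
  by rewrite -component_act // -AE CS_act //; exists (rep0 z.2).
by rewrite AE component_act // BE (component_eq c1) (component_eq c2).
Qed.

(** Schreier's lemma: modulo [Sig i], every word equals the stored word of the component that it
    reaches, by induction with the Schreier generators of [fam_step]. *)
Lemma word_fam w : letters01 w -> exists2 y, y \in fam i &
  actD (mw w) rep_D = CS y.2 /\ (pw w * (pw y.1)^-1)%g \in Sig i.
Proof.
elim/last_ind: w => [_|w g IH].
  exists ([::], rep_comp i).
    by case/and5P: ok; case: (fam i) => // y f /eqP [->] *; rewrite inE eqxx.
  by rewrite /mw /= actD1 mul1g invg1; have /group_setP [] := Sig_group i.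
rewrite /letters01 all_rcons => /andP[g2 /IH [y hy [h1 h2]]].
have [z hz [h3 h4]] := fam_step hy g2; exists z => //; split.
  by rewrite mw_rcons -actDM h1.
have -> : (pw (rcons w g) * (pw z.1)^-1 = (pw w * (pw y.1)^-1) * (pw y.1 * pg g * (pw z.1)^-1))%g.
  by rewrite pw_rcons !mulgA mulgKV.
have /group_setP [_ gM] := Sig_group i; exact: gM.
Qed.

(** If a word fixes the representative, the entry it reaches is the head of the orbit, with empty
    word, so its permutation lies in [Sig i]. Conversely a permutation in [Sig i] cannot lead to
    another entry, as the stored words of those lie outside [Sig i]. *)
Lemma word_stab w : letters01 w -> actD (mw w) rep_D = rep_D <-> pw w \in Sig i.
Proof.
move=> hw; have [y hy [h1 h2]] := word_fam hw.
have gG := Sig_group i; pose G := Group gG.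
have hyE : y = ([::], rep_comp i) \/ y \in behead (fam i).
  move: hy; case/and5P: ok; case: (fam i) => // z f /eqP [->] _ _ _ _.
  by rewrite inE => /orP[/eqP|]; [left|right].
case/and5P: ok => _ _ /allP hbeh _ _.
split=> [e|wS].
  case: hyE => [yE|/hbeh nin]; first by move: h2; rewrite yE invg1 mulg1.
  case/negP: nin; have [_ hr _] := fam_CS hy.
  have hne : rep0 y.2 \in y.2.
    by case/andP: fam_check => _ /allP h; apply/rep0_mem/h.
  have [R hR] := hr _ hne.
  have : rep_D R by rewrite -e h1; exists (rep0 y.2).
  by move=> [l hl /(has_idx_fun char5 r2E hR) ->].
case: hyE => [yE|hb]; first by rewrite h1 yE.
have : pw y.1 \in G.
  by rewrite -(mulgKV (pw w) (pw y.1)) groupM // -groupV invMg invgK.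
rewrite SigE tb_pw => /andP[_ hp].
case/andP: fam_check => /andP[_ /allP /(_ y hb)] + _.
by case/negP; exact: hp.
Qed.

Lemma perm_image_rep : perm_image D0 phi0 (stab D0 `&` stab rep_D) = Sig i.
Proof.
have hiso := phi0_iso char5 r2E tQ0 hphi; have [[p1 p2 p3] _] := hiso.
apply/setP => s; rewrite finset.in_set; apply/asboolP/idP.
  move=> [g [[ag gD] [_ gD']] hg].
  have [w hw gC] := stab_words_all char5 r2E tQ0 hphi ag gD.
  have -> : s = pw w.
    apply: perm_pairs_inj => A /p3 [Q DQ <-].
    by rewrite -hg // gC; have [] := word_phi0 char5 r2E tQ0 hphi hw DQ.
  apply/(word_stab hw); rewrite -[RHS]gD'.
  by apply/seteqP; split=> _ [Q DQ <-]; exists Q.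
move=> sS; have := sS; rewrite SigE => /andP[/alt_words [w hw ws] _].
exists (lm (mw w)); last by move=> Q DQ; have [_ ->] := word_phi0 char5 r2E tQ0 hphi hw DQ; rewrite ws.
have ag := word_Aut char5 r2E hw.
split; split=> //; first exact: (word_component char5 r2E tQ0 hphi hw).
by apply/(word_stab hw); rewrite ws.
Qed.
End Rep.

Lemma perm_image_relabel (s : 'S_7) phi1 (H : set 'End('rV[k]_3)) D :
  (forall Q, D Q -> phi1 Q = [set s i | i in phi0 Q]%SET) -> H `<=` stab D ->
  perm_image D phi1 H = (perm_image D phi0 H :^ s)%g.
Proof.
move=> h hH; apply/setP => t; rewrite mem_conjg !finset.in_set.
have im_inj : injective (fun A : {set 'I_7} => [set s i | i in A]%SET).
  exact/imset_inj/perm_inj.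
have cj : (t ^ s^-1 * s = s * t)%g by rewrite conjgE invgK mulgA mulgKV.
apply/asboolP/asboolP => -[g Hg hg]; exists g => // Q DQ; have DgQ : D (act g Q) by
  have [_ e] := hH g Hg; rewrite -e; exists Q.
  by apply: im_inj => /=; rewrite -imset_permM cj imset_permM -!h // hg.
by rewrite !h // hg // -!imset_permM cj.
Qed.
End Stabilizers.

(** * Completeness of the list of components *)

Section Pencil.
Variable k : closedFieldType.
Hypothesis char5 : 5%N \in [pchar k].
Implicit Types (M : 'M[k]_3) (P : subsp k) (R : set (subsp k)).

(* The conics tangent to the lines e0 e1 at e0 and e1 e2 at e2, where e0, e1, e2 are the rows of M. *)
Definition pencil M (c : k) : set (subsp k) :=
  [set P | exists x : 'rV[k]_3, [/\ x != 0, x 0 i1 ^+ 2 = c * (x 0 i0 * x 0 i2) & P = <[x *m M]>%VS]].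

Lemma row_gram M i j : gram M i j = herm (row i M) (row j M).
Proof. by rewrite mxE. Qed.

(** Orthogonality to the outer rows reduces the middle row of M' to n times that of M. If the outer
    rows are scaled by l and m, the Gram entries give l^5 m = m^5 l = 1 and n^6 = 1, so c = n^2 / (l
    m) is a sixth root of unity. *)
Lemma frame_pencil M M' : gram M = Jm k -> gram M' = Jm k ->
  (<[row i0 M']> = <[row i0 M]>)%VS -> (<[row i2 M']> = <[row i2 M]>)%VS ->
  exists2 c, c ^+ 6 = 1 & Cset M' = pencil M c.
Proof.
move=> gM gM'; have uM := frame_unit char5 gM; have uM' := frame_unit char5 gM'.
have [r0 r1 r2] := row_vec3 M; have [s0 s1 s2] := row_vec3 M'.
have row0 i : row i M' != 0.
  apply: contraTneq uM' => e; rewrite -row_free_unit -kermx_eq0; apply/rowV0Pn.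
  exists (delta_mx 0 i); first by apply/sub_kermxP; rewrite -rowE.
  by apply/eqP => /rowP /(_ i) /eqP; rewrite !mxE !eqxx oner_eq0.
move=> /(line_eqP _ (row0 _)) [l l0 lE] /(line_eqP _ (row0 _)) [m m0 mE].
have [x [n [y nE]]] : exists x n y, row i1 M' = x *: row i0 M + n *: row i1 M + y *: row i2 M.
  pose v := row i1 M' *m invmx M.
  by exists (v 0 i0), (v 0 i1), (v 0 i2); rewrite -[LHS](mulmxKV uM) mulmx_sum_row sum3.
have gE i j : herm (row i M) (row j M) = Jm k i j by rewrite -row_gram gM.
have gE' i j : herm (row i M') (row j M') = Jm k i j by rewrite -row_gram gM'.
have y0 : y = 0.
  have := gE' i0 i1; rewrite lE nE !hermDr !hermZr !hermZl !gE !JmE.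
  rewrite !mulr0 !add0r !mulr1 => /eqP; rewrite mulf_eq0 expf_eq0 /= (negbTE l0) orbF.
  by move=> /eqP.
have x0 : x = 0.
  have := gE' i2 i1; rewrite mE nE !hermDr !hermZr !hermZl !gE !JmE.
  rewrite !mulr0 !addr0 !mulr1 => /eqP; rewrite mulf_eq0 expf_eq0 /= (negbTE m0) orbF.
  by move=> /eqP.
rewrite x0 y0 !scale0r add0r addr0 in nE.
have lm1 : l ^+ 5 * m = 1.
  by have := gE' i0 i2; rewrite lE mE hermZl hermZr !gE !JmE mulr1 mulrC => ->.
have ml1 : m ^+ 5 * l = 1.
  by have := gE' i2 i0; rewrite lE mE hermZl hermZr !gE !JmE mulr1 mulrC => ->.
have n6 : n ^+ 6 = 1.
  have := gE' i1 i1; rewrite nE hermZl hermZr !gE !JmE => e.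
  have t0 : (-2 : k) != 0 by rewrite oppr_eq0 (two_neq0 char5).
  by apply: (mulIf t0); rewrite mul1r -[RHS]e; ring.
have n0 : n != 0 by apply: contra_eq_neq n6 => ->; rewrite expr0n eq_sym oner_neq0.
have lm0 : l * m != 0 by rewrite mulf_neq0.
have lm6 : (l * m) ^+ 6 = 1.
  by transitivity ((l ^+ 5 * m) * (m ^+ 5 * l)); [ring|rewrite lm1 ml1 mulr1].
exists (n ^+ 2 / (l * m)).
  by rewrite expr_div_n lm6 divr1 -exprM mulnC exprM n6 expr1n.
have E (v : 'rV[k]_3) : v *m M' = vec3 (l * v 0 i0) (n * v 0 i1) (m * v 0 i2) *m M.
  rewrite !mulmx_sum_row !sum3 !vec3E lE nE mE !scalerA.
  by rewrite [v _ i0 * _]mulrC [v _ i1 * _]mulrC [v _ i2 * _]mulrC.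
apply/seteqP; split=> P [v [v0 vE ->]].
  exists (vec3 (l * v 0 i0) (n * v 0 i1) (m * v 0 i2)); rewrite !vec3E -E; split=> //.
    by apply: contraNneq v0 => e; rewrite -(mulmxK uM' v) E e mul0mx mul0mx.
  rewrite exprMn vE; field; exact/andP.
exists (vec3 (v 0 i0 / l) (v 0 i1 / n) (v 0 i2 / m)); rewrite !vec3E E !vec3E; split.
- apply: contraNneq v0 => /eqP; rewrite vec3_eq0 !mulf_eq0 !invr_eq0 (negbTE l0) (negbTE n0) (negbTE m0).
  by rewrite !orbF => /and3P[/eqP a /eqP b /eqP c]; rewrite (vec3_eta v) a b c vec3_eq0 !eqxx.
- by rewrite expr_div_n vE; field; rewrite ?n0 ?l0 ?m0.
congr (<[_ *m M]>)%VS; rewrite {1}[v]vec3_eta; congr vec3; by field.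
Qed.

Lemma tt_pencil P1 P2 (s : seq (set (subsp k))) : P1 <> P2 -> uniq s ->
  (forall R, R \in s -> [/\ tt_conics R, (R `&` @Gamma k) P1 & (R `&` @Gamma k) P2]) ->
  (size s <= 6)%N.
Proof.
move=> neq; case: s => // R0 s us hs.
have [t0 a0 b0] := hs R0 (mem_head _ _).
have [M [gM RE PE1 PE2]] := tt_frame char5 t0 a0 b0 neq.
pose kap R := xget 0 [set c | c ^+ 6 = 1 /\ R = pencil M c].
have kapP R : R \in R0 :: s -> kap R ^+ 6 = 1 /\ R = pencil M (kap R).
  move=> /hs [tR a b]; apply: (@xgetPex _ 0 [set c | c ^+ 6 = 1 /\ R = pencil M c]).
  have [M' [gM' RE' PE1' PE2']] := tt_frame char5 tR a b neq.
  have [||c c6 cE] := frame_pencil gM gM'; rewrite -?PE1 -?PE2 //.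
  by exists c; rewrite RE' cE; split.
have uk : uniq (map kap (R0 :: s)).
  rewrite map_inj_in_uniq // => R R' /kapP [_ e] /kapP [_ e'] ke.
  by rewrite e ke -e'.
have s7 : size ('X^6 - 1%:P : {poly k}) = 7%N by rewrite size_XnsubC.
rewrite -(size_map kap) -ltnS -s7; apply: max_poly_roots uk.
  by rewrite -size_poly_eq0 s7.
apply/allP => _ /mapP [R /kapP [e _] ->].
by rewrite rootE !hornerE e subrr.
Qed.
End Pencil.

Lemma D0L_points : all (fun n => has (fun l => n \in l) D0L) (iota 0 126).
Proof. by vm_compute. Qed.

Lemma conics_through (S : seq (seq nat)) a m n :
  size (undup [seq l <- [seq l <- S | a \in l] | m \in l]) == n ->
  exists L, [/\ uniq L, size L = n & forall l, l \in L -> [/\ l \in S, a \in l & m \in l]].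
Proof.
move=> /eqP e; exists (undup [seq l <- [seq l <- S | a \in l] | m \in l]).
split=> // [|l]; first exact: undup_uniq.
by rewrite mem_undup !mem_filter => /and3P[].
Qed.

Lemma size_families : size families = 6%N.
Proof. by []. Qed.

Definition T_of (i : nat) : Ttype :=
  match i with 0 => alpha15_gamma6 | 1 | 2 => beta21 | 3 | 4 => alpha3_gamma18 | _ => gamma21 end%N.

Definition T_check (T : Ttype) (L : seq (seq nat)) : bool :=
  let c t := count (tcount t ^~ L) D0L in
  match T with
  | beta21 => c beta == 21
  | gamma21 => c gamma == 21
  | alpha15_gamma6 => (c alpha == 15) && (c gamma == 6)
  | alpha3_gamma18 => (c alpha == 3) && (c gamma == 18)
  end%N.

Lemma T_check_reps : all (fun i => T_check (T_of i) (rep_comp i)) (iota 0 6).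
Proof. by vm_compute. Qed.

Section Cover.
Variable k : closedFieldType.
Hypothesis char5 : 5%N \in [pchar k].
Variable r2 : k.
Hypothesis r2E : r2 ^+ 2 = 2.
Local Notation evm := (evm r2).
Local Notation pt := (pt r2).
Local Notation has_idx := (has_idx r2).
Local Notation Q0 := (Q0 r2).
Local Notation mw := (mw r2).
Local Notation CS := (CS r2).
Local Notation rep_D := (rep_D r2).
Hypothesis tQ0 : tt_conics Q0.
Variable phi : set (subsp k) -> {set 'I_7}.
Hypothesis hphi : T7_iso (component Q0) phi.
Implicit Types (Q R : set (subsp k)) (l : seq nat).

Let D0 := component Q0.
Let compE : D0 = CS D0L := component_D0 char5 r2E tQ0 hphi.

Lemma all_conics_cases l : l \in all_conics ->
  l \in D0L \/ exists i y, [/\ (i < 6)%N, y \in fam i & l \in y.2].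
Proof.
move=> /flattenP [ll]; rewrite in_cons => /orP[/eqP -> hl|/mapP [f hf ->] hl]; first by left.
have [_ /mapP [y hy ->] hl'] := flattenP hl.
right; exists (index f families), y; rewrite -size_families index_mem hf /fam nth_index //.
Qed.

Lemma all_conics_real l : l \in all_conics -> real r2 l.
Proof.
move=> /all_conics_cases [/(D0L_reals char5 r2E tQ0) //|[i [y [i6 hy hl]]]].
by have [_ h _] := fam_CS char5 r2E tQ0 hphi i6 hy; apply: h.
Qed.

(** A second contact point of R is rational, say point m. Six listed conics pass through the points
    0 and m, so an unlisted R would be a seventh, against [tt_pencil]. *)
Lemma listed R : tt_conics R -> (R `&` @Gamma k) (pt 0) -> exists2 l, l \in all_conics & has_idx R l.
Proof.
move=> tR R0.
have [P [RP neq]] : exists P, (R `&` @Gamma k) P /\ pt 0 <> P.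
  have [P1 [P2 [h1 h2 ne]]] := tt_two_points tR.
  have [e|e] := EM (pt 0 = P1); last by exists P1.
  by exists P2; split; rewrite // e.
have [v [v0 v25 hv PE]] := tt_rational char5 tR RP.
have [m m126 mE] := rational_pt char5 r2E v0 v25 hv.
have m0 : m != 0%N by apply: contra_notN neq => /eqP m0; rewrite PE mE m0.
have mi : m \in iota 1 125 by rewrite mem_iota lt0n m0.
have [L [uL sL hL]] := conics_through (allP check_cover m mi).
pose Rl l := xget set0 [set Q | has_idx Q l].
have LP l : l \in L -> [/\ l \in all_conics, 0%N \in l, m \in l & has_idx (Rl l) l].
  move=> /hL [hl l0 ml]; split=> //.
  by have hr := all_conics_real hl; apply: (@xgetPex _ set0 [set Q | has_idx Q l]).
apply: contrapT => nl.
have nR : R \notin map Rl L.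
  apply/negP => /mapP [l /LP [hl _ _ hI] e]; apply: nl; exists l; rewrite // e.
  exact: hI.
have uRL : uniq (R :: map Rl L).
  rewrite /= nR map_inj_in_uniq // => l l' /LP [_ _ _ h] /LP [_ _ _ h'] e.
  by apply: (has_idx_fun char5 r2E h); rewrite e.
suff h : forall R', R' \in R :: map Rl L -> [/\ tt_conics R', (R' `&` @Gamma k) (pt 0) & (R' `&` @Gamma k) P].
  by have := tt_pencil char5 neq uRL h; rewrite /= size_map sL.
move=> R'; rewrite inE => /orP[/eqP ->|/mapP [l /LP [_ l0 lm [tl _ hl]] ->]]; split=> //.
- by apply/hl; exists 0%N.
by apply/hl; exists m; rewrite // PE.
Qed.

(** Any component is V D0 for a unitary V. The preimage of point 0 under V is one of the 126
    rational points, and the conics of D0 cover all of these. *)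
Lemma component_through0 D' : components D' -> exists2 R, tt_conics R /\ (R `&` @Gamma k) (pt 0) &
  D' = component R.
Proof.
move=> [Q tQ ->]; have [M gM QE] := tt_frame_exists char5 tQ.
have gM0 := M0_frame char5 r2E; have uM0 := frame_unit char5 gM0.
pose V := invmx (evm M0) *m M; have hV : unitary V := frames_unitary char5 gM0 gM.
have uV := unitary_unit hV.
have QV : Q = act (lm V) Q0 by rewrite QE act_Cset mulKVmx.
have [GP [v PE v25]] : rational_pts (lm (invmx V) @: pt 0)%VS.
  rewrite -(rational_pts_act char5 (unitaryV char5 hV)); exists (pt 0) => //.
  exact: pt_rational.
have [v0 hv] : v != 0 /\ herm v v = 0 by apply/Gamma_line; rewrite -PE.
have [n n126 nE] := rational_pt char5 r2E v0 v25 hv.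
have ni : n \in iota 0 126 by rewrite mem_iota.
have /hasP [l lL nl] := allP D0L_points n ni.
have [R hR] := D0L_reals char5 r2E tQ0 lL; have [tR _ Rl] := hR.
have cR : D0 R by rewrite compE; exists l.
exists (act (lm V) R); first split.
- exact: tt_conics_act.
- rewrite -(act_Gamma char5 hV) -actI ?lker_lm //.
  exists (lm (invmx V) @: pt 0)%VS; last by rewrite lm_imgKV.
  by rewrite PE nE; apply/Rl; exists n.
by rewrite -/(component Q) QV -!component_act // -(component_eq cR).
Qed.

Lemma component_cover D' : components D' ->
  D' = D0 \/ exists i y, [/\ (i < 6)%N, y \in fam i & D' = actD (mw y.1) (rep_D i)].
Proof.
move=> /component_through0 [R [tR R0] ->]; have [l hl hR] := listed tR R0.
case: (all_conics_cases hl) => [lL|[i [y [i6 hy ly]]]].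
  left; apply/esym/component_eq; rewrite -/D0 compE; by exists l.
right; exists i, y; split=> //.
have [_ _ ->] := fam_CS char5 r2E tQ0 hphi i6 hy.
have [A tA AE] := fam_component char5 r2E tQ0 hphi i6 hy.
by rewrite AE; apply/esym/component_eq; rewrite -AE; exists l.
Qed.

Lemma T_is_CS T L : uniq L -> reals r2 L -> T_check T L -> T_is D0 (CS L) T.
Proof.
move=> uL hL; have hD := D0L_reals char5 r2E tQ0.
have oft t n : count (tcount t ^~ L) D0L == n -> (of_t D0 (CS L) t #= `I_n)%card.
  by move=> /eqP e; rewrite compE; apply: of_t_CS => //; apply: D0L_uniq.
have allt t : count (tcount t ^~ L) D0L == 21%N -> forall Q, D0 Q -> t_is Q (CS L) t.
  by move=> e; rewrite compE; apply: (all_t_CS char5 r2E) => //; rewrite all_count.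
case: T; rewrite /T_check /T_is.
- exact: allt.
- exact: allt.
- by move=> /andP[h1 h2]; split; apply: oft.
by move=> /andP[h1 h2]; split; apply: oft.
Qed.

Lemma T_is_rep i : (i < 6)%N -> T_is D0 (rep_D i) (T_of i).
Proof.
move=> i6; have [hr _] := rep_reals_D char5 r2E tQ0 hphi i6.
apply: T_is_CS => //; first exact: rep_comp_uniq.
by apply: (allP T_check_reps); rewrite mem_iota.
Qed.
End Cover.

(** * The criterion for the base component and for all components *)

Section Base.
Variable k : closedFieldType.
Hypothesis char5 : 5%N \in [pchar k].
Variable r2 : k.
Hypothesis r2E : r2 ^+ 2 = 2.
Local Notation Q0 := (Q0 r2).
Hypothesis tQ0 : tt_conics Q0.

(** The stabilizer is [Sig i] conjugated by the permutation s relating the two labellings.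
    [Sig_A7_conj] gives the implication from type to stabilizer, and the conjugation invariants,
    through [conj_T], give the converse. *)
Lemma criterion_rep phi i : T7_iso (component Q0) phi -> (i < 6)%N -> criterion (component Q0) (rep_D r2 i) phi.
Proof.
move=> hphi i6; have iso0 := phi0_iso char5 r2E tQ0 hphi.
have [s hs] := T7_iso_unique hphi iso0.
have HE : perm_image (component Q0) phi (stab (component Q0) `&` stab (rep_D r2 i)) = (Sig i :^ s)%g.
  rewrite -(perm_image_rep char5 r2E tQ0 hphi i6); apply: perm_image_relabel hs _.
  by move=> g [].
have key T : T_is (component Q0) (rep_D r2 i) T = (T_of i = T).
  apply/propext.
  have hT := T_is_rep char5 r2E tQ0 hphi i6.
  by split=> [/(T_is_excl (component_refl Q0) hT) //|<-].
have conj_T j : (j < 6)%N -> A7_conj (Sig i :^ s)%g (Sig j) -> T_of i = T_of j.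
  move=> j6 /A7_conj_Sig_eq; case: i i6 {HE key} => [|[|[|[|[|[|//]]]]]] _;
  by case: j j6 => [|[|[|[|[|[|//]]]]]] _ [].
have := Sig_A7_conj i s; rewrite /criterion HE !key.
case: i i6 {HE key} conj_T => [|[|[|[|[|[|//]]]]]] _ conj_T own; split; split=> // h.
all: try by case: own => [//|[//]].
all: try by have := conj_T 0%N isT h.
all: try by have := conj_T 3%N isT h.
all: try by have := conj_T 5%N isT h.
all: try by case: h => h; [have := conj_T 1%N isT h|have := conj_T 2%N isT h].
- by case: own => [|[_]]; [left|right].
by case: own => [|[_]]; [right|left].
Qed.

(** The word leading from a representative to D' fixes D0, so its inverse reduces the claim to the
    representative, with the labelling transported along. *)
Lemma criterion_base phi D' : T7_iso (component Q0) phi -> components D' -> D' <> component Q0 ->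
  criterion (component Q0) D' phi.
Proof.
move=> hphi hD' ne; have [//|[i [y [i6 hy ->]]]] := component_cover char5 r2E tQ0 hphi hD'.
have [hw _ _] := fam_CS char5 r2E tQ0 hphi i6 hy.
have hU := mw01_unitary char5 r2E hw; have uU := unitary_unit hU.
have hV := unitaryV char5 hU.
have e : actD (invmx (mw r2 y.1)) (component Q0) = component Q0.
  by rewrite -{1}(word_component char5 r2E tQ0 hphi hw) actDK.
apply: (criterion_act char5 hV); rewrite e actDK //; apply: criterion_rep => //.
by rewrite -e; apply: T7_iso_act.
Qed.
End Base.

Theorem theorem1p16 (k : closedFieldType) (char5 : 5%N \in [pchar k])
    (D D' : set (set (subsp k)))
    (hD : components D) (hD' : components D') (neqDD' : D <> D')
    (phi : set (subsp k) -> {set 'I_7}) (hphi : T7_iso D phi) :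
  let H := perm_image D phi (stab D `&` stab D') in
  [/\ T_is D D' beta21 <-> A7_conj H Sigma_b \/ A7_conj H Sigma_b',
      T_is D D' gamma21 <-> A7_conj H Sigma_d,
      T_is D D' alpha15_gamma6 <-> A7_conj H Sigma_a &
      T_is D D' alpha3_gamma18 <-> A7_conj H Sigma_c].
Proof.
have [r2 r2E] := @closed_root_exists k 2 2 isT.
case: hD => Q tQ DE; rewrite -/(component Q) in DE.
have [M gM QE] := tt_frame_exists char5 tQ.
have gM0 := M0_frame char5 r2E; have uM := frame_unit char5 gM.
(* This unitary matrix carries the given conic Q to the base conic, and thereby D to its
   component. *)
pose V := invmx M *m evm r2 M0; have hV : unitary V := frames_unitary char5 gM gM0.
have uV := unitary_unit hV.
have tQ0 : tt_conics (Q0 r2) := tt_Cset char5 tQ gM0.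
have VD : actD V D = component (Q0 r2).
  by rewrite DE component_act // QE act_Cset mulKVmx.
apply: (criterion_act char5 hV (D' := D')); rewrite VD; apply: criterion_base => //.
- by rewrite -VD; apply: T7_iso_act.
- case: hD' => Q' tQ' ->; exists (act (lm V) Q'); first exact: tt_conics_act.
  exact: component_act.
by rewrite -VD => e; apply: neqDD'; rewrite -(actDK D uV) -e actDK.
Qed.
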